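(* Let $n\ge3$, $\alpha\in\{\pm\}$, $m,\ell\in1+\mathbb Z_{\ge0}$, and consider the differential symmetry breaking operator $\mathbb D_{(m,\ell)}:I(\mathrm{triv},1-(m+\ell))^\alpha\to J(\mathrm{poly}^\ell_{n-1},1+\frac{\ell}{n-1})^{\alpha+m+\ell}$. As underlying $(\mathfrak g',K')$-modules the following hold. (1) If $\alpha=(-1)^m$, then $$\mathrm{Im}(\mathbb D_{(m,\ell)})\simeq\begin{cases}T_{G'}(n+\ell-1)&\text{if }\ell\in1+2\mathbb Z_{\ge0},\\ J(\mathrm{triv},1-\ell)^{\alpha+m}&\text{if }\ell\in2(1+\mathbb Z_{\ge0}).\end{cases}$$ (2) If $\alpha=(-1)^{m+1}$, then $$\mathrm{Im}(\mathbb D_{(m,\ell)})\simeq\begin{cases}J(\mathrm{triv},1-\ell)^{\alpha+m}&\text{if }\ell\in1+2\mathbb Z_{\ge0},\\ T_{G'}(n+\ell-1)&\text{if }\ell\in2(1+\mathbb Z_{\ge0}).\end{cases}$$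
   Context: Groups: $G=SL(n+1,\mathbb R)$, $G'=\{\mathrm{diag}(g',1):g'\in SL(n,\mathbb R)\}\subset G$, $\mathfrak g'=\mathfrak{sl}(n,\mathbb C)$, $K'\simeq SO(n)$ maximal compact in $G'$; the underlying $(\mathfrak g',K')$-module is the space of $K'$-finite vectors. With matrix units $E_{i,j}$ put $N_j^+=E_{1,j+1}$, $N_j^-=E_{j+1,1}$ ($1\le j\le n$), $\widetilde H_0=\frac1n\mathrm{diag}(n,-1,\dots,-1)$, $\widetilde H_0'=\frac1{n-1}\mathrm{diag}(n-1,-1,\dots,-1,0)$. Let $N_\pm=\exp(\mathrm{span}_{\mathbb R}\{N_1^\pm,\dots,N_n^\pm\})$, $N'_\pm=\exp(\mathrm{span}_{\mathbb R}\{N_1^\pm,\dots,N_{n-1}^\pm\})$, $A=\exp(\mathbb R\widetilde H_0)$, $A'=\exp(\mathbb R\widetilde H_0')$, $M=\{\mathrm{diag}(\det(g)^{-1},g):g\in SL^\pm(n,\mathbb R)\}$, $M'=\{\mathrm{diag}(\det(g')^{-1},g',1):g'\in SL^\pm(n-1,\mathbb R)\}$, $SL^\pm(k,\mathbb R)=\{\det=\pm1\}$. $P=MAN_+$, $P'=M'A'N_+'$. Signs: $\{\pm\}\equiv\{\pm1\}$; $\delta+k$ denotes the sign $\delta\cdot(-1)^k$. Representations: $\mathbb C_\lambda$ is the character $\exp(t\widetilde H_0)\mapsto e^{\lambda t}$ of $A$, $\mathbb C_\nu$ the character $\exp(t\widetilde H'_0)\mapsto e^{\nu t}$ of $A'$;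 $\mathrm{sgn}^+=1$, $\mathrm{sgn}^-=\mathrm{sgn}(\det)$ on $SL^\pm$. $\mathrm{poly}^\ell_{n-1}$ is the representation of $SL^\pm(n-1,\mathbb R)$ on $\mathbb C^\ell[y_1,\dots,y_{n-1}]$ (homogeneous degree $\ell$), $(g\cdot p)(v)=p(g^{-1}v)$. $I(\mathrm{triv},\lambda)^\alpha=\mathrm{Ind}_P^G(\mathrm{sgn}^\alpha\boxtimes\mathbb C_\lambda)$, $J(\varpi,\nu)^\beta=\mathrm{Ind}_{P'}^{G'}((\mathrm{sgn}^\beta\otimes\varpi)\boxtimes\mathbb C_\nu)$ (unnormalized smooth induction, $\mathrm{Ind}_P^G(\sigma)=\{f\in C^\infty(G,V):f(gp)=\sigma(p)^{-1}f(g)\}$ with left translation). Coordinates and operator: via $\mathbb R^n\simeq N_-$, $x\mapsto\exp(\sum x_jN_j^-)$, $\mathbb R^{n-1}=\{x_n=0\}\simeq N'_-$, the representations are realized in $C^\infty(\mathbb R^n)$ and $C^\infty(\mathbb R^{n-1})\otimes W$, and $\mathbb D_{(m,\ell)}=\mathrm{Rest}_{x_n=0}\circ\frac{\partial^m}{\partial x_n^m}\sum_{\mathbf l}\frac{\partial^\ell}{\partial x^{\mathbf l}}\otimes\widetilde y_{\mathbf l}$, the sum over $\mathbf l\in(\mathbb Z_{\ge0})^{n-1}$ with $|\mathbf l|=\ell$, where $\frac{\partial^\ell}{\partial x^{\mathbf l}}=\prod_{j<n}\partial_{x_j}^{\ell_j}$, $\widetilde y_{\mathbf l}=\prod_{j<n}y_j^{\ell_j}/\ell_j!$,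 $(\mathrm{Rest}_{x_n=0}f)(x')=f(x',0)$. Composition factors: for $\nu=1-\ell$ with $\ell\in1+\mathbb Z_{\ge0}$ and $\beta=(-1)^{1-\ell}$, $J(\mathrm{triv},1-\ell)^\beta$ has a finite-dimensional irreducible subrepresentation $F_{G'}(1-\ell)^\beta$, and the quotient $J(\mathrm{triv},1-\ell)^\beta/F_{G'}(1-\ell)^\beta$ is irreducible and infinite-dimensional; this quotient is denoted $T_{G'}(n+\ell-1)^\beta$, or simply $T_{G'}(n+\ell-1)$ (so there is an exact sequence $0\to F_{G'}(1-\ell)^\beta\to J(\mathrm{triv},1-\ell)^\beta\to T_{G'}(n+\ell-1)^\beta\to0$). For $\beta\ne(-1)^{1-\ell}$, $J(\mathrm{triv},1-\ell)^\beta$ is irreducible. In the claim the relevant sign is $\beta=\alpha+m$. *)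

(* Defs.v *)
From HB Require Import structures.
From mathcomp Require Import all_boot all_order all_algebra.
From mathcomp Require Import complex.
From mathcomp Require Import all_classical all_reals all_analysis.
From mathcomp Require mpoly.
From mathcomp Require Import -(notations) mpoly.

Set Implicit Arguments.
Unset Strict Implicit.
Unset Printing Implicit Defensive.

Import Order.TTheory GRing.Theory Num.Theory.
Import numFieldNormedType.Exports.

Local Open Scope classical_set_scope.
Local Open Scope ring_scope.
Local Open Scope complex_scope.

(* Throughout, n = k.+2, so that n - 1 = k.+1.  G = SL(n+1,R) is SL R k.+3 and
   G' = {diag(g',1)} is identified with SL(n,R) = SL R k.+2 along g' |->
   diag(g',1) (SLemb below).  Under this identification the parabolic P' of G'
   is the parabolic P of SL(N+1,R) for N = n - 1, so P, P' and the two
   inductions are defined once, for SL R N.+1. *)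

Record SL (R : realType) (N : nat) :=
  MkSL { slmx :> 'M[R]_N; _ : \det slmx == 1 }.

HB.instance Definition _ (R : realType) N := [isSub for @slmx R N].
HB.instance Definition _ (R : realType) N := [Choice of SL R N by <:].

Section SLGroup.
Variables (R : realType) (N : nat).
Implicit Types g h : SL R N.

Lemma SL_det g : \det (slmx g) = 1.
Proof. by case: g => g /= /eqP. Qed.

Lemma SL_unit g : slmx g \in unitmx.
Proof. by rewrite unitmxE SL_det unitr1. Qed.

Fact SL_one_subproof : \det (1%:M : 'M[R]_N) == 1.
Proof. by rewrite det1. Qed.
Definition SL_one : SL R N := MkSL SL_one_subproof.

Fact SL_mul_subproof g h : \det (slmx g *m slmx h) == 1.
Proof. by rewrite det_mulmx !SL_det mulr1. Qed.
Definition SL_mul g h : SL R N := MkSL (SL_mul_subproof g h).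

Fact SL_inv_subproof g : \det (invmx (slmx g)) == 1.
Proof. by rewrite det_inv SL_det invr1. Qed.
Definition SL_inv g : SL R N := MkSL (SL_inv_subproof g).

Fact SL_mulA : associative SL_mul.
Proof. by move=> a b c; apply: val_inj; rewrite /= mulmxA. Qed.
Fact SL_mul1 : left_id SL_one SL_mul.
Proof. by move=> a; apply: val_inj; rewrite /= mul1mx. Qed.
Fact SL_mulr1 : right_id SL_one SL_mul.
Proof. by move=> a; apply: val_inj; rewrite /= mulmx1. Qed.
Fact SL_mulV : left_inverse SL_one SL_inv SL_mul.
Proof. by move=> a; apply: val_inj; rewrite /= mulVmx // SL_unit. Qed.
Fact SL_mulrV : right_inverse SL_one SL_inv SL_mul.
Proof. by move=> a; apply: val_inj; rewrite /= mulmxV // SL_unit. Qed.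

HB.instance Definition _ := isGroup.Build (SL R N)
  SL_mulA SL_mul1 SL_mulr1 SL_mulV SL_mulrV.

End SLGroup.

Fact SLemb_subproof (R : realType) N (g : SL R N) :
  \det (castmx (addn1 N, addn1 N) (block_mx (slmx g) 0 0 (1%:M : 'M[R]_1))) == 1.
Proof.
have cast p q (e : p = q) (A : 'M[R]_p) : \det (castmx (e, e) A) = \det A.
  by case: q / e; rewrite castmx_id.
by rewrite cast det_ublock SL_det det1 mulr1.
Qed.
Definition SLemb (R : realType) N (g : SL R N) : SL R N.+1 :=
  MkSL (SLemb_subproof g).

Definition expm (R : realType) N (X : 'M[R]_N) : 'M[R]_N :=
  limn (series (fun j => (j`!%:R : R)^-1 *: X ^+ j)).

(* exp(X) as an element of SL(N,R); the default value 1 is only met when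
   \det (expm X) != 1, i.e. when \tr X != 0. *)
Definition SLexp (R : realType) N (X : 'M[R]_N) : SL R N :=
  insubd (1%g : SL R N) (expm X).

Section Calculus.
Variable R : realType.

(* R[i] carries no normed R-module structure in the library, so complex-valued
   functions of real variables are differentiated componentwise. *)
Definition cderive (E : normedModType R) (v : E) (f : E -> R[i]) (x : E) :
    R[i] :=
  ('D_v (fun y => complex.Re (f y) : R^o) x)
    +i* ('D_v (fun y => complex.Im (f y) : R^o) x).

(* For finite-dimensional E and open U this is C^oo(U): all iterated
   directional derivatives exist and are continuous on U. *)
Definition smooth_on (E : normedModType R) (U : set E) (f : E -> R[i]) :=
  forall (vs : seq E) (x : E), U x ->
    let g := foldr (@cderive E) f vs in
    [/\ {for x, continuous (fun y => complex.Re (g y) : R^o)},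
        {for x, continuous (fun y => complex.Im (g y) : R^o)},
        forall v, derivable (fun y => complex.Re (g y) : R^o) x v &
        forall v, derivable (fun y => complex.Im (g y) : R^o) x v].

(* SL(N,R) is an embedded submanifold of M_N(R): smooth means locally the
   restriction of a smooth function on an open set of matrices. *)
Definition smooth_SL N (f : SL R N -> R[i]) :=
  forall g : SL R N, exists (U : set 'M[R]_N) (F : 'M[R]_N -> R[i]),
    [/\ open U, U (slmx g), smooth_on U F &
        forall h : SL R N, U (slmx h) -> F (slmx h) = f h].

Section VectorValued.
Variable V : vectType R[i].

Definition vsmooth_SL N (f : SL R N -> V) :=
  forall i, smooth_SL (fun g => coord (vbasis fullv) i (f g)).

Definition vderive (c : R -> V) (t : R) : V :=
  \sum_i (cderive (1 : R^o) (fun s : R^o => coord (vbasis fullv) i (c s)) t)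
         *: (vbasis (fullv : {vspace V}))`_i.

End VectorValued.
End Calculus.

Section Induction.
Variables (R : realType) (N : nat).

Definition levi (h : 'M[R]_N) : 'M[R]_N.+1 :=
  block_mx ((\det h)^-1%:M : 'M[R]_1) 0 0 h : 'M[R]_(1 + N).

Definition H0 : 'M[R]_N.+1 :=
  N%:R^-1 *: (block_mx (N%:R%:M : 'M[R]_1) 0 0 (- 1%:M) : 'M[R]_(1 + N)).

Definition Nplus (x : 'rV[R]_N) : 'M[R]_N.+1 :=
  \sum_j x 0 j *: delta_mx ord0 (lift ord0 j).

Definition Nminus (x : 'rV[R]_N) : 'M[R]_N.+1 :=
  \sum_j x 0 j *: delta_mx (lift ord0 j) ord0.

Definition nbar (x : 'rV[R]_N) : SL R N.+1 := SLexp (Nminus x).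

Definition SLpm : set 'M[R]_N := [set h | \det h = 1 \/ \det h = -1].

(* signs are the integers 1 and -1 *)
Definition sgn_pow (delta : int) (h : 'M[R]_N) : R :=
  if delta == 1 then 1 else Num.sg (\det h).

(* Ind_P^G((sgn^delta (x) rho) [x] C_lambda), with rho a representation of
   SL^pm(N,R) on V:  f(gp) = sigma(p)^-1 f(g)  for  p = m a n  in  M A N_+. *)
Definition Ind (V : vectType R[i]) (rho : 'M[R]_N -> V -> V) (delta : int)
    (lambda : R) : set (SL R N.+1 -> V) :=
  [set f | vsmooth_SL f /\
    forall (g p : SL R N.+1) (h : 'M[R]_N) (t : R) (x : 'rV[R]_N),
      SLpm h ->
      slmx p = levi h *m expm (t *: H0) *m expm (Nplus x) ->
      f (g * p)%g = (sgn_pow delta h * expR (lambda * t))^-1%:C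
                      *: rho (invmx h) (f g)].

Definition triv (h : 'M[R]_N) (z : R[i]^o) : R[i]^o := z.

End Induction.

Section PolyRep.
Variables (R : realType) (N l : nat).

(* the coordinates of h^-1 v as linear forms in v *)
Definition linforms (h : 'M[R]_N) : N.-tuple (mpoly N R[i]) :=
  [tuple \sum_(j < N) (invmx h i j)%:C *: mpolyX R[i] (mnm1 j) | i < N].

Fact poly_rep_subproof (h : 'M[R]_N) (p : dhomog N R[i] l) :
  comp_mpoly (linforms h) (mpoly_of_dhomog p) \is ishomog1 l mdeg.
Proof.
rewrite comp_mpolyEX big_seq; apply: rpred_sum => a ap; apply: rpredZ.
have al : mdeg a = l by apply: (dhomog_mf (dhomog_is_dhomog p) ap).
rewrite comp_mpolyX -al mdegE.
elim/big_ind2: _ => [|x d y e hx hy|i _]; first exact: dhomog1.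
  exact: dhomogM.
suff /(dhomogMn (a i)) : tnth (linforms h) i \is ishomog1 1%N mdeg.
  by rewrite mul1n.
rewrite tnth_mktuple; apply: rpred_sum => j _; apply: rpredZ.
by rewrite dhomogX /= mdeg1.
Qed.

(* (h . p)(v) = p(h^-1 v) *)
Definition poly_rep (h : 'M[R]_N) (p : dhomog N R[i] l) : dhomog N R[i] l :=
  DHomog (poly_rep_subproof h p).

End PolyRep.

Section Representations.
Variables (R : realType) (N : nat).

Section OneSpace.
Variable V : vectType R[i].

Definition ltrans (g : SL R N) (f : SL R N -> V) : SL R N -> V :=
  fun h => f (g^-1 * h)%g.

Definition diff_ltrans (X : 'M[R]_N) (f : SL R N -> V) : SL R N -> V :=
  fun h => vderive (fun t => ltrans (SLexp (t *: X)) f h) 0.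

(* the complexified differential of left translation, for Z in sl(N,C) *)
Definition lie_act (Z : 'M[R[i]]_N) (f : SL R N -> V) : SL R N -> V :=
  fun h => diff_ltrans (map_mx (@complex.Re R) Z) f h
           + 'i *: diff_ltrans (map_mx (@complex.Im R) Z) f h.

Definition SO : set (SL R N) := [set k | (slmx k)^T *m slmx k = 1%:M].

(* The subquotient top/bot of the space of functions SL(N,R) -> V, with the
   action induced by left translation. *)
Record subquot := Subquot { top : set (SL R N -> V); bot : set (SL R N -> V) }.

Definition subrep (A : set (SL R N -> V)) : subquot := Subquot A [set 0].

Definition in_span (s : seq (SL R N -> V)) (u : SL R N -> V) :=
  exists c : 'I_(size s) -> R[i], u = \sum_i c i *: s`_i.

(* the vectors of top/bot whose K-translates span a finite-dimensional
   subspace of top/bot, where K = SO(N) *)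
Definition Kfinite (M : subquot) : subquot :=
  Subquot
    [set u | top M u /\
       exists2 s : seq (SL R N -> V), (forall w, w \in s -> top M w) &
         forall k, SO k ->
           exists2 w, in_span s w & bot M (ltrans k u - w)]
    (bot M).

Definition invariant_subspace (E : set (SL R N -> V)) :=
  [/\ E 0, forall (c : R[i]) u v, E u -> E v -> E (c *: u + v) &
      forall g u, E u -> E (ltrans g u)].

Definition findim_irreducible_subrep (A F : set (SL R N -> V)) :=
  [/\ F `<=` A, invariant_subspace F,
      exists s, forall u, F u -> in_span s u,
      F <> [set 0] &
      forall E, invariant_subspace E -> E `<=` F -> E = [set 0] \/ E = F].

End OneSpace.

(* Isomorphism of (sl(N,C), SO(N))-modules top M / bot M -> top M' / bot M',
   described by a map phi on representatives. *)
Definition gK_iso (V V' : vectType R[i]) (M : subquot V) (M' : subquot V') :=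
  exists phi : (SL R N -> V) -> (SL R N -> V'),
    [/\ forall u, top M u -> top M' (phi u),
        forall (c : R[i]) u v, top M u -> top M v ->
          bot M' (phi (c *: u + v) - (c *: phi u + phi v)),
        forall u, top M u -> (bot M' (phi u) <-> bot M u),
        forall u', top M' u' -> exists2 u, top M u & bot M' (u' - phi u) &
        (forall k u, SO k -> top M u ->
           bot M' (phi (ltrans k u) - ltrans k (phi u))) /\
        (forall (Z : 'M[R[i]]_N) u, \tr Z = 0 -> top M u ->
           bot M' (phi (lie_act Z u) - lie_act Z (phi u)))].

End Representations.

(* delta + k = delta * (-1)^k *)
Definition sgn_add (delta : int) (k : nat) : int := delta * (-1) ^+ k.

Section Modules.
Variables (R : realType) (k : nat).

Definition Itriv (alpha : int) (lambda : R) : set (SL R k.+3 -> R[i]^o) :=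
  Ind (@triv R k.+2) alpha lambda.

Definition Jtriv (beta : int) (nu : R) : set (SL R k.+2 -> R[i]^o) :=
  Ind (@triv R k.+1) beta nu.

Definition Jpoly (l : nat) (beta : int) (nu : R) :
    set (SL R k.+2 -> dhomog k.+1 R[i] l) :=
  Ind (@poly_rep R k.+1 l) beta nu.

(* F_G'(1-l)^beta, for beta = (-1)^(1-l) the unique finite-dimensional
   irreducible subrepresentation of J(triv,1-l)^beta *)
Definition Fsub (l : nat) (beta : int) : set (SL R k.+2 -> R[i]^o) :=
  xget [set 0] [set F | findim_irreducible_subrep (Jtriv beta (1 - l%:R)) F].

(* T_G'(n+l-1)^beta *)
Definition Tquot (l : nat) (beta : int) : subquot k.+2 R[i]^o :=
  Subquot (Jtriv beta (1 - l%:R)) (Fsub l beta).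

Section Operator.
Variables (m l : nat).

Definition dxn (u : 'rV[R]_k.+2 -> R[i]) : 'rV[R]_k.+2 -> R[i] :=
  cderive (delta_mx 0 ord_max) u.

Definition dx (j : 'I_k.+1) (u : 'rV[R]_k.+2 -> R[i]) : 'rV[R]_k.+2 -> R[i] :=
  cderive (delta_mx 0 (lift ord_max j)) u.

Definition dmulti (a : multinom k.+1) (u : 'rV[R]_k.+2 -> R[i]) :=
  foldr (fun j w => iter (a j) (dx j) w) u (enum 'I_k.+1).

(* x' |-> (x', 0) *)
Definition incl0 (x' : 'rV[R]_k.+1) : 'rV[R]_k.+2 :=
  \row_i oapp (x' 0) 0 (unlift ord_max i).

Definition ytilde (a : multinom k.+1) : mpoly k.+1 R[i] :=
  (\prod_j (a j)`!%:R)^-1 *: mpolyX R[i] a.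

Definition DO (u : 'rV[R]_k.+2 -> R[i]) (x' : 'rV[R]_k.+1) :
    mpoly k.+1 R[i] :=
  \sum_(a : bmultinom k.+1 l.+1 | mdeg a == l)
     iter m dxn (dmulti a u) (incl0 x') *: ytilde a.

(* f and phi correspond under D_(m,l) in the coordinates of N_- and N'_- *)
Definition coord_DO (f : SL R k.+3 -> R[i]^o)
    (phi : SL R k.+2 -> dhomog k.+1 R[i] l) :=
  forall x', mpoly_of_dhomog (phi (nbar x')) = DO (fun x => f (nbar x)) x'.

(* D_(m,l) as an operator with values in J: since N'_- P' is dense in G', an
   element of J is determined by its coordinate expression. *)
Definition DSBO (J : set (SL R k.+2 -> dhomog k.+1 R[i] l))
    (f : SL R k.+3 -> R[i]^o) : SL R k.+2 -> dhomog k.+1 R[i] l :=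
  xget 0 [set phi | J phi /\ coord_DO f phi].

Definition symmetry_breaking (I : set (SL R k.+3 -> R[i]^o))
    (J : set (SL R k.+2 -> dhomog k.+1 R[i] l)) :=
  (forall f, I f -> J (DSBO J f) /\ coord_DO f (DSBO J f)) /\
  (forall g f, I f -> DSBO J (ltrans (SLemb g) f) = ltrans g (DSBO J f)).

Definition Im_DSBO (I : set (SL R k.+3 -> R[i]^o))
    (J : set (SL R k.+2 -> dhomog k.+1 R[i] l)) :=
  subrep (DSBO J @` I).

End Operator.
End Modules.

(* Main.v *)
From HB Require Import structures.
Require Import Defs.
From mathcomp Require Import all_boot all_order all_algebra.
From mathcomp Require Import complex.
From mathcomp Require Import all_classical all_reals all_analysis.
From mathcomp Require mpoly.
From mathcomp Require Import -(notations) mpoly.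
From mathcomp Require Import ring.
Import Order.TTheory GRing.Theory Num.Theory.
Import numFieldNormedType.Exports.
Local Open Scope classical_set_scope.
Local Open Scope ring_scope.
Set Implicit Arguments.
Unset Strict Implicit.
Unset Printing Implicit Defensive.

(* Evaluating at the first basis vector e_0 turns J(triv,1-l)^b into the smooth
   functions psi on R^n \ 0 that are homogeneous of degree l-1 with parity b, and
   I(triv,1-(m+l))^alpha into those on R^(n+1) \ 0 of degree m+l-1.  In this
   picture D_(m,l) is the composite of two explicit maps.  The first takes the
   m-th normal derivative along {x_n = 0}; it is onto, because x_n^m/m! psi(x')
   times a homogeneous cut-off vanishing near x' = 0 is a preimage of psi.  The
   second sends psi to the polynomial y |-> (1/l!) (D_{g(0,y)})^l psi (g e_0); it
   lands in J(poly) because D_w^(l-1) psi is homogeneous of degree 0, so that by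
   Euler's identity D_w^l psi (x) depends only on w modulo x.  Its kernel consists
   of the psi that are polynomial of degree < l on every line.  Comparing the
   values of psi at x + s v and at v + x/s shows that such a psi is 0 if
   b <> (-1)^(l-1), and a homogeneous polynomial of degree l-1 otherwise.  The
   latter polynomials form F_G'(1-l): they are irreducible, and a torus argument
   puts every finite-dimensional subrepresentation inside them.  The image is
   therefore J/ker, with the (g',K')-structure transported along the operator. *)

(** * Smooth functions *)

(** The definitions supply only directional derivatives of real and imaginary parts, one direction
    at a time. Linearity in the direction, the chain rule and the symmetry of mixed derivatives are
    therefore derived from the mean value theorem and the continuity of iterated directional
    derivatives; Euler's identity, the coordinate form of the operator and the Lie algebra action
    all rest on them. The two parities arise on a single line. There psi(x + s v) is a polynomial in
    s, and by homogeneity it also equals |s|^(l-1) sgn(s)^b times a polynomial in 1/s. Positive s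
    bounds the degree by l-1; negative s forces a sign that only b = (-1)^(l-1) allows unless psi
    vanishes. Since b = alpha (-1)^m, this is the case distinction of the theorem. Two objects are
    given by choice rather than by a formula. The operator picks an element of J with a prescribed
    coordinate expression, so density of N'_-P' is what determines it. F_G'(1-l) is any
    finite-dimensional irreducible subrepresentation, so uniqueness must be shown before the
    quotient can be identified. For the same reason the isomorphism picks preimages and is linear
    and equivariant only modulo the kernel. *)

Section Line.
Variables (R : realType) (E W : normedModType R).
Implicit Types (f : E -> W) (x v : E) (t : R).

Lemma is_derive_line f x v t d :
  is_derive (x + t *: v) v f d <-> is_derive t 1 (fun h : R => f (x + h *: v)) d.
Proof.
have e : (fun h : R => h^-1 *: ((f \o shift (x + t *: v)) (h *: v) - f (x + t *: v)))
  = (fun h : R => h^-1 *: (((fun h : R => f (x + h *: v)) \o shift t) (h *: (1 : R)) -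
       (fun h : R => f (x + h *: v)) t)).
  apply/funext => h /=; rewrite [h%:A]mulr1 scalerDl.
  by rewrite [h *: v + _]addrCA.
split=> -[h1 h2]; split.
- by rewrite /derivable -e.
- by rewrite -h2 /derive e.
- by rewrite /derivable e.
- by rewrite -h2 /derive e.
Qed.

Lemma is_derive_line0 f x v d :
  is_derive x v f d <-> is_derive (0 : R) 1 (fun h : R => f (x + h *: v)) d.
Proof. by rewrite -is_derive_line scale0r addr0. Qed.

Lemma is_derive_scaledir f x v s d :
  is_derive x v f d -> is_derive x (s *: v) f (s *: d).
Proof.
move=> /is_derive_line0[h1 h2]; apply/is_derive_line0.
have hd : is_diff (0 : R) (fun h : R => f (x + h *: v)) ( *:%R^~ d).
  by split; [exact/derivable1_diffP | rewrite deriv1E // derive1E h2].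
have hm : is_diff (0 : R) ( *%R^~ s : R -> R) ( *%R^~ s).
  have [/= p q] := @is_diff_scalel R R 0 s; split; first exact: p.
  by rewrite [LHS]q.
have hd' : is_diff ((0 : R) * s) (fun h : R => f (x + h *: v)) ( *:%R^~ d) by rewrite mul0r.
have hh := is_diff_comp hm hd'.
have -> : (fun h : R => f (x + h *: (s *: v))) = (fun h : R => f (x + h *: v)) \o ( *%R^~ s).
  by apply/funext => h /=; rewrite scalerA.
have [p q] := hh; split; first exact: diff_derivable.
by rewrite deriveE // q /= mul1r.
Qed.
End Line.

Section Mvt.
Variables (R : realType) (E : normedModType R).
Implicit Types (f : E -> R) (x v : E).

(** Parametrising the segment from x to x + s v by [0,1] treats both signs of s at once. *)
Lemma mvt_line f x v (s : R) :
  (forall t, `|t| <= `|s| -> derivable f (x + t *: v) v) ->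
  exists2 t, `|t| <= `|s| & f (x + s *: v) - f x = s * 'D_v f (x + t *: v).
Proof.
move=> df.
pose g (t : R) := f (x + t *: (s *: v)).
have dg (t : R) : t \in `[0, 1]%R -> is_derive t 1 g (s * 'D_v f (x + (t * s) *: v)).
  rewrite in_itv => /andP[t0 t1].
  have h : `|t * s| <= `|s| by rewrite normrM (ger0_norm t0) ler_piMl.
  have := is_derive_scaledir s (DeriveDef (df _ h) erefl).
  by rewrite -scalerA is_derive_line.
have dg' (t : R) : t \in `]0, 1[%R -> is_derive t 1 g (s * 'D_v f (x + (t * s) *: v)).
  by move=> /subset_itv_oo_cc; exact: dg.
have cg : {within `[0, 1], continuous g}.
  by apply: derivable_within_continuous => t /dg[].
have [c] := MVT (@ltr01 R) dg' cg.
rewrite in_itv /= => /andP[c0 c1] e.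
exists (c * s); first by rewrite normrM (gtr0_norm c0) ler_piMl // ltW.
by move: e; rewrite /g scale1r scale0r addr0 subr0 mulr1.
Qed.
End Mvt.

Section Chain.
Variables (R : realType) (E : normedModType R) (I : finType) (v : I -> E).
Variables (F : E -> R) (x : E).
Hypothesis dF : forall i, \forall y \near x, derivable F y (v i).
Hypothesis cF : forall i, {for x, continuous ('D_(v i) F)}.

(** The path from z moves along one [v i] at a time. The mean value theorem turns each increment
    into [t i] times a derivative at a nearby point, and continuity replaces that point by x. The
    [v i] are an arbitrary finite family of directions. *)
Lemma C1_expand (s : seq I) (e : R) : 0 < e -> exists2 d : R, 0 < d &
  forall (z : E) (t : I -> R), `|z - x| < d -> (forall i, `|t i| <= d) ->
  `|F (z + \sum_(i <- s) t i *: v i) - F z - \sum_(i <- s) t i * 'D_(v i) F x|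
    <= e * \sum_(i <- s) `|t i|.
Proof.
move=> e0; elim: s => [|i s [d d0 IH]].
  by exists 1 => // z t _ _; rewrite !big_nil addr0 subrr subr0 normr0 mulr0.
have [r /= r0 hr] : exists2 r : R, 0 < r & forall y, `|y - x| < r ->
    derivable F y (v i) /\ `|'D_(v i) F y - 'D_(v i) F x| <= e.
  have h1 := dF i; have /cvgrPdist_le/(_ _ e0) h2 := @cF i.
  have [r r0 hr] := (nbhs_ballP _ _).1 (filterI h1 h2).
  exists r => // y yx; have [|p q] := hr y; first by rewrite -ball_normE /= distrC.
  by split => //; rewrite distrC.
(* M exceeds 1 plus the sum of the norms of the directions, so with steps of size at most r / M the
   whole broken path stays within r of x. *)
pose M := 2 + \sum_(j <- i :: s) `|v j|.
have M0 : 0 < M by rewrite ltr_pwDl// sumr_ge0.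
exists (Num.min d (r / M)); first by rewrite lt_min d0 divr_gt0.
move=> z t; rewrite lt_min => /andP[zd zr] td.
have td1 j : `|t j| <= d by have := td j; rewrite le_min => /andP[].
have td2 j : `|t j| <= r / M by have := td j; rewrite le_min => /andP[].
have {}IH := IH z t zd td1.
set z' := z + \sum_(j <- s) t j *: v j in IH *.
have hz tau : `|tau| <= `|t i| -> `|z' + tau *: v i - x| < r.
  move=> ht; have -> : z' + tau *: v i - x = (z - x) + (tau *: v i + \sum_(j <- s) t j *: v j).
    rewrite /z' -!addrA; congr (_ + _).
    by rewrite addrA addrC [\sum_(_ <- _) _ + _]addrC.
  apply: (le_lt_trans (ler_normD _ _)).
  have : `|tau *: v i + \sum_(j <- s) t j *: v j| <= r / M * (\sum_(j <- i :: s) `|v j|).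
    rewrite big_cons mulrDr; apply: (le_trans (ler_normD _ _)); apply: lerD.
      by rewrite normrZ ler_wpM2r//; exact: le_trans (td2 i).
    rewrite mulr_sumr; apply: (le_trans (ler_norm_sum _ _ _)); apply: ler_sum => j _.
    by rewrite normrZ ler_wpM2r.
  move=> h; apply: (lt_le_trans (ltr_leD zr h)).
  rewrite -{1}[r / M]mulr1 -mulrDr -[leRHS](divfK (lt0r_neq0 M0)).
  by rewrite ler_wpM2l ?divr_ge0 ?(ltW r0) ?(ltW M0)// /M lerD2r ler1n.
have [tau ht e1] : exists2 tau, `|tau| <= `|t i| &
    F (z' + t i *: v i) - F z' = t i * 'D_(v i) F (z' + tau *: v i).
  by apply: mvt_line => tau ht; apply: (hr _ (hz _ ht)).1.
rewrite !big_cons [t i *: _ + _]addrC addrA -/z'.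
have -> : F (z' + t i *: v i) - F z -
   (t i * 'D_(v i) F x + \sum_(j <- s) t j * 'D_(v j) F x) =
   t i * ('D_(v i) F (z' + tau *: v i) - 'D_(v i) F x) +
   (F z' - F z - \sum_(j <- s) t j * 'D_(v j) F x).
  by rewrite mulrBr -e1; ring.
apply: (le_trans (ler_normD _ _)); rewrite [leRHS]mulrDr; apply: lerD => //.
by rewrite normrM mulrC ler_wpM2r//; exact: (hr _ (hz _ ht)).2.
Qed.

Lemma chain_curve (t : I -> R -> R) (d : I -> R) :
  (forall i, t i 0 = 0) -> (forall i, is_derive (0 : R) 1 (t i) (d i)) ->
  is_derive (0 : R) 1 (fun h => F (x + \sum_i t i h *: v i))
    (\sum_i d i * 'D_(v i) F x).
Proof.
move=> t0 dt.
pose G h := F (x + \sum_i t i h *: v i).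
have q i : (fun h : R => h^-1 * t i h) @ 0^' --> d i.
  have [/cvg_ex[l hl] e] := dt i.
  have <- : l = d i by rewrite -e; apply/esym/cvg_lim.
  have e1 : (fun h : R => h^-1 *: ((t i \o shift 0) (h%:A) - t i 0)) = (fun h : R => h^-1 * t i h).
    by apply/funext => h /=; rewrite t0 subr0 addr0 [h%:A]mulr1.
  by rewrite -e1.
have ct i : {for (0 : R), continuous (t i)}.
  by apply: differentiable_continuous; apply/derivable1_diffP; case: (dt i).
suff H : (fun h : R => h^-1 *: ((G \o shift 0) (h%:A) - G 0)) @ 0^' -->
    (\sum_i d i * 'D_(v i) F x).
  by split; [apply/cvg_ex; eexists; exact: H | exact: cvg_lim].
have -> : (fun h : R => h^-1 *: ((G \o shift 0) (h%:A) - G 0)) =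
   (fun h : R => h^-1 * (G h - F x)).
  apply/funext => h /=; rewrite addr0 [h%:A]mulr1 {2}/G big1 ?addr0// => i _.
  by rewrite t0 scale0r.
have sum_cvg (g : I -> R -> R) (l : I -> R) : (forall i, g i @ 0^' --> l i) ->
    (fun h : R => \sum_i g i h) @ 0^' --> (\sum_i l i).
  by move=> gl; apply: cvg_big => //; exact: add_continuous.
have p : (fun h : R => \sum_i (h^-1 * t i h) * 'D_(v i) F x) @ 0^' -->
    (\sum_i d i * 'D_(v i) F x).
  by apply: sum_cvg => i; apply: cvgMl; exact: q.
have n : (fun h : R => \sum_i `|h^-1 * t i h|) @ 0^' --> (\sum_i `|d i|).
  by apply: sum_cvg => i; apply: cvg_norm; exact: q.
(* The sum of the |t i h / h| tends to S - 1, hence is eventually at most S; the expansion error is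
   taken relative to e / 2 / S. *)
pose S := \sum_i `|d i| + 1.
have S0 : 0 < S by rewrite ltr_wpDl ?sumr_ge0.
apply/cvgrPdist_lt => e e0.
have e2 : 0 < e / 2 by rewrite divr_gt0.
have [r r0 hr] := C1_expand (index_enum I) (divr_gt0 e2 S0).
have xr : `|x - x| < r by rewrite subrr normr0.
near=> h.
have th i : `|t i h| <= r.
  move: i; near: h; apply: filter_forall => i; apply: cvg_within.
  have /cvgrPdist_le/(_ _ r0) := ct i.
  by apply: filterS => h; rewrite t0 sub0r normrN.
have {th} := hr x (fun i => t i h) xr th.
rewrite -/(G h).
set sm := \sum_(i <- _) _ => hG.
have hh : h != 0 by near: h; exact: nbhs_dnbhs_neq.
have -> : \sum_i d i * 'D_(v i) F x - h^-1 * (G h - F x) =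
  (\sum_i d i * 'D_(v i) F x - \sum_i (h^-1 * t i h) * 'D_(v i) F x) -
   h^-1 * (G h - F x - sm).
  rewrite [h^-1 * (_ - sm)]mulrBr [h^-1 * sm]mulr_sumr.
  under [X in _ - (_ - X)]eq_bigr do rewrite mulrA.
  ring.
apply: (le_lt_trans (ler_normB _ _)); rewrite (splitr e); apply: ltr_leD.
  by near: h; move/cvgrPdist_lt : p; apply.
rewrite normrM; apply: le_trans (_ : `|h^-1| * (e / 2 / S * \sum_i `|t i h|) <= _).
  by rewrite ler_wpM2l.
rewrite mulrCA mulr_sumr; under eq_bigr do rewrite -normrM.
rewrite -[leRHS](divfK (lt0r_neq0 S0)) (ler_wpM2l (ltW (divr_gt0 e2 S0)))//.
near: h; have /cvgrPdist_le/(_ _ ltr01) := n.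
apply: filterS => h; rewrite distrC => /(le_trans (ler_norm _)).
by rewrite lerBlDl.
Unshelve. all: by end_near.
Qed.
End Chain.

Section Directions.
Variables (R : realType) (E : normedModType R).
Implicit Types (F : E -> R) (x u v : E).

(** Linearity in the direction is the chain rule along the linear curves h |-> a i h. *)
Lemma is_derive_sumdir (I : finType) (v : I -> E) F x (a : I -> R) :
  (forall i, \forall y \near x, derivable F y (v i)) ->
  (forall i, {for x, continuous ('D_(v i) F)}) ->
  is_derive x (\sum_i a i *: v i) F (\sum_i a i * 'D_(v i) F x).
Proof.
move=> dF cF; apply/is_derive_line0.
have -> : (fun h : R => F (x + h *: (\sum_i a i *: v i))) =
  (fun h : R => F (x + \sum_i (a i *: id : R -> R) h *: v i)).
  apply/funext => h; rewrite scaler_sumr; congr (F (_ + _)).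
  by apply: eq_bigr => i _; rewrite scalerA mulrC.
apply: (chain_curve dF cF) => i; first by rewrite [LHS]mulr0.
have {2}-> : a i = a i *: (1 : R) by rewrite [RHS]mulr1.
exact: is_deriveZ.
Qed.

Let shift_quotient F (w x v : E) :
  (fun h : R => h^-1 *: (((fun y => F (y + w)) \o shift x) (h *: v) - F (x + w))) =
  (fun h : R => h^-1 *: ((F \o shift (x + w)) (h *: v) - F (x + w))).
Proof. by apply/funext => h /=; rewrite addrA. Qed.

Lemma derive_shift_arg F (w x v : E) :
  'D_v (fun y => F (y + w)) x = 'D_v F (x + w).
Proof. by rewrite /derive shift_quotient. Qed.

Lemma derivable_shift_arg F (w x v : E) :
  derivable (fun y => F (y + w)) x v = derivable F (x + w) v.
Proof. by rewrite /derivable shift_quotient. Qed.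

(** The mean value theorem is applied twice: to the difference in the direction v as a function
    along u, then to D_u F along v. *)
Lemma double_difference F x u v (s : R) :
  (forall a b, `|a| <= `|s| -> `|b| <= `|s| ->
    derivable F (x + a *: u + b *: v) u /\
    derivable ('D_u F) (x + a *: u + b *: v) v) ->
  exists a b, [/\ `|a| <= `|s|, `|b| <= `|s| &
    F (x + s *: u + s *: v) - F (x + s *: u) - F (x + s *: v) + F x =
    s * (s * 'D_v ('D_u F) (x + a *: u + b *: v))].
Proof.
move=> dF.
have s0 : `|(0 : R)| <= `|s| by rewrite normr0.
pose G y := F (y + s *: v) - F y.
have d1 a : `|a| <= `|s| -> derivable (fun y => F (y + s *: v)) (x + a *: u) u.
  by move=> ha; rewrite derivable_shift_arg; exact: (dF _ _ ha (lexx _)).1.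
have d2 a : `|a| <= `|s| -> derivable F (x + a *: u) u.
  by move=> ha; have := (dF _ _ ha s0).1; rewrite scale0r addr0.
have [a ha ea] : exists2 a, `|a| <= `|s| &
    G (x + s *: u) - G x = s * 'D_u G (x + a *: u).
  by apply: mvt_line => a ha; apply: derivableB; [exact: d1|exact: d2].
have [b hb eb] : exists2 b, `|b| <= `|s| & 'D_u F (x + a *: u + s *: v) -
    'D_u F (x + a *: u) = s * 'D_v ('D_u F) (x + a *: u + b *: v).
  apply: (@mvt_line _ _ ('D_u F)) => b hb; exact: (dF _ _ ha hb).2.
exists a, b; split=> //.
rewrite -eb -derive_shift_arg -deriveB; [|exact: d1|exact: d2].
by rewrite -ea /G; ring.
Qed.

(** The second difference is symmetric in u and v, so [double_difference] read in both orders gives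
    equal mixed derivatives at two points near x; continuity brings both points to x up to e / 2. *)
Lemma clairaut F x u v :
  (\forall y \near x, [/\ derivable F y u, derivable F y v,
     derivable ('D_u F) y v & derivable ('D_v F) y u]) ->
  {for x, continuous ('D_v ('D_u F))} -> {for x, continuous ('D_u ('D_v F))} ->
  'D_v ('D_u F) x = 'D_u ('D_v F) x.
Proof.
move=> dF c1 c2; apply/eqP; rewrite -subr_eq0 -normr_le0; apply/ler_addgt0Pl => e e0.
rewrite addr0; have e2 : 0 < e / 2 by rewrite divr_gt0.
have /cvgrPdist_le/(_ _ e2) h1 := c1; have /cvgrPdist_le/(_ _ e2) h2 := c2.
have [r /= r0 hr] := (nbhs_ballP _ _).1 (filterI dF (filterI h1 h2)).
pose M := 1 + `|u| + `|v|.
have M0 : 0 < M by rewrite /M -addrA ltr_pwDl ?addr_ge0.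
pose s := r / M; have s0 : 0 < s by rewrite divr_gt0.
have hb a b : `|a| <= `|s| -> `|b| <= `|s| -> ball x r (x + a *: u + b *: v).
  rewrite (gtr0_norm s0) -ball_normE /= => ha hb.
  rewrite -addrA opprD addNKr normrN.
  apply: (le_lt_trans (ler_normD _ _)); rewrite !normrZ.
  apply: (@le_lt_trans _ _ (s * (`|u| + `|v|))).
    by rewrite mulrDr lerD // ler_wpM2r.
  rewrite -[ltRHS](divfK (lt0r_neq0 M0)) ltr_pM2l//.
  by rewrite /M -addrA ltr_pwDl.
have [a [b [ha hb1 e1]]] : exists a b, [/\ `|a| <= `|s|, `|b| <= `|s| &
    F (x + s *: u + s *: v) - F (x + s *: u) - F (x + s *: v) + F x =
    s * (s * 'D_v ('D_u F) (x + a *: u + b *: v))].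
  apply: double_difference => a b ha hb1.
  by have [[p1 _ p2 _] _] := hr _ (hb a b ha hb1); split; [exact: p1|exact: p2].
have [a' [b' [ha' hb' e3]]] : exists a b, [/\ `|a| <= `|s|, `|b| <= `|s| &
    F (x + s *: v + s *: u) - F (x + s *: v) - F (x + s *: u) + F x =
    s * (s * 'D_u ('D_v F) (x + a *: v + b *: u))].
  apply: double_difference => a' b' ha' hb'; rewrite addrAC.
  by have [[_ p1 _ p2] _] := hr _ (hb b' a' hb' ha'); split; [exact: p1|exact: p2].
rewrite [x + s *: v + _]addrAC [X in X + F x]addrAC in e3.
have e4 := etrans (esym e1) e3.
have {}e4 : 'D_v ('D_u F) (x + a *: u + b *: v) = 'D_u ('D_v F) (x + b' *: u + a' *: v).
  have ss : s != 0 by rewrite gt_eqF.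
  by move: e4; rewrite [x + a' *: v + _]addrAC => /(mulfI ss)/(mulfI ss).
have [_ [k1 _]] := hr _ (hb a b ha hb1); have [_ [_ k2]] := hr _ (hb b' a' hb' ha').
move: k1 k2; rewrite e4.
move: ('D_v ('D_u F) x) ('D_u ('D_v F) x) ('D_u ('D_v F) _) => A B C k1 k2.
have -> : A - B = (A - C) - (B - C) by ring.
by apply: (le_trans (ler_normB _ _)); rewrite (splitr e) lerD.
Qed.
End Directions.

Section Cn.
Variables (R : realType).

(* Continuity of all iterated directional derivatives up to order k. *)
Fixpoint Cn (E : normedModType R) (k : nat) (U : set E) (f : E -> R) : Prop :=
  (forall x, U x -> {for x, continuous f}) /\
  if k is k'.+1 then
    forall v, (forall x, U x -> derivable f x v) /\ Cn k' U ('D_v f)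
  else True.

Section Basic.
Variables (E : normedModType R).
Implicit Types (U V : set E) (f g : E -> R) (k : nat).

Lemma near_open U x (P : E -> Prop) : open U -> U x -> (forall y, U y -> P y) ->
  \forall y \near x, P y.
Proof. by move=> oU Ux h; apply: filterS (open_nbhs_nbhs (conj oU Ux)). Qed.

Lemma Cn_cont k U f x : Cn k U f -> U x -> {for x, continuous f}.
Proof. by case: k => [|k] [h _]; apply: h. Qed.

Lemma Cn_le k U f : Cn k.+1 U f -> Cn k U f.
Proof.
elim: k f => [|k IH] f [c h]; first by split.
by split=> // v; have [d /IH h'] := h v.
Qed.

Lemma Cn_sub k U V f : V `<=` U -> Cn k U f -> Cn k V f.
Proof.
move=> VU; elim: k f => [|k IH] f [c h]; split=> //; try by move=> x /VU; apply: c.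
by move=> v; have [d /IH h'] := h v; split=> // x /VU; apply: d.
Qed.

Lemma Cn_ext k U f g : open U -> (forall x, U x -> f x = g x) ->
  Cn k U f -> Cn k U g.
Proof.
move=> oU; elim: k f g => [|k IH] f g fg [c h].
  split=> // x Ux; rewrite /prop_for /continuous_at -(fg _ Ux).
  apply: cvg_trans (c _ Ux); apply: near_eq_cvg.
  exact: near_open fg.
split=> [x Ux|v].
  rewrite /prop_for /continuous_at -(fg _ Ux).
  by apply: cvg_trans (c _ Ux); apply: near_eq_cvg; exact: near_open fg.
have [d h'] := h v; split=> [x Ux|].
  by apply: near_eq_derivable (d _ Ux); exact: near_open fg.
by apply: IH h' => x Ux; apply: near_eq_derive; exact: near_open fg.
Qed.

Lemma Cn_cst k U (a : R) : Cn k U (cst a).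
Proof.
elim: k a => [|k IH] a; split=> //; try by move=> x _; exact: cst_continuous.
move=> v; split=> [x _|]; first exact: derivable_cst.
by have -> : 'D_v (cst a : E -> R) = cst 0 by apply/funext => x; rewrite derive_cst.
Qed.

Lemma CnD k U f g : open U -> Cn k U f -> Cn k U g -> Cn k U (fun x => f x + g x).
Proof.
move=> oU; elim: k f g => [|k IH] f g [cf hf] [cg hg];
  split=> //; try by move=> x Ux; apply: continuousD; [exact: cf|exact: cg].
move=> v; have [df hf'] := hf v; have [dg hg'] := hg v; split=> [x Ux|].
  by apply: derivableD; [exact: df|exact: dg].
apply: Cn_ext (IH _ _ hf' hg') => // x Ux.
by rewrite -deriveD; [|exact: df|exact: dg].
Qed.

Lemma CnM k U f g : open U -> Cn k U f -> Cn k U g -> Cn k U (fun x => f x * g x).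
Proof.
move=> oU; elim: k f g => [|k IH] f g [cf hf] [cg hg];
  split=> //; try by move=> x Ux; apply: continuousM; [exact: cf|exact: cg].
move=> v; have [df hf'] := hf v; have [dg hg'] := hg v; split=> [x Ux|].
  by apply: derivableM; [exact: df|exact: dg].
have h1 : Cn k U g by apply: Cn_le; split.
have h2 : Cn k U f by apply: Cn_le; split.
apply: Cn_ext (CnD oU (IH _ _ h2 hg') (IH _ _ h1 hf')) => // x Ux.
rewrite -[RHS]/('D_v (f * g) x) deriveM; [|exact: df|exact: dg].
by congr (_ + _); rewrite [RHS]mulrC.
Qed.

Lemma CnZ k U f (a : R) : open U -> Cn k U f -> Cn k U (fun x => a * f x).
Proof. by move=> oU; apply: CnM => //; exact: Cn_cst. Qed.

Lemma CnB k U f g : open U -> Cn k U f -> Cn k U g -> Cn k U (fun x => f x - g x).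
Proof.
move=> oU hf hg; apply: CnD => //.
by apply: Cn_ext (CnZ (-1) oU hg) => // x _; rewrite mulN1r.
Qed.

Lemma CnX k U f j : open U -> Cn k U f -> Cn k U (fun x => f x ^+ j).
Proof.
move=> oU hf; elim: j => [|j IH]; first exact: Cn_cst.
by apply: Cn_ext (CnM oU hf IH) => // x _; rewrite exprS.
Qed.

Lemma Cn_sum k U (I : Type) (r : seq I) (P : pred I) (F : I -> E -> R) : open U ->
  (forall i, P i -> Cn k U (F i)) -> Cn k U (fun x => \sum_(i <- r | P i) F i x).
Proof.
move=> oU h; elim: r => [|i r IH].
  by apply: Cn_ext (Cn_cst k U 0) => // x _; rewrite big_nil.
case Pi: (P i).
  by apply: Cn_ext (CnD oU (h _ Pi) IH) => // x _; rewrite big_cons Pi.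
by apply: Cn_ext IH => // x _; rewrite big_cons Pi.
Qed.

Lemma Cn_lin k U (f : {linear E -> R}) : continuous f -> Cn k U f.
Proof.
move=> cf; case: k => [|k]; split=> //; try by move=> x _; exact: cf.
have d x : differentiable f x by apply: linear_differentiable; exact: cf.
move=> v; split=> [x _|]; first exact: diff_derivable.
have -> : 'D_v f = cst (f v) by apply/funext => x; rewrite deriveE// diff_lin//; exact: cf.
exact: Cn_cst.
Qed.

Lemma CnV k U f : open U -> (forall x, U x -> f x != 0) -> Cn k U f ->
  Cn k U (fun x => (f x)^-1).
Proof.
move=> oU f0; elim: k => [|k IH] [cf hf];
  split=> //; try by move=> x Ux; apply: continuousV; [exact: f0|exact: cf].
move=> v; have [df hf'] := hf v; split=> [x Ux|].
  by apply: derivableV; [exact: f0|exact: df].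
have h1 : Cn k U f by apply: Cn_le; split.
apply: Cn_ext (CnZ (-1) oU (CnM oU (CnX 2 oU (IH h1)) hf')) => // x Ux.
rewrite deriveV ?f0//; last exact: df.
by rewrite mulN1r -exprVn scaleNr.
Qed.
End Basic.
End Cn.

Local Open Scope complex_scope.

(** * The chain rule through matrix-valued maps *)

Section MatrixTarget.
Variables (R : realType).

Lemma cvg_mx (T : Type) (F : set_system T) (FF : Filter F) p q
    (f : T -> 'M[R]_(p, q)) (l : 'M[R]_(p, q)) :
  (forall i j, (fun t => f t i j) @ F --> l i j) -> f @ F --> l.
Proof.
move=> h; apply/cvgrPdist_le => /= e e0; near=> x.
rewrite /Num.Def.normr/= mx_normrE (bigmax_le _ (ltW e0))//= => i _.
rewrite !mxE/=; move: i; near: x; apply: filter_forall => /= i.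
by have /cvgrPdist_le/(_ _ e0) := h i.1 i.2.
Unshelve. all: by end_near. Qed.

Lemma Cn_coord k p q (U : set 'M[R]_(p, q)) i j : Cn k U (fun M => M i j).
Proof.
have lf : linear (fun M : 'M[R]_(p, q) => M i j : R^o) by move=> a M N; rewrite !mxE.
pose l := GRing.isLinear.Build _ _ _ _ _ lf.
pose f : {linear 'M[R]_(p, q) -> R^o} := HB.pack (fun M : 'M[R]_(p, q) => M i j : R^o) l.
by apply: (@Cn_lin _ _ k U f); exact: coord_continuous.
Qed.

Lemma mx_sum_delta p q (M : 'M[R]_(p, q)) :
  M = \sum_(ij : 'I_p * 'I_q) M ij.1 ij.2 *: delta_mx ij.1 ij.2.
Proof. by rewrite {1}[M]matrix_sum_delta pair_bigA. Qed.

Section Comp.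
Variables (E : normedModType R) (p q : nat).
Variables (U : set E) (V : set 'M[R]_(p, q)) (s : E -> 'M[R]_(p, q)).
Hypotheses (oU : open U) (oV : open V) (sUV : forall x, U x -> V (s x)).

Lemma comp_cont (F : 'M[R]_(p, q) -> R) k :
  Cn k V F -> (forall i j, Cn k U (fun x => s x i j)) ->
  forall x, U x -> {for x, continuous (F \o s)}.
Proof.
move=> cF cs x Ux; apply: continuous_comp; last exact: Cn_cont cF (sUV Ux).
by apply: cvg_mx => i j; exact: Cn_cont (cs i j) Ux.
Qed.

(** Near x the map s is its value plus entry increments times matrix units, so this is [chain_curve]
    for the family of matrix units. *)
Lemma comp_derive (F : 'M[R]_(p, q) -> R) x w (d : 'M[R]_(p, q)) : Cn 1 V F -> U x ->
  (forall i j, is_derive x w (fun x => s x i j) (d i j)) ->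
  is_derive x w (F \o s)
    (\sum_(ij : 'I_p * 'I_q) d ij.1 ij.2 * 'D_(delta_mx ij.1 ij.2) F (s x)).
Proof.
move=> [cF dF] Ux ds; apply/is_derive_line0.
pose t (ij : 'I_p * 'I_q) (h : R) := s (x + h *: w) ij.1 ij.2 - s x ij.1 ij.2.
have -> : (fun h : R => (F \o s) (x + h *: w)) =
   (fun h => F (s x + \sum_ij t ij h *: delta_mx ij.1 ij.2)).
  apply/funext => h /=; congr F.
  have -> : \sum_ij t ij h *: delta_mx ij.1 ij.2 = s (x + h *: w) - s x.
    by rewrite [RHS]mx_sum_delta; apply: eq_bigr => ij _; rewrite /t 2!mxE.
  by rewrite [RHS]addrC subrK.
have nV : forall y, V y -> forall ij : 'I_p * 'I_q, derivable F y (delta_mx ij.1 ij.2).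
  by move=> y Vy ij; exact: (dF (delta_mx ij.1 ij.2)).1.
apply: chain_curve.
- move=> ij; apply: near_open oV (sUV Ux) _ => y Vy; exact: nV.
- move=> ij; exact: (@Cn_cont _ _ 0 V _ _ (dF (delta_mx ij.1 ij.2)).2 (sUV Ux)).
- by move=> ij; rewrite /t scale0r addr0 subrr.
- move=> ij; have := ds ij.1 ij.2 => /is_derive_line0 h.
  rewrite -[d ij.1 ij.2]subr0.
  exact: is_deriveB.
Qed.

Lemma Cn_comp (F : 'M[R]_(p, q) -> R) k :
  Cn k V F -> (forall i j, Cn k U (fun x => s x i j)) -> Cn k U (F \o s).
Proof.
elim: k F => [|k IH] F cF cs; split=> //; try exact: comp_cont cF cs.
move=> w; have c1 : Cn 1 V F.
  by clear -cF; elim: k cF => // k IH /Cn_le.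
have ds i j x : U x -> is_derive x w (fun x => s x i j)
     ((\matrix_(i, j) 'D_w (fun x => s x i j) x) i j).
  move=> Ux; rewrite mxE; apply: DeriveDef => //.
  exact: ((cs i j).2 w).1.
split=> [x Ux|]; first by have [] := comp_derive c1 Ux (fun i j => ds i j _ Ux).
apply: (Cn_ext (f := fun x => \sum_(ij : 'I_p * 'I_q) 'D_w (fun x => s x ij.1 ij.2) x
      * ('D_(delta_mx ij.1 ij.2) F \o s) x)) => //.
  move=> x Ux; have [_ ->] := comp_derive c1 Ux (fun i j => ds i j _ Ux).
  by apply: eq_bigr => ij _; rewrite mxE.
apply: Cn_sum => // ij _; apply: CnM => //; first exact: ((cs ij.1 ij.2).2 w).2.
by apply: IH => [|i j]; [exact: (cF.2 _).2|exact: Cn_le].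
Qed.
End Comp.
End MatrixTarget.

(** * Complex-valued functions of real variables *)

Section ComplexParts.
Variable R : realType.
Implicit Types (a b z w : R[i]).

Lemma ReD z w : complex.Re (z + w) = complex.Re z + complex.Re w.
Proof. by case: z w => [a b] [c d]. Qed.
Lemma ImD z w : complex.Im (z + w) = complex.Im z + complex.Im w.
Proof. by case: z w => [a b] [c d]. Qed.
Lemma ReM z w : complex.Re (z * w) =
  complex.Re z * complex.Re w - complex.Im z * complex.Im w.
Proof. by case: z w => [a b] [c d]. Qed.
Lemma ImM z w : complex.Im (z * w) =
  complex.Re z * complex.Im w + complex.Im z * complex.Re w.
Proof. by case: z w => [a b] [c d]. Qed.
Lemma complexP z w : complex.Re z = complex.Re w -> complex.Im z = complex.Im w -> z = w.
Proof. by case: z w => [a b] [c d] /= -> ->. Qed.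
Lemma Re_sum (I : Type) (r : seq I) (P : pred I) (F : I -> R[i]) :
  complex.Re (\sum_(i <- r | P i) F i) = \sum_(i <- r | P i) complex.Re (F i).
Proof. by elim/big_rec2: _ => // i x y _ <-; rewrite ReD. Qed.
Lemma Im_sum (I : Type) (r : seq I) (P : pred I) (F : I -> R[i]) :
  complex.Im (\sum_(i <- r | P i) F i) = \sum_(i <- r | P i) complex.Im (F i).
Proof. by elim/big_rec2: _ => // i x y _ <-; rewrite ImD. Qed.
End ComplexParts.

Section Csm.
Variables (R : realType) (E : normedModType R).
Implicit Types (U V : set E) (f g : E -> R[i]) (r : E -> R) (x v w : E).

(** Smoothness as C^k for every k: products, inverses and compositions then go by induction on k. *)
Definition csm U f := forall k,
  Cn k U (fun x => complex.Re (f x)) /\ Cn k U (fun x => complex.Im (f x)).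

Lemma csm_cderive U f v : csm U f -> csm U (cderive v f).
Proof. by move=> h k; have [[_ a] [_ b]] := h k.+1; split; [exact: (a v).2|exact: (b v).2]. Qed.

(** In [foldr] the last direction of the list is differentiated first, so lists are peeled from the
    end to follow the recursion of [Cn]. *)
Lemma smooth_onP U f : smooth_on U f <-> csm U f.
Proof.
split.
  move=> h k; elim: k f h => [|k IH] f h.
    by split; split=> // x Ux; have [] := h [::] x Ux.
  have hv v : smooth_on U (cderive v f).
    by move=> vs x Ux; have := h (rcons vs v) x Ux; rewrite /= foldr_rcons.
  split; split=> [x Ux|v].
  - by have [] := h [::] x Ux.
  - by split; [move=> x Ux; have [_ _ + _] := h [::] x Ux; apply | have [] := IH _ (hv v)].
  - by have [] := h [::] x Ux.
  - by split; [move=> x Ux; have [_ _ _ +] := h [::] x Ux; apply | have [] := IH _ (hv v)].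
move=> h vs; elim/last_ind: vs f h => [|vs v IH] f h x Ux.
  have [[a b] [c d]] := h 1%N; split; [exact: a|exact: c| |] => v.
    exact: (b v).1.
  exact: (d v).1.
by rewrite foldr_rcons; apply: IH => //; exact: csm_cderive.
Qed.

Lemma csm_sub U V f : V `<=` U -> csm U f -> csm V f.
Proof. by move=> VU h k; have [a b] := h k; split; apply: Cn_sub VU _. Qed.

Lemma csm_ext U f g : open U -> (forall x, U x -> f x = g x) -> csm U f -> csm U g.
Proof.
by move=> oU fg h k; have [a b] := h k; split; [move: a|move: b];
  apply: Cn_ext => // x /fg ->.
Qed.

Lemma csm_local U f : (forall x, U x -> exists V, [/\ open V, V x & csm V f]) -> csm U f.
Proof.
move=> h; apply/smooth_onP => vs x Ux; have [V [oV Vx /smooth_onP]] := h x Ux.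
exact.
Qed.

Lemma cderive_ext U f g v x : open U -> U x -> (forall x, U x -> f x = g x) ->
  cderive v f x = cderive v g x.
Proof.
move=> oU Ux fg; congr (_ +i* _); apply: near_eq_derive;
  by apply: near_open oU Ux _ => y /fg ->.
Qed.

Lemma csm_derivable U f v x : csm U f -> U x ->
  derivable (fun y => complex.Re (f y)) x v /\ derivable (fun y => complex.Im (f y)) x v.
Proof. by move=> h Ux; have [[_ b] [_ d]] := h 1%N; split; [exact: (b v).1|exact: (d v).1]. Qed.

Lemma csm_cst U (a : R[i]) : csm U (cst a).
Proof. by move=> k; split; exact: Cn_cst. Qed.

Lemma csmD U f g : open U -> csm U f -> csm U g -> csm U (fun x => f x + g x).
Proof.
move=> oU hf hg k; have [a b] := hf k; have [c d] := hg k; split.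
- by apply: Cn_ext (CnD oU a c) => // x _; rewrite ReD.
- by apply: Cn_ext (CnD oU b d) => // x _; rewrite ImD.
Qed.

Lemma csmM U f g : open U -> csm U f -> csm U g -> csm U (fun x => f x * g x).
Proof.
move=> oU hf hg k; have [a b] := hf k; have [c d] := hg k; split.
- by apply: Cn_ext (CnB oU (CnM oU a c) (CnM oU b d)) => // x _; rewrite ReM.
- by apply: Cn_ext (CnD oU (CnM oU a d) (CnM oU b c)) => // x _; rewrite ImM.
Qed.

Lemma csmZ U (a : R[i]) f : open U -> csm U f -> csm U (fun x => a * f x).
Proof. by move=> oU; apply: csmM => //; exact: csm_cst. Qed.

Lemma csm_sum U (I : Type) (s : seq I) (P : pred I) (F : I -> E -> R[i]) : open U ->
  (forall i, P i -> csm U (F i)) -> csm U (fun x => \sum_(i <- s | P i) F i x).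
Proof.
move=> oU h k; split.
- apply: (@Cn_ext _ _ _ _ (fun x => \sum_(i <- s | P i) complex.Re (F i x))) => //.
    by move=> x _; rewrite Re_sum.
  by apply: Cn_sum => // i Pi; have [] := h i Pi k.
- apply: (@Cn_ext _ _ _ _ (fun x => \sum_(i <- s | P i) complex.Im (F i x))) => //.
    by move=> x _; rewrite Im_sum.
  by apply: Cn_sum => // i Pi; have [] := h i Pi k.
Qed.

Lemma csm_real U r : (forall k, Cn k U r) -> csm U (fun x => (r x)%:C).
Proof. by move=> h k; split; [exact: h|exact: Cn_cst]. Qed.

Lemma cderiveD U f g v x : csm U f -> csm U g -> U x ->
  cderive v (fun x => f x + g x) x = cderive v f x + cderive v g x.
Proof.
move=> hf hg Ux; have [a b] := csm_derivable v hf Ux; have [c d] := csm_derivable v hg Ux.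
apply: complexP; rewrite ?ReD ?ImD /=.
- rewrite -[RHS](deriveD a c); congr ('D_v _ x); apply/funext => y.
  by rewrite ReD.
- rewrite -[RHS](deriveD b d); congr ('D_v _ x); apply/funext => y.
  by rewrite ImD.
Qed.

Let derive_mulB (p q r s : E -> R) v x : derivable p x v -> derivable q x v ->
  derivable r x v -> derivable s x v ->
  'D_v (fun y => p y * q y - r y * s y) x =
  (p x * 'D_v q x + q x * 'D_v p x) - (r x * 'D_v s x + s x * 'D_v r x).
Proof.
move=> dp dq dr ds.
have h1 := is_deriveM (derivableP dp) (derivableP dq).
have h2 := is_deriveM (derivableP dr) (derivableP ds).
by have [_ e] := is_deriveB h1 h2.
Qed.

Let derive_mulD (p q r s : E -> R) v x : derivable p x v -> derivable q x v ->
  derivable r x v -> derivable s x v ->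
  'D_v (fun y => p y * q y + r y * s y) x =
  (p x * 'D_v q x + q x * 'D_v p x) + (r x * 'D_v s x + s x * 'D_v r x).
Proof.
move=> dp dq dr ds.
have h1 := is_deriveM (derivableP dp) (derivableP dq).
have h2 := is_deriveM (derivableP dr) (derivableP ds).
by have [_ e] := is_deriveD h1 h2.
Qed.

Lemma cderiveM U f g v x : csm U f -> csm U g -> U x ->
  cderive v (fun x => f x * g x) x = cderive v f x * g x + f x * cderive v g x.
Proof.
move=> hf hg Ux; have [a b] := csm_derivable v hf Ux; have [c d] := csm_derivable v hg Ux.
apply: complexP; rewrite ?ReD ?ImD ?ReM ?ImM /=.
- transitivity ('D_v (fun y => complex.Re (f y) * complex.Re (g y) -
     complex.Im (f y) * complex.Im (g y)) x).
    by congr ('D_v _ x); apply/funext => y; rewrite ReM.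
  by rewrite derive_mulB//; ring.
- transitivity ('D_v (fun y => complex.Re (f y) * complex.Im (g y) +
     complex.Im (f y) * complex.Re (g y)) x).
    by congr ('D_v _ x); apply/funext => y; rewrite ImM.
  by rewrite derive_mulD//; ring.
Qed.

Lemma cderive_cst v x (a : R[i]) : cderive v (cst a : E -> R[i]) x = 0.
Proof. by apply: complexP; rewrite /= derive_cst. Qed.

Lemma cderiveZ U (a : R[i]) f v x : csm U f -> U x ->
  cderive v (fun x => a * f x) x = a * cderive v f x.
Proof.
by move=> hf Ux; rewrite (cderiveM v (csm_cst U a) hf Ux) cderive_cst mul0r add0r.
Qed.

Lemma cderive_sum U (I : Type) (s : seq I) (F : I -> E -> R[i]) v x : open U ->
  (forall i, csm U (F i)) -> U x ->
  cderive v (fun x => \sum_(i <- s) F i x) x = \sum_(i <- s) cderive v (F i) x.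
Proof.
move=> oU hF Ux; elim: s => [|i s IH].
  rewrite big_nil -[RHS](cderive_cst v x 0); congr (cderive v _ x).
  by apply/funext => y; rewrite big_nil.
rewrite big_cons -IH -(cderiveD _ (hF i) (csm_sum s oU (fun i (_ : true) => hF i)) Ux).
by congr (cderive v _ x); apply/funext => y; rewrite big_cons.
Qed.

Lemma cderive_sumdir U (I : finType) (v : I -> E) (a : I -> R) f x : open U -> csm U f ->
  U x -> cderive (\sum_i a i *: v i) f x = \sum_i (a i)%:C * cderive (v i) f x.
Proof.
move=> oU hf Ux.
have key (h : E -> R) : (forall k, Cn k U h) ->
    'D_(\sum_i a i *: v i) h x = \sum_i a i * 'D_(v i) h x.
  move=> hh; suff [] : is_derive x (\sum_i a i *: v i) h (\sum_i a i * 'D_(v i) h x) by [].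
  apply: is_derive_sumdir => i.
    by apply: near_open oU Ux _ => y Uy; exact: ((hh 1%N).2 (v i)).1.
  exact: (@Cn_cont _ _ 0 U _ _ ((hh 1%N).2 (v i)).2 Ux).
apply: complexP.
- rewrite Re_sum [LHS]key; last by move=> k; have [] := hf k.
  by apply: eq_bigr => i _; rewrite ReM mul0r subr0.
- rewrite Im_sum [LHS]key; last by move=> k; have [] := hf k.
  by apply: eq_bigr => i _; rewrite ImM mul0r addr0.
Qed.

Lemma cderive_comm U f u v x : open U -> csm U f -> U x ->
  cderive u (cderive v f) x = cderive v (cderive u f) x.
Proof.
move=> oU hf Ux.
have key (h : E -> R) : (forall k, Cn k U h) -> 'D_u ('D_v h) x = 'D_v ('D_u h) x.
  move=> hh; have [_ d1] := hh 1%N; have [_ d2] := hh 2%N; apply: clairaut.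
  - apply: near_open oU Ux _ => y Uy; split; [exact: (d1 v).1|exact: (d1 u).1| |].
      exact: (((d2 v).2).2 u).1.
    exact: (((d2 u).2).2 v).1.
  - exact: (@Cn_cont _ _ 0 U _ _ (((d2 v).2).2 u).2 Ux).
  - exact: (@Cn_cont _ _ 0 U _ _ (((d2 u).2).2 v).2 Ux).
by apply: complexP; rewrite /= key // => k; have [] := hf k.
Qed.
End Csm.

Section IsCderive.
Variables (R : realType) (E : normedModType R).
Implicit Types (f g : E -> R[i]) (x v : E) (d : R[i]).

(** Since [cderive] is a total function, its value carries no differentiability; this predicate
    records both. *)
Definition is_cderive x v f d :=
  is_derive x v (fun y => complex.Re (f y)) (complex.Re d) /\
  is_derive x v (fun y => complex.Im (f y)) (complex.Im d).

Lemma is_cderive_val x v f d : is_cderive x v f d -> cderive v f x = d.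
Proof. by case=> -[_ a] [_ b]; apply: complexP. Qed.

Lemma is_cderive_cst x v (a : R[i]) : is_cderive x v (cst a) 0.
Proof. by split; exact: is_derive_cst. Qed.

Lemma is_cderiveD x v f g d d' : is_cderive x v f d -> is_cderive x v g d' ->
  is_cderive x v (fun y => f y + g y) (d + d').
Proof.
case=> a b [a' b']; split.
  rewrite ReD; under [X in is_derive _ _ X]eq_fun do rewrite ReD.
  exact: is_deriveD.
rewrite ImD; under [X in is_derive _ _ X]eq_fun do rewrite ImD.
exact: is_deriveD.
Qed.

Lemma is_cderiveZ x v (a : R[i]) f d : is_cderive x v f d ->
  is_cderive x v (fun y => a * f y) (a * d).
Proof.
case=> h1 h2; split.
  rewrite ReM; under [X in is_derive _ _ X]eq_fun do rewrite ReM.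
  by apply: is_deriveB; exact: is_deriveZ.
rewrite ImM; under [X in is_derive _ _ X]eq_fun do rewrite ImM.
by apply: is_deriveD; exact: is_deriveZ.
Qed.

Lemma is_cderive_sum x v (I : Type) (s : seq I) (F : I -> E -> R[i]) (d : I -> R[i]) :
  (forall i, is_cderive x v (F i) (d i)) ->
  is_cderive x v (fun y => \sum_(i <- s) F i y) (\sum_(i <- s) d i).
Proof.
move=> h; elim: s => [|i s IH].
  rewrite big_nil; under [X in is_cderive _ _ X]eq_fun do rewrite big_nil.
  exact: is_cderive_cst.
rewrite big_cons; under [X in is_cderive _ _ X]eq_fun do rewrite big_cons.
exact: is_cderiveD.
Qed.

(** The two difference quotients coincide as functions of h, whatever f is. *)
Lemma cderive_affine (E' : normedModType R) (A : E' -> E) (v : E') (w : E) f (x : E') :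
  (forall h : R, A (h *: v + x) = h *: w + A x) ->
  cderive v (fun y => f (A y)) x = cderive w f (A x).
Proof.
move=> hA; have key (r : E -> R) : 'D_v (fun y => r (A y)) x = 'D_w r (A x).
  rewrite /derive.
  suff -> : (fun h : R => h^-1 *: (((fun y => r (A y)) \o shift x) (h *: v) - r (A x)))
     = (fun h : R => h^-1 *: ((r \o shift (A x)) (h *: w) - r (A x))) by [].
  by apply/funext => h /=; rewrite hA.
by apply: complexP;
  [exact: (key (fun y => complex.Re (f y)))|exact: (key (fun y => complex.Im (f y)))].
Qed.

Lemma cderive_iter_affine (E' : normedModType R) (A : E' -> E) (v : E') (w : E) f k (x : E') :
  (forall (h : R) (x : E'), A (h *: v + x) = h *: w + A x) ->
  iter k (cderive v) (fun y => f (A y)) x = iter k (cderive w) f (A x).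
Proof.
move=> hA; elim: k x => //= k IH x.
rewrite -(cderive_affine (A := A) (v := v))//.
by congr (cderive v _ x); apply/funext => y; exact: IH.
Qed.
End IsCderive.

Section ComplexComp.
Variables (R : realType) (E : normedModType R) (p q : nat).
Implicit Types (U : set E) (V : set 'M[R]_(p, q)) (F : 'M[R]_(p, q) -> R[i]).

Lemma csm_comp U V (s : E -> 'M[R]_(p, q)) F : open U -> open V ->
  (forall x, U x -> V (s x)) -> (forall k i j, Cn k U (fun x => s x i j)) ->
  csm V F -> csm U (fun x => F (s x)).
Proof.
move=> oU oV sUV cs hF k; have [a b] := hF k; split.
- exact: (Cn_comp oU oV sUV a (cs k)).
- exact: (Cn_comp oU oV sUV b (cs k)).
Qed.

Lemma is_cderive_comp V (s : E -> 'M[R]_(p, q)) F x w (d : 'M[R]_(p, q)) :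
  open V -> V (s x) -> csm V F ->
  (forall i j, is_derive x w (fun x => s x i j) (d i j)) ->
  is_cderive x w (fun y => F (s y)) (cderive d F (s x)).
Proof.
move=> oV Vx hF ds; have sV : forall y, [set x] y -> V (s y) by move=> y ->.
have e : cderive d F (s x) =
   \sum_(ij : 'I_p * 'I_q) (d ij.1 ij.2)%:C * cderive (delta_mx ij.1 ij.2) F (s x).
  by rewrite {1}[d]mx_sum_delta; exact: cderive_sumdir oV hF Vx.
have [a b] := hF 1%N; split; rewrite e.
- rewrite Re_sum.
  have -> : \sum_(ij : 'I_p * 'I_q) complex.Re ((d ij.1 ij.2)%:C * cderive (delta_mx ij.1 ij.2) F (s x))
   = \sum_(ij : 'I_p * 'I_q) d ij.1 ij.2 * 'D_(delta_mx ij.1 ij.2) (fun y => complex.Re (F y)) (s x).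
    by apply: eq_bigr => ij _; rewrite ReM mul0r subr0.
  exact: (comp_derive oV sV a erefl ds).
- rewrite Im_sum.
  have -> : \sum_(ij : 'I_p * 'I_q) complex.Im ((d ij.1 ij.2)%:C * cderive (delta_mx ij.1 ij.2) F (s x))
   = \sum_(ij : 'I_p * 'I_q) d ij.1 ij.2 * 'D_(delta_mx ij.1 ij.2) (fun y => complex.Im (F y)) (s x).
    by apply: eq_bigr => ij _; rewrite ImM mul0r addr0.
  exact: (comp_derive oV sV b erefl ds).
Qed.
End ComplexComp.

Section VectorValued.
Variables (R : realType) (V : vectType R[i]).

(** [vderive] refers to one fixed basis; any expansion with constant vectors may be differentiated
    termwise instead. *)
Lemma vderive_sum (I : finType) (w : I -> V) (a : I -> R -> R[i]) (d : I -> R[i]) (c : R -> V) t :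
  (forall s, c s = \sum_i a i s *: w i) ->
  (forall i, is_cderive (t : R^o) 1 (a i) (d i)) ->
  vderive c t = \sum_i d i *: w i.
Proof.
move=> hc ha; rewrite [RHS](coord_vbasis (memvf _)) /vderive.
apply: eq_bigr => j _; congr (_ *: _).
rewrite linear_sum; apply: is_cderive_val.
have -> : (fun s : R^o => coord (vbasis (fullv : {vspace V})) j (c s)) =
   (fun s : R^o => \sum_i coord (vbasis fullv) j (w i) * a i s).
  by apply/funext => s; rewrite hc linear_sum; apply: eq_bigr => i _; rewrite linearZ mulrC.
under eq_bigr do rewrite linearZ/= mulrC.
by apply: is_cderive_sum => i; exact: is_cderiveZ.
Qed.

End VectorValued.

Lemma vderive_scalar (R : realType) (c : R -> R[i]^o) (d : R[i]) t :
  is_cderive (t : R^o) 1 (c : R^o -> R[i]) d -> vderive c t = d.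
Proof.
move=> hd; have := @vderive_sum R R[i]^o 'I_1 (fun=> 1 : R[i]^o) (fun=> c) (fun=> d) c t.
rewrite !big_ord1 => ->; first exact: mulr1.
- by move=> s; rewrite big_ord1; apply/esym; exact: mulr1.
- by move=> _; exact: hd.
Qed.

(** * The matrix exponential *)

Section Expm.
Variables (R : realType) (n : nat).
Implicit Types (X Y : 'M[R]_n.+1) (t : R).

Definition expc Y X (i j : 'I_n.+1) (k : nat) : R := (Y *m X ^+ k) i j / k`!%:R.

(** The matrix norm is the maximum of the entries, so each multiplication costs a factor equal to
    the size. *)
Lemma mulmxX_bound Y X k i j : `|(Y *m X ^+ k) i j| <= `|Y| * (n.+1%:R * `|X|) ^+ k.
Proof.
have entry (M : 'M[R]_n.+1) i1 j1 : `|M i1 j1| <= `|M|.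
  rewrite [leRHS]/Num.Def.normr/= mx_normrE.
  exact: (le_bigmax _ (fun ij : 'I_n.+1 * 'I_n.+1 => `|M ij.1 ij.2|) (i1, j1)).
elim: k Y i j => [|k IH] Y i j; first by rewrite expr0 mulmx1 expr0 mulr1.
rewrite exprSr -mulmxE mulmxA mxE.
apply: (le_trans (ler_norm_sum _ _ _)).
apply: (@le_trans _ _ (\sum_(l < n.+1) `|Y| * (n.+1%:R * `|X|) ^+ k * `|X|)).
  by apply: ler_sum => l _; rewrite normrM ler_pM.
rewrite sumr_const card_ord -mulr_natl exprSr.
by rewrite le_eqVlt; apply/orP; left; apply/eqP; ring.
Qed.

Lemma is_cvg_expc Y X i j t : cvgn (pseries (expc Y X i j) t).
Proof.
apply: normed_cvg; pose B := `|t| * (n.+1%:R * `|X|).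
apply: (@series_le_cvg _ _ (`|Y| *: exp_coeff B)) => [k|k|k|].
- exact: normr_ge0.
- by apply: mulr_ge0 => //; rewrite exp_coeff_ge0 // !mulr_ge0.
- rewrite /expc /= normrM normrX normrM [ `|_%:R^-1|]ger0_norm ?invr_ge0//.
  rewrite -[leRHS]/(`|Y| * (B ^+ k / k`!%:R)) /B exprMn.
  rewrite [leRHS](_ : _ = `|Y| * (n.+1%:R * `|X|) ^+ k / k`!%:R * `|t| ^+ k); last by ring.
  by rewrite ler_wpM2r ?exprn_ge0// ler_wpM2r ?invr_ge0// mulmxX_bound.
- by apply: is_cvg_seriesZ; exact: is_cvg_series_exp_coeff.
Qed.

(* Y exp(tX), computed entrywise as a scalar power series in t so that the
   library's term-by-term differentiation applies. *)
Definition expser Y X t : 'M[R]_n.+1 := \matrix_(i, j) limn (pseries (expc Y X i j) t).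

Lemma expc_series Y X t k i j :
  (Y *m series (fun j => (j`!%:R : R)^-1 *: (t *: X) ^+ j) k) i j = pseries (expc Y X i j) t k.
Proof.
rewrite /pseries /series /= mulmx_sumr summxE; apply: eq_bigr => l _.
by rewrite exprZn -!scalemxAr 2!mxE /expc; ring.
Qed.

Lemma expc_series1 X t i j :
  (fun k => (series (fun j => (j`!%:R : R)^-1 *: (t *: X) ^+ j) k) i j) =
  pseries (expc 1%:M X i j) t.
Proof. by apply/funext => k; rewrite -expc_series mul1mx. Qed.

Lemma expmE X t : expm (t *: X) = expser 1%:M X t.
Proof.
apply: cvg_lim => //; apply: cvg_mx => i j; rewrite mxE expc_series1.
exact: is_cvg_expc.
Qed.

Lemma expserM Y X t : expser Y X t = Y *m expm (t *: X).
Proof.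
apply/matrixP => i j; rewrite expmE 2!mxE; apply: cvg_lim => //.
have -> : pseries (expc Y X i j) t = (fun k =>
    \sum_l Y i l * (series (fun j => (j`!%:R : R)^-1 *: (t *: X) ^+ j) k) l j).
  by apply/funext => k; rewrite -expc_series mxE.
apply: cvg_big => [|l _]; first exact: add_continuous.
apply: cvgMl_tmp; rewrite mxE expc_series1.
exact: is_cvg_expc.
Qed.

(** The reason for carrying a left factor Y: termwise differentiation replaces Y by Y X and stays in
    the same family of series. *)
Lemma expc_diffs Y X i j : pseries_diffs (expc Y X i j) = expc (Y *m X) X i j.
Proof.
apply/funext => k; rewrite /pseries_diffs /expc exprS -mulmxE mulmxA factS natrM invfM.
by rewrite mulrCA mulVKf.
Qed.

Lemma is_derive_expm X t i j :
  is_derive t 1 (fun s : R => expm (s *: X) i j) ((X *m expm (t *: X)) i j).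
Proof.
have -> : (fun s : R => expm (s *: X) i j) = (fun s => limn (pseries (expc 1%:M X i j) s)).
  by apply/funext => s; rewrite expmE mxE.
rewrite -[X in X *m _]mul1mx -expserM mxE -expc_diffs.
(* Termwise differentiation asks for convergence at a point of larger absolute value than t; |t| + 1
   serves. *)
apply: (@pseries_snd_diffs _ _ (`|t| + 1)); rewrite ?expc_diffs; try exact: is_cvg_expc.
by rewrite [ltRHS]ger0_norm ?addr_ge0// ltrDl.
Qed.

Lemma expm_nilp X : X *m X = 0 -> expm X = 1%:M + X.
Proof.
move=> XX; apply: cvg_lim => //; apply: cvg_near_cst; exists 2 => // k /= k2.
rewrite /series /= -(subnKC k2) /index_iota subn0 iotaD big_cat /= [X in _ + X]big1_seq ?addr0.
  rewrite !big_cons big_nil addr0 !invr1 !scale1r expr0 expr1 //.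
move=> i /=; rewrite mem_iota add0n => /andP[i2 _].
by rewrite -(subnKC i2) exprD expr2 -[X * X]/(X *m X) XX mul0r scaler0.
Qed.

Lemma expm_diag (d : 'rV[R]_n.+1) : expm (diag_mx d) = diag_mx (\row_i expR (d 0 i)).
Proof.
have dX k : diag_mx d ^+ k = diag_mx (\row_i d 0 i ^+ k).
  elim: k => [|k IH]; first by apply/matrixP => i j; rewrite !mxE.
  rewrite exprS IH -[LHS]/(diag_mx d *m diag_mx _) mulmx_diag; congr diag_mx.
  by apply/matrixP => i j; rewrite !mxE exprS.
apply: cvg_lim => //; apply: cvg_mx => i j.
have -> : (fun k => series (fun j => (j`!%:R : R)^-1 *: diag_mx d ^+ j) k i j) =
   (fun k => series (exp_coeff (d 0 i)) k *+ (i == j)).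
  apply/funext => k; rewrite /series /= summxE -sumrMnl; apply: eq_bigr => l _.
  by rewrite dX !mxE /exp_coeff /= mulrnAr mulrC.
rewrite !mxE; case: eqP => _; last by rewrite !mulr0n; exact: cvg_cst.
rewrite !mulr1n; exact: is_cvg_series_exp_coeff.
Qed.
End Expm.

Section DetExpm.
Variables (R : realType) (n : nat).
Implicit Types (A X : 'M[R]_n.+1).

Lemma Cn_det k (U : set 'M[R]_n.+1) : open U -> Cn k U (fun A => \det A).
Proof.
move=> oU; rewrite /determinant; apply: Cn_sum => // s _; apply: CnZ => //.
have key (f : 'I_n.+1 -> 'I_n.+1) (r : seq 'I_n.+1) :
    Cn k U (fun A : 'M[R]_n.+1 => \prod_(i <- r) A i (f i)).
  elim: r => [|i r IH].
    by apply: Cn_ext (Cn_cst k U 1) => // A _; rewrite big_nil.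
  apply: (@Cn_ext _ _ k U (fun A => A i (f i) * \prod_(j <- r) A j (f j))) => //.
    by move=> A _; rewrite big_cons.
  by apply: CnM => //; exact: Cn_coord.
exact: key.
Qed.

Lemma is_derive_det A i j : is_derive A (delta_mx i j) (fun A => \det A) (cofactor A i j).
Proof.
apply/is_derive_line0.
have -> : (fun h : R => \det (A + h *: delta_mx i j)) =
    (fun h => \det A + cofactor A i j *: h).
  apply/funext => h; rewrite (expand_det_row _ i) (expand_det_row A i).
  have cf l : cofactor (A + h *: delta_mx i j) i l = cofactor A i l.
    congr (_ * \det _); apply/matrixP => a b; rewrite !mxE.
    by rewrite eq_sym (negbTE (neq_lift _ _)) mulr0 addr0.
  under eq_bigr do rewrite cf !mxE eqxx /= mulrDl.
  rewrite big_split /=; congr (_ + _).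
  rewrite (bigD1 j)//= big1 ?addr0 ?eqxx; first by rewrite mulr1 mulrC.
  by move=> l /negbTE ->; rewrite mulr0 mul0r.
have h1 : is_derive (0 : R) 1 (cst (\det A)) 0 by exact: is_derive_cst.
have h2 : is_derive (0 : R) 1 (cofactor A i j *: id : R -> R) (cofactor A i j *: 1).
  exact: is_deriveZ.
have := is_deriveD h1 h2.
by rewrite add0r [_ *: 1]mulr1.
Qed.

(** Jacobi's formula: the derivative of det exp(tX) is tr(X exp(tX) adj(exp(tX))) = tr(X) det
    exp(tX) = 0, so the determinant keeps its value 1 at t = 0. *)
Lemma det_expm X : \tr X = 0 -> \det (expm X) = 1.
Proof.
move=> trX; pose D (t : R) := \det (expm (t *: X)).
have dD (t : R) : is_derive t 1 D 0.
  have := @comp_derive R R _ _ setT setT (fun t : R => expm (t *: X))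
    openT (fun _ _ => I) (fun A => \det A) t 1 (X *m expm (t *: X))
    (Cn_det 1 openT) I (fun i j => is_derive_expm X t i j).
  suff -> : \sum_(ij : 'I_n.+1 * 'I_n.+1) (X *m expm (t *: X)) ij.1 ij.2 *
      'D_(delta_mx ij.1 ij.2) (fun A => \det A) (expm (t *: X)) = 0 by [].
  transitivity (\tr (X *m expm (t *: X) *m \adj (expm (t *: X)))).
    rewrite /mxtrace; under [RHS]eq_bigr do rewrite mxE.
    rewrite pair_bigA; apply: eq_bigr => ij _; rewrite [\adj _ _ _]mxE; congr (_ * _).
    by have [_ ->] := is_derive_det (expm (t *: X)) ij.1 ij.2.
  by rewrite -mulmxA mul_mx_adj mul_mx_scalar mxtraceZ trX mulr0.
have [|s _] := @mvt_line R R D 0 1 1; first by move=> t _; case: (dD (0 + t *: 1)).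
rewrite /D scale0r; have [_ ->] := dD (0 + s *: 1).
rewrite mulr0 [1%:A]mulr1 add0r scale1r => /eqP; rewrite subr_eq0 => /eqP ->.
by rewrite expm_nilp ?mulmx0// addr0 det1.
Qed.

Lemma slmx_SLexp X : \tr X = 0 -> slmx (SLexp X) = expm X.
Proof. by move=> trX; rewrite /SLexp insubdK // /in_mem /= det_expm. Qed.
End DetExpm.

Section ParabolicExp.
Variables (R : realType) (N : nat).
Implicit Types (x : 'rV[R]_N) (t : R).

Lemma Nplus_block x : Nplus x = block_mx 0 x 0 0 :> 'M[R]_(1 + N).
Proof.
apply/(@matrixP _ (1 + N) (1 + N)) => i j; rewrite /Nplus (@summxE _ (1 + N) (1 + N)).
under eq_bigr do rewrite !mxE.
case: (split_ordP i) => i' ->; case: (split_ordP j) => j' ->.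
- rewrite block_mxEul mxE big1// => l _.
  rewrite [X in (nat_of_bool X)%:R](_ : _ = false) ?mulr0//.
  apply/negbTE; rewrite negb_and ord1; apply/orP; right.
  by apply/eqP => /(congr1 val) /=; rewrite (ord1 j').
- rewrite block_mxEur ord1 (bigD1 j')//= big1 ?addr0 ?eqxx ?mulr1//.
    rewrite [X in (nat_of_bool X)%:R](_ : _ = true) ?mulr1//.
    by apply/eqP/val_inj.
  move=> l lj; rewrite [X in (nat_of_bool X)%:R](_ : _ = false) ?mulr0//.
  apply/negbTE; apply: contra lj => /eqP/(congr1 val) /= [] e.
  by apply/eqP/esym/val_inj; exact: e.
- by rewrite block_mxEdl mxE big1// => l _; rewrite mulr0.
- by rewrite block_mxEdr mxE big1// => l _; rewrite mulr0.
Qed.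

Lemma Nminus_block x : Nminus x = block_mx 0 0 x^T 0 :> 'M[R]_(1 + N).
Proof.
rewrite -[RHS]trmxK tr_block_mx !trmx0 trmxK -Nplus_block.
apply/matrixP => i j; rewrite mxE !summxE; apply: eq_bigr => l _.
by rewrite !mxE andbC.
Qed.

Lemma expm_Nplus x : expm (Nplus x) = block_mx 1%:M x 0 1%:M :> 'M[R]_(1 + N).
Proof.
rewrite Nplus_block expm_nilp.
  by rewrite [X in X + _](scalar_mx_block 1 N 1) (@add_block_mx R 1 N 1 N) !addr0 !add0r.
by rewrite (@mulmx_block R 1 N 1 N 1 N) !(mul0mx, mulmx0, addr0) block_mx0.
Qed.

Lemma expm_Nminus x : expm (Nminus x) = block_mx 1%:M 0 x^T 1%:M :> 'M[R]_(1 + N).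
Proof.
rewrite Nminus_block expm_nilp.
  by rewrite [X in X + _](scalar_mx_block 1 N 1) (@add_block_mx R 1 N 1 N) !addr0 !add0r.
by rewrite (@mulmx_block R 1 N 1 N 1 N) !(mul0mx, mulmx0, addr0, add0r) block_mx0.
Qed.

Lemma slmx_nbar x : slmx (nbar x) = block_mx 1%:M 0 x^T 1%:M :> 'M[R]_(1 + N).
Proof.
rewrite slmx_SLexp ?expm_Nminus// Nminus_block.
by rewrite (@mxtrace_block R 1 N) !mxtrace0 addr0.
Qed.

Lemma expm_H0 t : (0 < N)%N ->
  expm (t *: H0 R N) = block_mx (expR t)%:M 0 0 (expR (- (t / N%:R)))%:M :> 'M[R]_(1 + N).
Proof.
move=> N0; have NR : N%:R != 0 :> R by rewrite pnatr_eq0 -lt0n.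
pose d (a b : R) : 'rV[R]_(1 + N) := row_mx (const_mx a) (const_mx b).
have dE a b : diag_mx (d a b) = block_mx a%:M 0 0 b%:M.
  by rewrite /d diag_mx_row !diag_const_mx.
have -> : t *: H0 R N = diag_mx (d t (- (t / N%:R))).
  rewrite dE /H0 (@scale_block_mx R 1 N 1 N) (@scale_block_mx R 1 N 1 N).
  rewrite !scale_scalar_mx mulVf// mulr1 !scaler0.
  suff -> : t *: (N%:R^-1 *: - 1%:M) = (- (t / N%:R))%:M :> 'M[R]_N by [].
  by rewrite !scalerN scalerA scale_scalar_mx mulr1; apply/esym/(raddfN (@scalar_mx R N)).
rewrite (@expm_diag R N) -dE; congr diag_mx.
apply/(@rowP _ (1 + N)) => i; rewrite mxE /d.
by case: (split_ordP i) => j ->; rewrite ?(row_mxEl, row_mxEr) !mxE ?(unsplitK (inl j)) ?(unsplitK (inr j)) /= ?mxE.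
Qed.
End ParabolicExp.

(** * Homogeneous functions and the scalar principal series *)

Section Hom.
Variable R : realType.

Definition nz n : set 'cV[R]_n := [set x | x != 0].
Definition e0 n : 'cV[R]_n.+1 := delta_mx 0 0.
Definition spow (b : int) (c : R) : R := if b == 1 then 1 else Num.sg c.
(* The character c |-> |c|^d sgn(c)^b of the nonzero reals. *)
Definition chi (d : nat) (b : int) (c : R) : R := `|c| ^+ d * spow b c.

(** Only nonzero vectors are constrained; the value at 0 is arbitrary, so such functions are
    compared off 0. *)
Definition Hom n (d : nat) (b : int) (psi : 'cV[R]_n -> R[i]) :=
  csm (@nz n) psi /\
  forall (c : R) x, c != 0 -> x != 0 -> psi (c *: x) = (chi d b c)%:C * psi x.

(** The parabolic subgroup is the stabiliser of the line through e_0, which is why equivariant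
    functions of g are functions of the first column g e_0. *)
Definition liftSL n (psi : 'cV[R]_n.+1 -> R[i]) (g : SL R n.+1) : R[i]^o :=
  psi (slmx g *m e0 n).

Lemma open_nz n : open (@nz n).
Proof.
rewrite openE => x /= x0; apply/nbhs_ballP; exists `|x|; first by rewrite /= normr_gt0.
move=> y; rewrite -ball_normE /= => xy; apply/eqP => y0.
by move: xy; rewrite y0 subr0 ltxx.
Qed.

Lemma SL_mul_neq0 n (g : SL R n) (x : 'cV[R]_n) : x != 0 -> slmx g *m x != 0.
Proof.
move=> x0; apply: contra x0 => /eqP gx.
by rewrite -[x](mulKmx (SL_unit g)) gx mulmx0.
Qed.

Lemma e0_neq0 n : e0 n != 0.
Proof.
apply/eqP => /matrixP/(_ 0 0); rewrite !mxE !eqxx => /eqP.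
by rewrite oner_eq0.
Qed.

Lemma SL_e0_neq0 n (g : SL R n.+1) : slmx g *m e0 n != 0.
Proof. exact/SL_mul_neq0/e0_neq0. Qed.

Lemma e0_block n : e0 n = col_mx 1%:M 0 :> 'cV[R]_(1 + n).
Proof.
apply/(@matrixP _ (1 + n)) => i j; rewrite [j]ord1 mxE.
by case: (split_ordP i) => i' ->; rewrite ?(col_mxEu, col_mxEd) ?[i']ord1 !mxE.
Qed.

(** The rank-one factorisation of x gives an invertible matrix with first column x. Its last column,
    distinct from the first because the size is at least 2, is rescaled to make the determinant
    1. *)
Lemma SL_transitive n (x : 'cV[R]_n.+2) : x != 0 ->
  exists g : SL R n.+2, slmx g *m e0 n.+1 = x.
Proof.
move=> x0.
have [M [uM Me]] : exists M : 'M[R]_n.+2, M \in unitmx /\ M *m e0 n.+1 = x.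
  pose L := col_ebase x; pose r := row_ebase x 0 0.
  have rx : \rank x = 1%N.
    apply/eqP; rewrite eqn_leq rank_leq_col lt0n mxrank_eq0 //.
  have xE : x = r *: (L *m e0 n.+1).
    rewrite -[LHS]mulmx_ebase rx -/L.
    have -> : pid_mx 1 = e0 n.+1.
      apply/matrixP => i j; rewrite !mxE [j]ord1 /=.
      by case: i => [[|i] hi].
    by rewrite [row_ebase x]mx11_scalar mul_mx_scalar.
  have r0 : r != 0 by apply: contra x0 => /eqP r0; rewrite xE r0 scale0r.
  exists (r *: L); split; last by rewrite -scalemxAl -xE.
  by rewrite unitmxZ ?unitfE// col_ebase_unit.
pose D : 'M[R]_n.+2 := diag_mx (\row_i if i == ord_max then (\det M)^-1 else 1).
have dD : \det D = (\det M)^-1.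
  rewrite det_diag (bigD1 ord_max)//= mxE eqxx big1 ?mulr1// => i /negbTE ne.
  by rewrite mxE ne.
have dM : \det (M *m D) == 1.
  by rewrite det_mulmx dD divff // -unitfE -unitmxE.
exists (MkSL dM); rewrite /= -mulmxA -[RHS]Me; congr (_ *m _).
apply/matrixP => i j; rewrite mul_diag_mx !mxE [j]ord1 andbT.
by case: eqP => [->|_]; rewrite ?mulr0// mul1r.
Qed.

Section Parabolic.
Variable N : nat.
Hypothesis N0 : (0 < N)%N.
Implicit Types (h : 'M[R]_N) (t : R) (x : 'rV[R]_N).

Lemma parabolic_block h t x :
  levi h *m expm (t *: H0 R N) *m expm (Nplus x) =
  block_mx ((\det h)^-1 * expR t)%:M (((\det h)^-1 * expR t) *: x)
           0 (expR (- (t / N%:R)) *: h) :> 'M[R]_(1 + N).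
Proof.
rewrite expm_H0// expm_Nplus /levi !(@mulmx_block R 1 N 1 N 1 N).
rewrite !(mul0mx, mulmx0, addr0, add0r, mulmx1).
by rewrite -scalar_mxM mul_scalar_mx mul_mx_scalar.
Qed.

Lemma parabolic_e0 h t x :
  levi h *m expm (t *: H0 R N) *m expm (Nplus x) *m e0 N =
  ((\det h)^-1 * expR t) *: e0 N.
Proof.
rewrite parabolic_block e0_block (@mul_block_col R 1 N 1 N).
rewrite !mulmx0 mul0mx !addr0 mulmx1 (@scale_col_mx R 1 N) scaler0.
by rewrite scale_scalar_mx mulr1.
Qed.

(** Here t = ln |c|, and h is the lower diagonal block rescaled by exp(t/N), which makes its
    determinant the sign of c. *)
Lemma parabolicP (p : SL R N.+1) c : c != 0 -> slmx p *m e0 N = c *: e0 N ->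
  exists h t x, [/\ SLpm h, slmx p = levi h *m expm (t *: H0 R N) *m expm (Nplus x) &
     c = (\det h)^-1 * expR t].
Proof.
move=> c0 pe; pose P : 'M[R]_(1 + N) := slmx p.
have NR : N%:R != 0 :> R by rewrite pnatr_eq0 -lt0n.
have eP : P = block_mx c%:M (ursubmx P) 0 (drsubmx P).
  move: pe; rewrite -[slmx p]/P e0_block -[P]submxK (@mul_block_col R 1 N 1 N).
  rewrite !mulmx0 !mulmx1 !addr0 (@scale_col_mx R 1 N) scaler0 scale_scalar_mx mulr1.
  by move=> /(@eq_col_mx _ 1 N)[-> ->]; rewrite !block_mxKur !block_mxKdr.
have dP : c * \det (drsubmx P) = 1.
  by rewrite -[RHS](SL_det p) -[slmx p]/P [in RHS]eP (@det_ublock R 1 N) det_scalar1.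
pose t := ln `|c|; have et : expR t = `|c| by rewrite lnK // posrE normr_gt0.
pose h := expR (t / N%:R) *: drsubmx P.
have dh : (\det h)^-1 = Num.sg c.
  rewrite /h detZ -expRM_natr divfK// et.
  have -> : \det (drsubmx P) = c^-1 by apply: (mulfI c0); rewrite dP divff.
  by rewrite invfM invrK {2}[c]numEsg mulrCA mulVf ?mulr1// normr_eq0.
exists h, t, (c^-1 *: ursubmx P); split.
- have : \det h = (Num.sg c)^-1 by rewrite -dh invrK.
  by rewrite /SLpm /=; case: sgrP c0 => // _ _ ->; rewrite ?invrN invr1; [left|right].
- rewrite parabolic_block dh et -numEsg scalerA divff// scale1r /h scalerA -expRD addNr.
  by rewrite expR0 scale1r -eP.
- by rewrite dh et -numEsg.
Qed.

(** For c = det(h)^-1 e^t one has |c| = e^t and sgn c = det h, so the induction parameter -d becomes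
    homogeneity of degree d with parity b. *)
Lemma parabolic_factor (d : nat) (b : int) h t : SLpm h ->
  (sgn_pow b h * expR (- d%:R * t))^-1 = chi d b ((\det h)^-1 * expR t).
Proof.
move=> hh; rewrite /chi /sgn_pow /spow invfM -expRN mulNr opprK.
have -> : `|(\det h)^-1 * expR t| ^+ d = expR (d%:R * t).
  have -> : `|(\det h)^-1 * expR t| = expR t.
    rewrite normrM [X in _ * X]ger0_norm ?expR_ge0//.
    by case: hh => ->; rewrite ?invrN invr1 ?normrN normr1 mul1r.
  by rewrite expRM_natl.
rewrite mulrC; congr (_ * _); case: eqP => _; first by rewrite invr1.
rewrite sgrM [Num.sg (expR t)]gtr0_sg ?expR_gt0// mulr1.
by case: hh => ->; rewrite ?invrN ?invr1 ?sgrN sgr1 ?invrN ?invr1.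
Qed.
End Parabolic.
End Hom.

Section SmoothSL.
Variables (R : realType) (n : nat).
Implicit Types (f : SL R n -> R[i]).

Lemma smooth_SL_restr (U : set 'M[R]_n) (F : 'M[R]_n -> R[i]) : open U ->
  (forall g : SL R n, U (slmx g)) -> csm U F -> smooth_SL (fun g => F (slmx g)).
Proof. by move=> oU hU hF g; exists U, F; split => //; apply/smooth_onP. Qed.

Lemma smooth_SLD f1 f2 : smooth_SL f1 -> smooth_SL f2 -> smooth_SL (fun g => f1 g + f2 g).
Proof.
move=> h1 h2 g; have [U [F [oU Ug /smooth_onP hF eF]]] := h1 g.
have [U' [F' [oU' Ug' /smooth_onP hF' eF']]] := h2 g.
exists (U `&` U'), (fun A => F A + F' A); split => //.
- exact: openI.
- apply/smooth_onP; apply: csmD; first exact: openI.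
    by apply: csm_sub hF => ? [].
  by apply: csm_sub hF' => ? [].
- by move=> h [Uh Uh']; rewrite eF // eF'.
Qed.

Lemma smooth_SLZ (a : R[i]) f : smooth_SL f -> smooth_SL (fun g => a * f g).
Proof.
move=> h1 g; have [U [F [oU Ug /smooth_onP hF eF]]] := h1 g.
exists U, (fun A => a * F A); split => //; first by apply/smooth_onP/csmZ.
by move=> h Uh; rewrite eF.
Qed.

Lemma smooth_SL_sum (I : Type) (r : seq I) (F : I -> SL R n -> R[i]) :
  (forall i, smooth_SL (F i)) -> smooth_SL (fun g => \sum_(i <- r) F i g).
Proof.
move=> h; elim: r => [|i r IH].
  under [X in smooth_SL X]eq_fun do rewrite big_nil.
  move=> g; exists setT, (cst 0); split => //; first exact: openT.
  by apply/smooth_onP; exact: csm_cst.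
under [X in smooth_SL X]eq_fun do rewrite big_cons.
exact: smooth_SLD.
Qed.

Lemma vsmooth_sum (V : vectType R[i]) (I : Type) (r : seq I) (w : I -> V)
    (a : I -> SL R n -> R[i]) :
  (forall i, smooth_SL (a i)) -> vsmooth_SL (fun g => \sum_(i <- r) a i g *: w i).
Proof.
move=> ha j.
have -> : (fun g => coord (vbasis (fullv : {vspace V})) j (\sum_(i <- r) a i g *: w i)) =
   (fun g => \sum_(i <- r) coord (vbasis fullv) j (w i) * a i g).
  by apply/funext => g; rewrite linear_sum; apply: eq_bigr => i _; rewrite linearZ mulrC.
by apply: smooth_SL_sum => i; exact: smooth_SLZ.
Qed.

Lemma vsmooth_scalar (f : SL R n -> R[i]^o) : vsmooth_SL f <-> smooth_SL (f : _ -> R[i]).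
Proof.
split=> h.
  have -> : (f : _ -> R[i]) = (fun g => \sum_(i < \dim (fullv : {vspace R[i]^o}))
     ((vbasis (fullv : {vspace R[i]^o}))`_i : R[i]) * coord (vbasis fullv) i (f g)).
    apply/funext => g; rewrite {1}[f g](coord_vbasis (memvf _)).
    by apply: eq_bigr => i _; rewrite mulrC.
  by apply: smooth_SL_sum => i; apply: smooth_SLZ; exact: h.
have -> : f = (fun g => \sum_(i <- [:: tt]) (f g : R[i]) *: (1 : R[i]^o)).
  by apply/funext => g; rewrite big_seq1; apply/esym; exact: mulr1.
exact: vsmooth_sum.
Qed.

End SmoothSL.

Section HomInd.
Variable R : realType.

Lemma mulmx_entry (S : pzSemiRingType) m n p (A : 'M[S]_(m, n)) (B : 'M[S]_(n, p)) i j :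
  (A *m B) i j = \sum_l A i l * B l j.
Proof. by rewrite mxE. Qed.

Lemma Cn_mulmx k m n p (A : 'M[R]_(m, n)) (U : set 'M[R]_(n, p)) i j : open U ->
  Cn k U (fun x => (A *m x) i j).
Proof.
move=> oU; apply: (@Cn_ext _ _ k U (fun x => \sum_l A i l * x l j)) => //.
  by move=> x _; rewrite mxE.
by apply: Cn_sum => // l _; apply: CnZ => //; exact: Cn_coord.
Qed.

Lemma Cn_mulmxr k m n p (x : 'M[R]_(n, p)) (U : set 'M[R]_(m, n)) i j : open U ->
  Cn k U (fun A => (A *m x) i j).
Proof.
move=> oU; apply: (@Cn_ext _ _ k U (fun A => \sum_l x l j * A i l)) => //.
  by move=> A _; rewrite mxE; apply: eq_bigr => l _; rewrite mulrC.
by apply: Cn_sum => // l _; apply: CnZ => //; exact: Cn_coord.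
Qed.

Lemma open_preim (E : normedModType R) p q (V : set E) (U : set 'M[R]_(p, q))
    (s : E -> 'M[R]_(p, q)) : open V -> open U ->
  (forall i j, Cn 0 V (fun y => s y i j)) -> open [set y | V y /\ U (s y)].
Proof.
move=> oV oU hs; rewrite openE => y /= [Vy Uy].
have cs : {for y, continuous s} by apply: cvg_mx => i j; exact: Cn_cont (hs i j) Vy.
apply: filterI; first exact: open_nbhs_nbhs (conj oV Vy).
exact: (cs _ (open_nbhs_nbhs (conj oU Uy))).
Qed.

Lemma open_mulmxr n (x : 'cV[R]_n) : open [set A : 'M[R]_n | A *m x != 0].
Proof.
have := @open_preim 'M[R]_n n 1 setT (@nz R n) (fun A => A *m x) openT (@open_nz R n)
  (fun i j => Cn_mulmxr 0 x i j openT).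
by congr open; apply/seteqP; split=> y /= => [[]|].
Qed.

Lemma smooth_SL_point n (psi : 'cV[R]_n -> R[i]) (v : 'cV[R]_n) : v != 0 ->
  csm (@nz R n) psi -> smooth_SL (fun g : SL R n => psi (slmx g *m v)).
Proof.
move=> v0 hpsi.
apply: (@smooth_SL_restr _ _ [set A | A *m v != 0] (fun A => psi (A *m v))).
- exact: open_mulmxr.
- by move=> g; exact: SL_mul_neq0.
- apply: csm_comp hpsi; [exact: open_mulmxr|exact: open_nz|by []|].
  by move=> k i j; apply: Cn_mulmxr; exact: open_mulmxr.
Qed.

Section Triv.
Variables (k d : nat) (b : int).
Let N := k.+1.

Lemma chi_eq1 d' b' : chi d' b' (1 : R) = 1.
Proof. by rewrite /chi normr1 expr1n mul1r /spow sgr1 if_same. Qed.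

Lemma Hom_Ind psi : Hom d b psi -> Ind (@triv R N) b (- d%:R) (liftSL psi).
Proof.
move=> [hpsi hom]; split.
  by apply/vsmooth_scalar; apply: smooth_SL_point => //; exact: e0_neq0.
move=> g p h t x hh ep.
rewrite parabolic_factor// /liftSL /= -mulmxA ep parabolic_e0// -scalemxAr hom//.
  apply: mulf_neq0; last by rewrite gt_eqF ?expR_gt0.
  by rewrite invr_eq0; case: hh => ->; rewrite ?oppr_eq0 oner_eq0.
exact: SL_e0_neq0.
Qed.

(** Elements with proportional first columns differ on the right by an element of P, so f descends
    to a homogeneous psi. For smoothness near x = g e_0 a local section is needed: with z = g^-1 y
    and z_0 > 0, the element g nbar(w) sends e_0 to y / z_0, where w holds the affine coordinates of
    z. Hence psi(y) is z_0^d times a local smooth extension of f at g nbar(w). *)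
Lemma Ind_Hom f : Ind (@triv R N) b (- d%:R) f -> exists2 psi, Hom d b psi & f = liftSL psi.
Proof.
move=> [/vsmooth_scalar sf eqf].
have scal (g g' : SL R N.+1) c : c != 0 -> slmx g *m e0 R N = c *: (slmx g' *m e0 R N) ->
    f g = (chi d b c)%:C * f g'.
  move=> c0 e; have pe : slmx (g'^-1 * g)%g *m e0 R N = c *: e0 R N.
    by rewrite /= -mulmxA e -scalemxAr mulKmx ?SL_unit.
  have [h [t [x [hh ep ec]]]] := parabolicP (isT : (0 < N)%N) c0 pe.
  by have := eqf g' _ h t x hh ep; rewrite mulVKg parabolic_factor// -ec => ->.
pose psi (x : 'cV[R]_N.+1) : R[i] :=
  if pselect (exists g : SL R N.+1, slmx g *m e0 R N = x) is left e then f (projT1 (cid e)) else 0.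
have psiE (g : SL R N.+1) : psi (slmx g *m e0 R N) = f g.
  rewrite /psi; case: pselect => [e|]; last by case; exists g.
  rewrite (scal _ g 1 (oner_neq0 R)) ?chi_eq1 ?mul1r//.
  by rewrite scale1r; exact: projT2 (cid e).
exists psi; last by apply/funext => g; rewrite /liftSL psiE.
have hom (c : R) x : c != 0 -> x != 0 -> psi (c *: x) = (chi d b c)%:C * psi x.
  move=> c0 x0; have [g <-] := SL_transitive x0.
  have [|g' eg'] := @SL_transitive R k (c *: (slmx g *m e0 R N)).
    by rewrite scaler_eq0 negb_or c0; exact: SL_e0_neq0.
  by rewrite -eg' !psiE; exact: scal.
split=> //; apply: csm_local => x x0.
have [g ge] := SL_transitive x0.
have [U [F [oU Ug /smooth_onP hF eF]]] := sf g.
pose z (y : 'cV[R]_(1 + N)) : 'cV[R]_(1 + N) := invmx (slmx g) *m y.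
pose V : set 'cV[R]_(1 + N) := [set y | 0 < z y 0 0].
pose w y : 'rV[R]_N := (z y 0 0)^-1 *: (dsubmx (z y))^T.
pose s y : 'M[R]_(1 + N) := slmx g *m block_mx 1%:M 0 (w y)^T 1%:M.
have Cz U' K i : open U' -> Cn K U' (fun y => z y i 0) by move=> oU'; exact: Cn_mulmx.
have oV : open V.
  have cz : continuous (fun y => z y 0 0).
    by move=> y; exact: (@Cn_cont _ _ 0 setT _ _ (Cz setT 0%N 0 openT) I).
  by have := @open_comp _ _ (fun y => z y 0 0) [set t | 0 < t] (fun y _ => cz y) (@open_gt _ 0).
have sE y : s y = slmx (g * nbar (w y))%g by rewrite /= slmx_nbar.
have Cs K i j : Cn K V (fun y => s y i j).
  pose B y : 'M[R]_(1 + N) := block_mx 1%:M 0 (w y)^T 1%:M.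
  suff CB (l j' : 'I_(1 + N)) : Cn K V (fun y => B y l j').
    apply: (@Cn_ext _ _ K V (fun y => \sum_l slmx g i l * B y l j)) => //.
      by move=> y _; apply/esym; exact: mulmx_entry.
    by apply: Cn_sum => // l _; apply: CnZ => //; exact: CB.
  rewrite /B {B}.
  case: (split_ordP l) => l' ->; case: (split_ordP j') => j'' ->.
  - by apply: Cn_ext (Cn_cst K V ((1%:M : 'M[R]_1) l' j'')) => // y _; rewrite block_mxEul.
  - by apply: Cn_ext (Cn_cst K V 0) => // y _; rewrite block_mxEur mxE.
  - apply: (@Cn_ext _ _ K V (fun y => (z y 0 0)^-1 * z y (rshift 1 l') 0)) => //.
      by move=> y _; rewrite block_mxEdl !mxE (ord1 j'').
    apply: CnM => //; last exact: Cz.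
    by apply: CnV; [by []|by move=> y Vy; rewrite gt_eqF|exact: Cz].
  - by apply: Cn_ext (Cn_cst K V ((1%:M : 'M[R]_N) l' j'')) => // y _; rewrite block_mxEdr.
have zx : z x = e0 R N by rewrite /z -ge mulKmx ?SL_unit.
have Vx : V x by rewrite /V /= zx /e0 mxE !eqxx ltr01.
have oW : open [set y | V y /\ U (s y)] by apply: open_preim => // i j; exact: Cs.
have sx : s x = slmx g.
  have wx : w x = 0 by rewrite /w zx e0_block col_mxKd trmx0 scaler0.
  by rewrite /s wx trmx0 -(scalar_mx_block 1 N 1) mulmx1.
exists [set y | V y /\ U (s y)]; split; first exact: oW.
  by split; [exact: Vx | rewrite sx].
apply: (@csm_ext _ _ _ (fun y => (z y 0 0 ^+ d)%:C * F (s y))) => //.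
  move=> y [Vy Uy]; rewrite sE eF -?sE// -psiE.
  have zy : z y 0 0 != 0 by rewrite gt_eqF.
  have ey : y = z y 0 0 *: (slmx (g * nbar (w y))%g *m e0 R N).
    rewrite -sE /s -mulmxA e0_block (@mul_block_col R 1 N 1 N) !mulmx0 !addr0 !mulmx1.
    rewrite scalemxAr (@scale_col_mx R 1 N) scale_scalar_mx mulr1 /w.
    rewrite linearZ /= trmxK scalerA divff// scale1r.
    have -> : (z y 0 0)%:M = usubmx (z y) :> 'cV[R]_1.
      by apply/matrixP => i j; rewrite !mxE !ord1 mulr1n (_ : lshift N 0 = 0)//; exact: val_inj.
    by rewrite vsubmxK /z mulKVmx ?SL_unit.
  rewrite [in RHS]ey hom//; last exact: SL_e0_neq0.
  by rewrite /chi /spow gtr0_norm// gtr0_sg// if_same mulr1.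
apply: csmM => //.
  by apply: csm_real => K; apply: CnX => //; exact: Cz.
apply: (csm_comp oW oU) hF; first by move=> y [].
by move=> K i j; apply: Cn_sub (Cs K i j) => y [].
Qed.
End Triv.
End HomInd.

(** * Iterated derivatives and Euler's identity *)

Section IterDerive.
Variables (R : realType) (E : normedModType R) (U : set E).
Hypothesis oU : open U.
Implicit Types (f g : E -> R[i]) (u v x : E).

Lemma csm_iter k v f : csm U f -> csm U (iter k (cderive v) f).
Proof. by move=> hf; elim: k => //= k IH; exact: csm_cderive. Qed.

Lemma iter_cderive_ext k v f g x : U x -> (forall x, U x -> f x = g x) ->
  iter k (cderive v) f x = iter k (cderive v) g x.
Proof.
move=> Ux fg; elim: k x Ux => [|k IH] x Ux /=; first exact: fg.
by apply: cderive_ext IH.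
Qed.

Lemma iter_cderiveD k v f g x : csm U f -> csm U g -> U x ->
  iter k (cderive v) (fun y => f y + g y) x =
  iter k (cderive v) f x + iter k (cderive v) g x.
Proof.
move=> hf hg; elim: k x => [//|k IH] x Ux /=.
rewrite -(cderiveD v (csm_iter k v hf) (csm_iter k v hg) Ux).
exact: cderive_ext IH.
Qed.

Lemma iter_cderiveZ k v (a : R[i]) f x : csm U f -> U x ->
  iter k (cderive v) (fun y => a * f y) x = a * iter k (cderive v) f x.
Proof.
move=> hf; elim: k x => [//|k IH] x Ux /=.
by rewrite -(cderiveZ a v (csm_iter k v hf) Ux); exact: cderive_ext IH.
Qed.

Lemma iter_cderive_sum (I : Type) (s : seq I) (F : I -> E -> R[i]) k v x :
  (forall i, csm U (F i)) -> U x ->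
  iter k (cderive v) (fun x => \sum_(i <- s) F i x) x = \sum_(i <- s) iter k (cderive v) (F i) x.
Proof.
move=> hF; elim: k x => [//|k IH] x Ux /=.
rewrite -(cderive_sum s v oU (fun i => csm_iter k v (hF i)) Ux).
exact: cderive_ext IH.
Qed.

Lemma iter_cderive_comm k u v f x : csm U f -> U x ->
  cderive u (iter k (cderive v) f) x = iter k (cderive v) (cderive u f) x.
Proof.
move=> hf; elim: k x => [//|k IH] x Ux /=.
rewrite (cderive_comm _ _ oU (csm_iter k v hf) Ux).
exact: cderive_ext IH.
Qed.

Lemma cderiveDdir u v (a : R) f x : csm U f -> U x ->
  cderive (u + a *: v) f x = cderive u f x + a%:C * cderive v f x.
Proof.
move=> hf Ux.
have := @cderive_sumdir _ _ _ _ (fun b : bool => if b then u else v)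
  (fun b => if b then 1 else a) f x oU hf Ux.
by rewrite !big_bool /= scale1r mul1r.
Qed.

Lemma cderiveZdir v (a : R) f x : csm U f -> U x ->
  cderive (a *: v) f x = a%:C * cderive v f x.
Proof.
move=> hf Ux.
have := @cderive_sumdir _ _ _ 'I_1 (fun=> v) (fun=> a) f x oU hf Ux.
by rewrite !big_ord1.
Qed.

End IterDerive.

Section Homogeneous.
Variables (R : realType) (n : nat).
Implicit Types (w : R -> R) (eta : 'cV[R]_n -> R[i]) (v x : 'cV[R]_n).
Let onz := @open_nz R n.

(** The weight w is a free function because each derivative divides it by c. S is the whole line
    when parity matters and the positive half-line in Euler arguments. *)
Definition homw (S : set R) w eta :=
  forall (c : R) x, S c -> c != 0 -> x != 0 -> eta (c *: x) = (w c)%:C * eta x.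

Lemma homw_cderive S w eta v : csm (@nz R n) eta -> homw S w eta ->
  homw S (fun c => w c / c) (cderive v eta).
Proof.
move=> he hom c x Sc c0 x0.
have cx0 : c *: x != 0 by rewrite scaler_eq0 negb_or c0.
have h1 : cderive v (fun y => eta (c *: y)) x = cderive (c *: v) eta (c *: x).
  by apply: cderive_affine => h; rewrite scalerDr scalerA mulrC -scalerA.
have h2 : cderive v (fun y => eta (c *: y)) x = (w c)%:C * cderive v eta x.
  rewrite -(cderiveZ _ _ he x0); apply: (cderive_ext v onz x0) => y y0; exact: hom.
have h3 := cderiveZdir onz v c he cx0.
have cC : c%:C != 0 :> R[i] by rewrite fmorph_eq0.
apply: (mulfI cC); rewrite -h3 -h1 h2 rmorphM fmorphV /= mulrA [in RHS]mulrCA.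
by rewrite mulfV // mulr1.
Qed.

Lemma homw_iter S w eta v k : csm (@nz R n) eta -> homw S w eta ->
  homw S (fun c => w c / c ^+ k) (iter k (cderive v) eta).
Proof.
move=> he hom; elim: k => [|k IH].
  by move=> c x Sc c0 x0; rewrite expr0 divr1; exact: hom.
move=> c x Sc c0 x0; rewrite /= (homw_cderive _ (csm_iter k v he) IH)//.
by rewrite exprSr invfM mulrA.
Qed.

Lemma euler0 eta x : csm (@nz R n) eta -> x != 0 ->
  (forall c : R, 0 < c -> eta (c *: x) = eta x) -> cderive x eta x = 0.
Proof.
move=> he x0 hom.
have h : cderive (1 : R^o) (fun h : R^o => eta (x + h *: x)) 0 = cderive x eta x.
  rewrite (@cderive_affine _ _ _ (fun h : R^o => x + h *: x) 1 x eta 0).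
    by rewrite scale0r addr0.
  move=> h; rewrite scalerDl scale0r !addr0 [h *: (1 : R^o)]mulr1 addrC.
  by [].
rewrite -h -[RHS](cderive_cst (1 : R^o) (0 : R^o) (eta x)).
(* On this neighbourhood of 0 the factor 1 + h is positive, so homogeneity makes the function
   constant there. *)
apply: (@cderive_ext _ _ [set h : R^o | -1 < h]).
- exact: (@open_gt R).
- by rewrite /= ltrN10.
- move=> s /= s1; have -> : x + s *: x = (1 + s : R) *: x by rewrite scalerDl scale1r.
  by apply: hom; rewrite -ltrBlDl sub0r.
Qed.

(** The weight c^l / c stands for degree l - 1. In the inductive step eta has degree l, and with w =
    v + a x the innermost of its l + 1 derivatives splits as D_v + a D_x. The D_x part commutes to
    the outside, where it meets D_w^l eta of degree 0 and vanishes; D_v eta has degree l - 1 and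
    falls under the induction hypothesis. *)
Lemma euler_drop l eta v x (a : R) : csm (@nz R n) eta -> x != 0 ->
  homw [set c | 0 < c] (fun c => c ^+ l / c) eta ->
  iter l (cderive (v + a *: x)) eta x = iter l (cderive v) eta x.
Proof.
move=> + x0; elim: l eta => [//|l IH] eta he hom.
rewrite !iterSr; set w := v + a *: x.
rewrite (@iter_cderive_ext _ _ _ onz l w _ (fun y => cderive v eta y + a%:C * cderive x eta y))//; last first.
  by move=> y y0; rewrite (cderiveDdir onz).
rewrite (iter_cderiveD onz) //; [|exact: csm_cderive|by apply: csmZ => //; exact: csm_cderive].
rewrite (iter_cderiveZ onz)//; last exact: csm_cderive.
rewrite -(@iter_cderive_comm _ _ _ onz l x w eta x he x0).
rewrite (@euler0 (iter l (cderive w) eta)) ?mulr0 ?addr0 //.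
- apply: IH; first exact: csm_cderive.
  move=> c y c0 c1 y0; rewrite (homw_cderive v he hom)//.
  by rewrite exprSr mulfK.
- exact: csm_iter.
- move=> c c0; rewrite (homw_iter w l he hom) ?gt_eqF//.
  by rewrite exprSr mulfK ?gt_eqF// divff ?expf_neq0 ?gt_eqF// mul1r.
Qed.
End Homogeneous.

(** * Extraction of coefficients *)

(** Uniqueness of base-B digits: reduction modulo B reads off the first one. *)
Lemma kronecker_inj n (B : nat) (a b : 'I_n -> nat) :
  (forall i, a i < B)%N -> (forall i, b i < B)%N ->
  (\sum_i a i * B ^ i = \sum_i b i * B ^ i)%N -> a =1 b.
Proof.
elim: n a b => [|n IH] a b aB bB e; first by case.
have split (c : 'I_n.+1 -> nat) : (\sum_i c i * B ^ i = c ord0 + (\sum_(i < n) c (lift ord0 i) * B ^ i) * B)%N.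
  rewrite big_ord_recl expn0 muln1 big_distrl; congr (_ + _)%N.
  by apply: eq_bigr => i _; rewrite /= /bump /= add1n expnSr mulnA.
have B0 : (0 < B)%N by apply: leq_ltn_trans (aB ord0).
have e0 : a ord0 = b ord0.
  by have := congr1 (modn^~ B) e; rewrite /= !split ![(_ ord0 + _)%N]addnC !modnMDl !modn_small.
move: e; rewrite !split e0 => /addnI/eqP; rewrite eqn_mul2r gtn_eqF//= => /eqP e i.
have h := IH (a \o lift ord0) (b \o lift ord0) (fun i => aB _) (fun i => bB _) e.
by case: (unliftP ord0 i) => [j ->|->] //; exact: h.
Qed.

(** Inverting a Vandermonde matrix writes each coefficient as a combination of values. E is any set
    closed under combinations, so the lemma serves polynomial identities as well as
    subrepresentations. *)
Lemma coef_extraction (F : numFieldType) (V : lmodType F) (E : set V) M (u : 'I_M -> V) :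
  E 0 -> (forall c x y, E x -> E y -> E (c *: x + y)) ->
  (forall s : nat, (0 < s)%N -> E (\sum_(k < M) s%:R ^+ k *: u k)) -> forall k, E (u k).
Proof.
(* The nodes are 1, ..., M, since only positive s are available. *)
move=> E0 EL h k; pose a : 'rV[F]_M := \row_j (j.+1)%:R.
have uV : Vandermonde M a \in unitmx.
  rewrite unitmxE det_Vandermonde unitfE prodf_seq_neq0; apply/allP => i _ /=.
  rewrite prodf_seq_neq0; apply/allP => j _; apply/implyP => ij.
  by rewrite !mxE subr_eq0 eqr_nat eqSS gtn_eqF.
have -> : u k = \sum_j (invmx (Vandermonde M a)) j k *: (\sum_(l < M) a 0 j ^+ l *: u l).
  under eq_bigr do rewrite scaler_sumr.
  rewrite exchange_big /=; under eq_bigr do under eq_bigr do rewrite scalerA mulrC.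
  under eq_bigr do rewrite -scaler_suml.
  have vi (l : 'I_M) : \sum_j a 0 j ^+ l * (invmx (Vandermonde M a)) j k = (l == k)%:R.
    transitivity ((Vandermonde M a *m invmx (Vandermonde M a)) l k).
      by rewrite mulmx_entry; apply: eq_bigr => j _; rewrite [Vandermonde _ _ _ _]mxE.
    by rewrite mulmxV // mxE.
  under eq_bigr do rewrite vi.
  rewrite (bigD1 k)//= big1 ?addr0; first by rewrite eqxx scale1r.
  by move=> l /negbTE lk; rewrite lk scale0r.
elim/big_rec: _ => // j x _ Ex; apply: EL => //.
by rewrite mxE; exact: h.
Qed.

Lemma kronecker_extraction (F : numFieldType) (V : lmodType F) (E : set V)
    (I : finType) (e : I -> nat) (u : I -> V) :
  E 0 -> (forall c x y, E x -> E y -> E (c *: x + y)) ->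
  (forall s : nat, (0 < s)%N -> E (\sum_i s%:R ^+ e i *: u i)) ->
  forall j, E (\sum_(i | e i == j) u i).
Proof.
move=> E0 EL h j; pose M := (\max_i e i + j).+1.
have eM i : (e i < M)%N by rewrite ltnS (leq_trans (leq_bigmax i)) // leq_addr.
have jM : (j < M)%N by rewrite ltnS leq_addl.
have := @coef_extraction F V E M (fun k => \sum_(i | e i == k) u i) E0 EL _ (Ordinal jM).
apply=> s s0.
suff -> : \sum_(k < M) s%:R ^+ k *: (\sum_(i | e i == k) u i) =
  \sum_i s%:R ^+ e i *: u i by exact: h.
under eq_bigr do rewrite scaler_sumr.
rewrite (exchange_big_dep predT) //=; apply: eq_bigr => i _.
by rewrite (big_pred1 (Ordinal (eM i))) // => k; rewrite eq_sym.
Qed.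

(** Kronecker substitution: with y_i = s^(B^i) and B above every exponent, distinct monomials become
    distinct powers of s and their coefficients can be extracted. *)
Lemma mpoly_real_inj (R : realType) n (p q : mpoly n R[i]) :
  (forall y : 'I_n -> R, meval (fun j => (y j)%:C) p = meval (fun j => (y j)%:C) q) -> p = q.
Proof.
move=> h; apply/eqP; rewrite -subr_eq0; apply/eqP.
have {h} : forall y : 'I_n -> R, meval (fun j => (y j)%:C) (p - q) = 0.
  by move=> y; rewrite mevalB h subrr.
move: (p - q) => {p q} p h.
pose B := msize p.
have mB (m : multinom n) : m \in msupp p -> forall i, (m i < B)%N.
  by move=> mp i; rewrite (leq_ltn_trans _ (msize_mdeg_lt mp))// mdegE (bigD1 i)//= leq_addr.
pose sm i := nth (mnm0 : multinom n) (msupp p) i.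
have sp (i : 'I_(size (msupp p))) : sm i \in msupp p by exact: mem_nth.
pose e (k : 'I_(size (msupp p))) := (\sum_(i < n) sm k i * B ^ i)%N.
have H := @kronecker_extraction R[i] R[i]^o [set 0] _ e (fun k => mcoeff (sm k) p) erefl.
apply/mpolyP => m; rewrite mcoeff0.
case mp: (m \in msupp p); last first.
  by apply: memN_msupp_eq0; rewrite mp.
have im : (index m (msupp p) < size (msupp p))%N by rewrite index_mem.
have := H _ _ (e (Ordinal im)); rewrite (big_pred1 (Ordinal im)); last first.
  move=> k /=; apply/eqP/eqP => [ee|->//]; apply: val_inj => /=.
  apply/eqP; rewrite -(nth_uniq (mnm0 : multinom n) _ _ (msupp_uniq p))//; apply/eqP.
  by apply/mnmP => i; exact: (kronecker_inj (mB _ (sp k)) (mB _ (sp (Ordinal im))) ee).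
rewrite /sm /= nth_index//; apply=> [c x y -> ->|s s0] /=; first by rewrite scaler0 addr0.
rewrite -[RHS](h (fun i => s%:R ^+ (B ^ i))) mevalE.
rewrite (big_nth (mnm0 : multinom n)) big_mkord; apply: eq_bigr => k _.
rewrite /e -[_ *: _]/(_ * _) mulrC; congr (_ * _).
rewrite expr_sum; apply: eq_bigr => i _.
by rewrite rmorphXn rmorph_nat -exprM mulnC.
Qed.

Lemma mpoly_of_dhomogZ (R : realType) n l (c : R[i]) (p : dhomog n R[i] l) :
  mpoly_of_dhomog (c *: p) = c *: mpoly_of_dhomog p.
Proof. by []. Qed.

Lemma mpoly_of_dhomogD (R : realType) n l (p q : dhomog n R[i] l) :
  mpoly_of_dhomog (p + q) = mpoly_of_dhomog p + mpoly_of_dhomog q.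
Proof. by []. Qed.

Lemma mpoly_of_dhomog_sum (R : realType) n l (I : Type) (r : seq I) (F : I -> dhomog n R[i] l) :
  mpoly_of_dhomog (\sum_(i <- r) F i) = \sum_(i <- r) mpoly_of_dhomog (F i).
Proof. by elim/big_rec2: _ => // i p q _ <-. Qed.

(** * The operator from the scalar to the polynomial principal series *)

Section Symbol.
Variables (R : realType) (k : nat).
Let N := k.+1.
Implicit Types (psi : 'cV[R]_(1 + N) -> R[i]) (A : 'M[R]_(1 + N)) (x : 'cV[R]_(1 + N)).
Implicit Types (y : 'cV[R]_N) (l : nat).

(* A word of pairs (j, i) encodes one term of the expansion of (D_{A(0,y)})^l,
   where A(0,y) = sum_(j,i) y_j A_(i,j) e_i: each letter contributes the variable
   y_j, the entry A_(i,j) and the derivative in direction e_i. *)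
Definition idx : finType := ('I_N * 'I_(1 + N))%type.

Fixpoint words l : seq (seq idx) :=
  if l is l'.+1 then [seq t :: w | t <- enum idx, w <- words l'] else [:: [::]].

Definition dword (w : seq idx) psi : 'cV[R]_(1 + N) -> R[i] :=
  foldl (fun f t => cderive (delta_mx t.2 0) f) psi w.

Definition aword A (w : seq idx) : R := \prod_(t <- w) A t.2 (rshift 1 t.1).

Definition xword (w : seq idx) : mpoly N R[i] := \prod_(t <- w) mpolyX R[i] (mnm1 t.1).

(** [indhomog] has a default value outside degree l; by [xword_in] it is never met on [words l]. *)
Definition lsymb l psi A x : dhomog N R[i] l :=
  \sum_(w <- words l) ((aword A w)%:C * dword w psi x) *: indhomog l (xword w).

Lemma size_words l w : w \in words l -> size w = l.
Proof.
elim: l w => [|l IH] w /=; first by rewrite inE => /eqP ->.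
by move=> /allpairsP[[t w'] [_ /IH hw ->]] /=; rewrite hw.
Qed.

Lemma xword_homog w : xword w \is ishomog1 (size w) mdeg.
Proof.
rewrite /xword; elim: w => [|t w IH]; first by rewrite big_nil dhomog1.
have h1 : mpolyX R[i] (mnm1 t.1) \is ishomog1 1%N mdeg by rewrite dhomogX /= mdeg1.
by rewrite big_cons; exact: (dhomogM h1 IH).
Qed.

Lemma xword_in l w : w \in words l -> val (indhomog l (xword w)) = xword w.
Proof. by move=> /size_words hw; rewrite insubdK // -hw; exact: xword_homog. Qed.

Lemma csm_dword w psi : csm (@nz R _) psi -> csm (@nz R _) (dword w psi).
Proof. by elim: w psi => //= t w IH psi h; apply: IH; exact: csm_cderive. Qed.

Definition emb0 y : 'cV[R]_(1 + N) := col_mx 0 y.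

Lemma mul_emb0 A y : A *m emb0 y =
  \sum_(t : idx) (y t.1 0 * A t.2 (rshift 1 t.1)) *: delta_mx t.2 0.
Proof.
apply/matrixP => i j; rewrite [j]ord1 summxE mxE big_split_ord /=.
rewrite big1 ?add0r; last by move=> l _; rewrite col_mxEu mxE mulr0.
rewrite -(pair_bigA _ (fun a b => ((y a 0 * A b (rshift 1 a)) *: delta_mx b 0) i 0)) /=.
apply: eq_bigr => a _; rewrite col_mxEd (bigD1 i)//= big1 ?addr0.
  by rewrite !mxE !eqxx mulr1 mulrC.
by move=> b /negbTE bi; rewrite !mxE eq_sym bi mulr0.
Qed.

(** Words are ordered, so iterating the expansion of one directional derivative produces each word
    once and no multinomial coefficients. *)
Lemma lsymb_eval l psi A x y : csm (@nz R _) psi -> x != 0 ->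
  meval (fun j => (y j 0)%:C) (mpoly_of_dhomog (lsymb l psi A x)) =
  iter l (cderive (A *m emb0 y)) psi x.
Proof.
move=> hpsi x0.
have -> : meval (fun j => (y j 0)%:C) (mpoly_of_dhomog (lsymb l psi A x)) =
  \sum_(w <- words l) (\prod_(t <- w) (y t.1 0 * A t.2 (rshift 1 t.1)))%:C * dword w psi x.
  rewrite /lsymb mpoly_of_dhomog_sum raddf_sum big_seq [RHS]big_seq; apply: eq_bigr => w hw.
  rewrite mpoly_of_dhomogZ /= mevalZ -[mpoly_of_dhomog _]/(val (indhomog l (xword w))) (xword_in hw) big_split /=.
  have -> : meval (fun j => (y j 0)%:C) (xword w) = (\prod_(t <- w) y t.1 0)%:C.
    rewrite /xword; elim: w {hw} => [|t w IH]; first by rewrite !big_nil meval1.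
    by rewrite !big_cons mevalM mevalXU IH rmorphM.
  by rewrite -/(aword A w) rmorphM /=; ring.
elim: l psi hpsi => [|l IH] psi hpsi; first by rewrite big_seq1 big_nil mul1r.
rewrite iterSr mul_emb0.
rewrite (@iter_cderive_ext _ _ _ (@open_nz R _) l _ _ (fun z => \sum_(t : idx)
   (y t.1 0 * A t.2 (rshift 1 t.1))%:C * cderive (delta_mx t.2 0) psi z)) //; last first.
  by move=> z z0; exact: cderive_sumdir (@open_nz R _) hpsi z0.
rewrite (iter_cderive_sum (@open_nz R _))//; last first.
  by move=> t; apply: csmZ; [exact: open_nz|exact: csm_cderive].
rewrite big_allpairs_dep big_enum; apply: eq_bigr => t _ /=.
rewrite (iter_cderiveZ (@open_nz R _))//; last exact: csm_cderive.
rewrite -mul_emb0 -IH; last exact: csm_cderive.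
by rewrite mulr_sumr; apply: eq_bigr => w _; rewrite big_cons rmorphM mulrA.
Qed.
End Symbol.

Section DL.
Variables (R : realType) (k : nat).
Let N := k.+1.
Implicit Types (psi : 'cV[R]_(1 + N) -> R[i]) (y : 'cV[R]_N) (l : nat) (g : SL R N.+1).

Lemma iter_cderiveZdir n l (a : R) v (f : 'cV[R]_n -> R[i]) x : csm (@nz R n) f -> x != 0 ->
  iter l (cderive (a *: v)) f x = (a ^+ l)%:C * iter l (cderive v) f x.
Proof.
move=> hf; elim: l x => [|l IH] x x0; first by rewrite mul1r.
rewrite /= (@cderive_ext _ _ (@nz R n) _ (fun z => (a ^+ l)%:C * iter l (cderive v) f z))//; last exact: open_nz.
rewrite (cderiveZ _ _ (csm_iter l v hf) x0) (cderiveZdir (@open_nz R n) _ _ (csm_iter l v hf) x0).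
by rewrite exprSr rmorphM /= mulrA.
Qed.

Definition rpt y : 'I_N -> R[i] := fun j => (y j 0)%:C.

Lemma dhomog_real_inj l (p q : dhomog N R[i] l) :
  (forall y, meval (rpt y) (mpoly_of_dhomog p) = meval (rpt y) (mpoly_of_dhomog q)) -> p = q.
Proof.
move=> h; apply: val_inj; apply: mpoly_real_inj => y.
have := h (\col_j y j); rewrite /rpt.
by rewrite !(@meval_eq _ _ (fun j => ((\col_j y j) j 0)%:C) (fun j => (y j)%:C)) => [|j|j]; rewrite ?mxE.
Qed.

(** The factor 1/l! matches the normalisation y^a / a! of [ytilde] through the multinomial
    theorem. *)
Definition DL l psi g : dhomog N R[i] l :=
  (l`!%:R)^-1 *: lsymb l psi (slmx g) (slmx g *m e0 R N).

Lemma DL_eval l psi g y : csm (@nz R _) psi ->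
  meval (rpt y) (mpoly_of_dhomog (DL l psi g)) =
  (l`!%:R)^-1 * iter l (cderive (slmx g *m emb0 y)) psi (slmx g *m e0 R N).
Proof.
move=> hpsi; rewrite /DL mpoly_of_dhomogZ mevalZ lsymb_eval//.
exact: SL_e0_neq0.
Qed.

Lemma DL_ext l psi psi' : csm (@nz R _) psi -> csm (@nz R _) psi' ->
  (forall x, x != 0 -> psi x = psi' x) -> DL l psi = DL l psi'.
Proof.
move=> h h' e; apply/funext => g; apply: dhomog_real_inj => y; rewrite !DL_eval//.
by congr (_ * _); apply: (iter_cderive_ext (@open_nz R _)) => //; exact: SL_e0_neq0.
Qed.

Lemma DL_lin l (a : R[i]) psi psi' : csm (@nz R _) psi -> csm (@nz R _) psi' ->
  DL l (fun x => a * psi x + psi' x) = (fun g => a *: DL l psi g + DL l psi' g).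
Proof.
move=> h h'; have o := @open_nz R (1 + N); apply/funext => g; apply: dhomog_real_inj => y.
have hc : csm (@nz R _) (fun x => a * psi x + psi' x) by apply: csmD => //; exact: csmZ.
rewrite (DL_eval _ _ _ hc) mpoly_of_dhomogD (mpoly_of_dhomogZ a) mevalD mevalZ !DL_eval//.
have x0 := SL_e0_neq0 g.
rewrite (iter_cderiveD o)//; last exact: csmZ.
by rewrite (iter_cderiveZ o)// mulrDr mulrCA.
Qed.

Lemma DL_ltrans l psi g0 : csm (@nz R _) psi ->
  DL l (fun x => psi (invmx (slmx g0) *m x)) = ltrans g0 (DL l psi).
Proof.
move=> h; apply/funext => g; apply: dhomog_real_inj => y; rewrite /ltrans !DL_eval//.
  congr (_ * _); rewrite /= -!mulmxA; apply: cderive_iter_affine => c x.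
  by rewrite mulmxDr -scalemxAr.
apply: csm_comp h; [exact: open_nz|exact: open_nz| |].
  by move=> x; exact: (@SL_mul_neq0 _ _ (g0^-1)%g x).
by move=> K i j; apply: Cn_mulmx; exact: open_nz.
Qed.

Lemma poly_rep_eval l h (p : dhomog N R[i] l) y :
  meval (rpt y) (mpoly_of_dhomog (poly_rep h p)) = meval (rpt (invmx h *m y)) (mpoly_of_dhomog p).
Proof.
rewrite /= comp_mpoly_meval; apply: meval_eq => i; rewrite tnth_mktuple.
rewrite raddf_sum /rpt mxE rmorph_sum; apply: eq_bigr => j _ /=.
by rewrite mevalZ mevalXU rmorphM.
Qed.

Lemma smooth_dword w psi : csm (@nz R _) psi ->
  smooth_SL (fun g => dword w psi (slmx g *m e0 R N)).
Proof. by move=> h; apply: smooth_SL_point; [exact: e0_neq0|exact: csm_dword]. Qed.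

Lemma smooth_SLM n (f1 f2 : SL R n -> R[i]) : smooth_SL f1 -> smooth_SL f2 ->
  smooth_SL (fun g : SL R n => f1 g * f2 g).
Proof.
move=> h1 h2 g; have [U [F [oU Ug /smooth_onP hF eF]]] := h1 g.
have [U' [F' [oU' Ug' /smooth_onP hF' eF']]] := h2 g.
exists (U `&` U'), (fun A => F A * F' A); split => //.
- exact: openI.
- apply/smooth_onP; apply: csmM; first exact: openI.
    by apply: csm_sub hF => ? [].
  by apply: csm_sub hF' => ? [].
- by move=> h [Uh Uh']; rewrite eF // eF'.
Qed.

Lemma smooth_aword w : smooth_SL (fun g => (aword (slmx g) w)%:C : R[i]).
Proof.
apply: (@smooth_SL_restr _ _ setT (fun A => (aword A w)%:C)) => //; first exact: openT.
apply: csm_real => K; rewrite /aword.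
suff key v : Cn K setT (fun A : 'M[R]_(1 + N) => \prod_(t <- v) A t.2 (rshift 1 t.1)) by exact: key.
elim: v => [|t v IH].
  by apply: Cn_ext (Cn_cst K setT 1); [exact: openT|move=> A _; rewrite big_nil].
apply: (@Cn_ext _ _ K setT (fun A : 'M[R]_(1 + N) =>
  A t.2 (rshift 1 t.1) * \prod_(t <- v) A t.2 (rshift 1 t.1))).
- exact: openT.
- by move=> A _; rewrite big_cons.
- by apply: CnM; [exact: openT|exact: Cn_coord|].
Qed.

Lemma DL_sumE l psi g : DL l psi g = \sum_(w <- words k l)
  ((aword (slmx g) w)%:C * dword w psi (slmx g *m e0 R N)) *:
    ((l`!%:R)^-1 *: indhomog l (xword R w)).
Proof.
rewrite /DL /lsymb scaler_sumr; apply: eq_bigr => w _.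
by rewrite !scalerA mulrC.
Qed.

Lemma DL_smooth l psi : csm (@nz R _) psi -> vsmooth_SL (DL l psi).
Proof.
move=> h; have -> : DL l psi = (fun g => DL l psi g) by [].
under [X in vsmooth_SL X]eq_fun do rewrite DL_sumE.
apply: vsmooth_sum => w; apply: smooth_SLM; first exact: smooth_aword.
exact: smooth_dword.
Qed.

(** Multiplication by p sends e_0 to c e_0, and (0,y) to e'(0,hy) plus a multiple of e_0, with c =
    det(h)^-1 e^t and e' = exp(-t/N). Euler's identity discards the multiple of e_0. The base point
    contributes chi(c) / c^l, of modulus e^-t, and the l directions contribute e'^l = exp(-l t/N):
    together the parameter 1 + l/N. *)
Lemma DL_Ind l b psi : (0 < l)%N -> b = 1 \/ b = -1 -> Hom l.-1 b psi ->
  Ind (@poly_rep R N l) (sgn_add b l) (1 + l%:R / N%:R) (DL l psi).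
Proof.
move=> l0 hb [hpsi hom]; split; first exact: DL_smooth.
move=> g p h t x hh ep; apply: dhomog_real_inj => y.
rewrite DL_eval// (mpoly_of_dhomogZ (_ %:C)) mevalZ poly_rep_eval DL_eval// invmxK.
have x0 := SL_e0_neq0 g; set X0 := slmx g *m e0 R N in x0 *.
pose c := (\det h)^-1 * expR t; pose e' := expR (- (t / N%:R)).
have dh0 : (\det h)^-1 != 0.
  by rewrite invr_eq0; case: hh => ->; rewrite ?oppr_eq0 oner_eq0.
have c0 : c != 0 by rewrite mulf_neq0// gt_eqF ?expR_gt0.
have eX : slmx (g * p)%g *m e0 R N = c *: X0.
  by rewrite /= -mulmxA ep parabolic_e0// -scalemxAr.
have eV : slmx (g * p)%g *m emb0 y =
    e' *: (slmx g *m emb0 (h *m y)) + ((c *: x) *m y) 0 0 *: X0.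
  rewrite /= -mulmxA ep parabolic_block// /X0 !scalemxAr -mulmxDr; congr (_ *m _).
  rewrite e0_block /emb0 (@mul_block_col R 1 N 1 N) !(@scale_col_mx R 1 N).
  rewrite (@add_col_mx R 1 N) !mulmx0 !scaler0 !add0r addr0 -scalemxAl.
  by rewrite scale_scalar_mx mulr1 -mx11_scalar.
rewrite eX eV.
have H1 : homw setT (fun s => chi l.-1 b s / s ^+ l)
    (iter l (cderive (e' *: (slmx g *m emb0 (h *m y)) + ((c *: x) *m y) 0 0 *: X0)) psi).
  by apply: homw_iter => // s z _; exact: hom.
have H2 : homw [set s | 0 < s] (fun s => s ^+ l / s) psi.
  move=> s z /= s0 s1 z0; rewrite hom// /chi /spow gtr0_norm// gtr0_sg// if_same mulr1.
  by rewrite -{2}(prednK l0) exprSr mulfK.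
rewrite (H1 c X0 I c0 x0) (euler_drop _ _ hpsi x0 H2) iter_cderiveZdir//.
rewrite [RHS]mulrCA; congr (_ * _); rewrite mulrA -rmorphM; congr (_%:C * _).
have NR : N%:R != 0 :> R by rewrite pnatr_eq0.
have -> : expR ((1 + l%:R / N%:R) * t) = expR t * (e' ^+ l)^-1.
  rewrite /e' expRN exprVn invrK -expRM_natl -expRD; congr expR.
  by rewrite mulrDl mul1r; congr (_ + _); field.
have en : `|c| = expR t.
  rewrite /c normrM [X in _ * X]ger0_norm ?expR_ge0//.
  by case: hh => ->; rewrite ?invrN invr1 ?normrN normr1 mul1r.
have sc : Num.sg c = \det h.
  rewrite /c sgrM [Num.sg (expR t)]gtr0_sg ?expR_gt0// mulr1.
  by case: hh => ->; rewrite ?invrN invr1 ?sgrN sgr1.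
have cE : c = \det h * expR t by rewrite -sc -en -numEsg.
(* The sign of c^-l is det(h)^l, which turns the parity b into b + l. *)
have sdl : spow b c * (\det h) ^- l = (sgn_pow (sgn_add b l) h)^-1.
  rewrite /spow /sgn_pow /sgn_add sc.
  have e1 : (1 * -1 == 1 :> int) = false by [].
  have e2 : (1 * 1 == 1 :> int) = true by [].
  have e3 : (-1 == 1 :> int) = false by [].
  have e4 : (-1 * -1 == 1 :> int) = true by [].
  have e5 : (-1 * 1 == 1 :> int) = false by [].
  rewrite -[(-1) ^+ l]signr_odd; case: hh => ->; rewrite ?expr1n -?[(-1) ^+ l]signr_odd.
    by rewrite sgr1 !if_same mul1r.
  rewrite sgrN sgr1; case: hb => ->; case: (odd l);
    rewrite ?expr0 ?expr1 ?eqxx ?e1 ?e2 ?e3 ?e4 ?e5;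
    by rewrite ?invrN ?invr1 ?mulN1r ?mul1r ?opprK.
rewrite /chi en invfM invfM invrK -sdl [in X in _ / X]cE exprMn invfM.
have et : expR t != 0 by rewrite gt_eqF ?expR_gt0.
have -> : expR t ^+ l.-1 = expR t ^+ l / expR t by rewrite -{2}(prednK l0) exprSr mulfK.
have P0 : expR t ^+ l != 0 by rewrite expf_neq0.
have D0 : \det h ^+ l != 0 by rewrite expf_neq0// -invr_eq0.
move: (spow b c) (expR t ^+ l) (\det h ^+ l) (e' ^+ l) (expR t) P0 D0 et => s P D e T P0 D0 T0.
by field; rewrite P0 D0 T0.
Qed.
End DL.

(** * Density of the open cell N_- P *)

Section Density.
Variables (R : realType).

Lemma smooth_SL_curve n (f : SL R n -> R[i]) (c : R -> SL R n) : smooth_SL f ->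
  (forall i j, {for 0, continuous (fun s => slmx (c s) i j)}) ->
  {for 0, continuous (fun s => complex.Re (f (c s)))} /\
  {for 0, continuous (fun s => complex.Im (f (c s)))}.
Proof.
move=> hf hc; have [U [F [oU Uc /smooth_onP hF eF]]] := hf (c 0).
have cc : {for 0, continuous (fun s => slmx (c s))} by apply: cvg_mx => i j; exact: hc.
have nU : \forall s \near (0 : R), F (slmx (c s)) = f (c s).
  have nU' : \forall s \near (0 : R), U (slmx (c s)).
    exact: cc (open_nbhs_nbhs (conj oU Uc)).
  by apply: filterS nU' => s; exact: eF.
have [a b] := hF 0%N.
have key (r : 'M[R]_n -> R) (r' : R[i] -> R) : {for slmx (c 0), continuous r} ->
    (forall A, r A = r' (F A)) -> {for 0, continuous (fun s => r' (f (c s)))}.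
  move=> cr er; rewrite /prop_for /continuous_at -(eF _ Uc) -er.
  have h := continuous_comp cc cr.
  apply: cvg_trans h; apply: near_eq_cvg; move: nU; apply: filterS => s /=.
  by rewrite er => ->.
split.
- exact: (key _ (@complex.Re R) (Cn_cont a Uc) (fun=> erefl)).
- exact: (key _ (@complex.Im R) (Cn_cont b Uc) (fun=> erefl)).
Qed.

Lemma cont_eq0 (r1 r2 : R -> R) : {for 0, continuous r1} -> {for 0, continuous r2} ->
  (forall s, s != 0 -> r1 s = r2 s) -> r1 0 = r2 0.
Proof.
move=> c1 c2 e; have h1 : r1 @ 0^' --> r1 0 by apply: cvg_within_filter; exact: c1.
have h2 : r2 @ 0^' --> r2 0 by apply: cvg_within_filter; exact: c2.
suff h3 : r1 @ 0^' --> r2 0 by exact: (cvg_unique _ h1 h3).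
apply: cvg_trans h2; apply: near_eq_cvg; near=> s; apply/esym/e.
by near: s; exact: nbhs_dnbhs_neq.
Unshelve. all: by end_near. Qed.

(** The elements g with (g e_0)_0 nonzero lie in N_- P, where equivariance determines f. If this
    entry vanishes, some entry (0,j) of the first row does not, since det g = 1; then g nbar(s e_j)
    lies in the cell for every s other than 0, and s -> 0 concludes by continuity. *)
Lemma Ind_nbar_inj k (V : vectType R[i]) rho d nu (f1 f2 : SL R k.+2 -> V) :
  @Ind R k.+1 V rho d nu f1 -> @Ind R k.+1 V rho d nu f2 ->
  (forall x, f1 (nbar x) = f2 (nbar x)) -> f1 = f2.
Proof.
move=> [s1 e1] [s2 e2] e12; pose N := k.+1.
have dense (g : SL R N.+1) : (slmx g *m e0 R N) 0 0 != 0 -> f1 g = f2 g.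
  set X : 'cV[R]_(1 + N) := slmx g *m e0 R N => c0.
  pose c := X 0 0; pose x : 'rV[R]_N := c^-1 *: (dsubmx X)^T.
  have eX : X = c *: (slmx (nbar x) *m e0 R N).
    rewrite slmx_nbar e0_block (@mul_block_col R 1 N 1 N) !mulmx0 !addr0 !mulmx1.
    rewrite (@scale_col_mx R 1 N) scale_scalar_mx mulr1 /x linearZ /= trmxK scalerA divff// scale1r.
    rewrite -[LHS]vsubmxK; congr col_mx.
    have l0 : lshift N (0 : 'I_1) = 0 :> 'I_(1 + N) by exact: val_inj.
    by apply/matrixP => i j; rewrite [LHS]mxE [RHS]mxE !ord1 mulr1n l0.
  have pe : slmx ((nbar x)^-1 * g)%g *m e0 R N = c *: e0 R N.
    by rewrite /= -mulmxA -/X eX -scalemxAr mulKmx ?SL_unit.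
  have [h [t [z [hh ep _]]]] := parabolicP (isT : (0 < N)%N) c0 pe.
  have a1 := e1 (nbar x) _ h t z hh ep; have a2 := e2 (nbar x) _ h t z hh ep.
  by rewrite mulVKg in a1; rewrite mulVKg in a2; rewrite a1 a2 e12.
apply/funext => g; have [g0|] := eqVneq ((slmx g *m e0 R N) 0 0) 0; last exact: dense.
have [j gj] : exists j : 'I_N, slmx g 0 (lift ord0 j) != 0.
  apply/existsP; rewrite -[X in is_true X]negbK negb_exists; apply/negP => /forallP h.
  have := SL_det g; rewrite (expand_det_row _ 0) big1 ?eqxx => [/eqP|i _].
    by rewrite eq_sym oner_eq0.
  case: (unliftP 0 i) => [j ->|->]; first by have := h j; rewrite negbK => /eqP ->; rewrite mul0r.
  move: g0; rewrite mxE (bigD1 ord0)//= big1 => [|b /negbTE b0].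
    by rewrite mxE !eqxx mulr1 addr0 => ->; rewrite mul0r.
  by rewrite mxE b0 mulr0.
have Nd : Nminus (delta_mx 0 j : 'rV[R]_N) = delta_mx (lift ord0 j) ord0.
  rewrite /Nminus (bigD1 j)//= big1 ?addr0 => [|b /negbTE bj].
    by rewrite mxE !eqxx scale1r.
  by rewrite mxE eqxx bj scale0r.
pose c s : SL R N.+1 := (g * nbar (s *: delta_mx 0 j : 'rV[R]_N))%g.
have cE s : slmx (c s) = slmx g + s *: (slmx g *m Nminus (delta_mx 0 j : 'rV[R]_N)).
  have -> : slmx (c s) = slmx g *m slmx (nbar (s *: delta_mx 0 j : 'rV[R]_N)) by [].
  have -> : slmx (nbar (s *: delta_mx 0 j : 'rV[R]_N)) =
      1%:M + s *: Nminus (delta_mx 0 j : 'rV[R]_N).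
    rewrite slmx_nbar Nminus_block (@scale_block_mx R 1 N 1 N) !scaler0.
    by rewrite (scalar_mx_block 1 N 1) (@add_block_mx R 1 N 1 N) !addr0 !add0r linearZ.
  by rewrite mulmxDr mulmx1 scalemxAr.
have c00 : c 0 = g.
  by apply: val_inj; have := cE 0; rewrite scale0r addr0.
have ccont a b : {for 0, continuous (fun s => slmx (c s) a b)}.
  have -> : (fun s => slmx (c s) a b) =
      (fun s => slmx g a b + s * (slmx g *m Nminus (delta_mx 0 j : 'rV[R]_N)) a b).
    by apply/funext => s; rewrite cE [LHS]mxE; congr (_ + _); rewrite [LHS]mxE.
  apply: cvgD; first exact: cvg_cst.
  by apply: cvgMr_tmp; exact: cvg_id.
have ceq s : s != 0 -> f1 (c s) = f2 (c s).
  move=> s0; apply: dense.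
  rewrite cE mulmxDl [X in X != 0]mxE g0 add0r -scalemxAl [X in X != 0]mxE mulf_neq0//.
  by rewrite -mulmxA Nd mul_delta_mx -colE mxE.
rewrite [f1 g](coord_vbasis (memvf _)) [RHS](coord_vbasis (memvf _)).
apply: eq_bigr => i _; congr (_ *: _).
have [r1 i1] := smooth_SL_curve (s1 i) ccont; have [r2 i2] := smooth_SL_curve (s2 i) ccont.
rewrite -c00; apply: complexP.
- by apply: (cont_eq0 r1 r2) => s /ceq ->.
- by apply: (cont_eq0 i1 i2) => s /ceq ->.
Qed.
End Density.

(** * Normal derivatives along a hyperplane *)

Section Restriction.
Variables (R : realType).

Definition inclc n (x : 'cV[R]_n) : 'cV[R]_n.+1 :=
  castmx (addn1 n, erefl) (col_mx x (0 : 'cV[R]_1)).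

Definition elast n : 'cV[R]_n.+1 := castmx (addn1 n, erefl) (col_mx (0 : 'cV[R]_n) 1%:M).

Lemma castmx_mul p q (e : p = q) (A : 'M[R]_p) (x : 'cV[R]_p) :
  castmx (e, e) A *m castmx (e, erefl) x = castmx (e, erefl) (A *m x).
Proof. by case: q / e; rewrite !castmx_id. Qed.

Lemma castmx_lin p q (e : p = q) (a : R) (x y : 'cV[R]_p) :
  castmx (e, erefl) (a *: x + y) = a *: castmx (e, erefl) x + castmx (e, erefl) y.
Proof. by case: q / e; rewrite !castmx_id. Qed.

Lemma castmx_inj0 p q (e : p = q) (x : 'cV[R]_p) : (castmx (e, erefl 1%N) x == 0) = (x == 0).
Proof. by case: q / e; rewrite castmx_id. Qed.

Lemma inclc_lin n (a : R) (x y : 'cV[R]_n) : inclc (a *: x + y) = a *: inclc x + inclc y.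
Proof. by rewrite /inclc -castmx_lin scale_col_mx scaler0 add_col_mx addr0. Qed.

Lemma inclcZ n (a : R) (x : 'cV[R]_n) : inclc (a *: x) = a *: inclc x.
Proof.
have i0 : inclc (0 : 'cV[R]_n) = 0.
  by rewrite /inclc col_mx0; case: _.+1 / (addn1 n); rewrite castmx_id.
by rewrite -[a *: x]addr0 inclc_lin i0 addr0.
Qed.

Lemma inclc_neq0 n (x : 'cV[R]_n) : (inclc x != 0) = (x != 0).
Proof. by rewrite castmx_inj0 col_mx_eq0 eqxx andbT. Qed.

Lemma SLemb_incl n (g : SL R n) x : slmx (SLemb g) *m inclc x = inclc (slmx g *m x).
Proof. by rewrite /= castmx_mul mul_block_col !mulmx0 mul0mx !addr0. Qed.

Lemma SLemb_last n (g : SL R n) : slmx (SLemb g) *m elast n = elast n.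
Proof. by rewrite /= castmx_mul mul_block_col !mulmx0 !mul0mx !add0r mulmx1. Qed.

Lemma inclc_lift n (x : 'cV[R]_n) (i : 'I_n) : inclc x (lift ord_max i) 0 = x i 0.
Proof.
rewrite castmxE /= cast_ord_id -(col_mxEu x (0 : 'cV[R]_1)); congr (col_mx _ _ _ _).
by apply: val_inj; rewrite /= /bump leqNgt ltn_ord.
Qed.

Lemma inclc_max n (x : 'cV[R]_n) : inclc x ord_max 0 = 0.
Proof.
rewrite castmxE /= cast_ord_id (_ : cast_ord _ _ = rshift n 0) ?col_mxEd ?mxE//.
by apply: val_inj; rewrite /= addn0.
Qed.

Lemma elast_delta n : elast n = delta_mx ord_max 0.
Proof.
apply/matrixP => i j; rewrite [j]ord1 castmxE /= cast_ord_id.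
case: (unliftP ord_max i) => [i' ->|->].
  rewrite (_ : cast_ord _ _ = lshift 1 i') ?col_mxEu ?mxE.
    by rewrite eq_sym (negbTE (neq_lift _ _)).
  by apply: val_inj; rewrite /= /bump leqNgt ltn_ord.
rewrite (_ : cast_ord _ _ = rshift n 0) ?col_mxEd ?mxE ?eqxx//.
by apply: val_inj; rewrite /= addn0.
Qed.

Lemma SLemb_inv n (g : SL R n) : SLemb (g^-1)%g = ((SLemb g)^-1)%g.
Proof.
have h : (SLemb (g^-1)%g * SLemb g)%g = 1%g.
  apply: val_inj; rewrite /=.
  have cm p q (e : p = q) (A B : 'M[R]_p) :
      castmx (e, e) A *m castmx (e, e) B = castmx (e, e) (A *m B).
    by case: q / e; rewrite !castmx_id.
  have c1 p q (e : p = q) : castmx (e, e) (1%:M : 'M[R]_p) = 1%:M.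
    by case: q / e; rewrite castmx_id.
  rewrite cm mulmx_block !mulmx0 !mul0mx !addr0 mulmx1 mulVmx ?SL_unit//.
  by rewrite add0r -scalar_mx_block c1.
by rewrite -[LHS]mulg1 -(mulgV (SLemb g)) mulgA h mul1g.
Qed.

Definition restm n (m : nat) (Psi : 'cV[R]_n.+1 -> R[i]) (x : 'cV[R]_n) : R[i] :=
  iter m (cderive (elast n)) Psi (inclc x).

Lemma csm_incl n (F : 'cV[R]_n.+1 -> R[i]) : csm (@nz R n.+1) F ->
  csm (@nz R n) (fun x => F (inclc x)).
Proof.
apply: csm_comp; [exact: open_nz|exact: open_nz|by move=> x; rewrite /nz /= inclc_neq0|].
move=> K i j; rewrite [j]ord1; case: (unliftP ord_max i) => [i' ->|->].
  by apply: Cn_ext (Cn_coord K (@nz R n) i' 0); [exact: open_nz|move=> x _; rewrite inclc_lift].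
by apply: Cn_ext (Cn_cst K (@nz R n) 0); [exact: open_nz|move=> x _; rewrite inclc_max].
Qed.

Lemma restm_csm n m Psi : csm (@nz R n.+1) Psi -> csm (@nz R n) (restm m Psi).
Proof. by move=> h; apply: csm_incl; exact: csm_iter. Qed.

(** Each normal derivative lowers the degree by one and flips the parity. *)
Lemma chi_div (m d : nat) (al : int) (c : R) : al = 1 \/ al = -1 -> c != 0 ->
  chi (m + d) al c / c ^+ m = chi d (sgn_add al m) c.
Proof.
move=> ha c0; rewrite /chi exprD.
have nc : `|c| ^+ m != 0 by rewrite expf_neq0// normr_eq0.
have -> : c ^+ m = Num.sg c ^+ m * `|c| ^+ m by rewrite -exprMn -numEsg.
have s1 : Num.sg c = 1 \/ Num.sg c = -1 by case: sgrP c0; [|left|right].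
have -> : spow (sgn_add al m) c = spow al c / Num.sg c ^+ m.
  rewrite /spow /sgn_add.
  have e1 : (1 * -1 == 1 :> int) = false by [].
  have e2 : (1 * 1 == 1 :> int) = true by [].
  have e3 : (-1 == 1 :> int) = false by [].
  have e4 : (-1 * -1 == 1 :> int) = true by [].
  have e5 : (-1 * 1 == 1 :> int) = false by [].
  case: s1 => ->; first by rewrite expr1n !if_same divr1.
  rewrite -[(-1) ^+ m]signr_odd -[(-1) ^+ m]signr_odd; case: ha => ->; case: (odd m);
    rewrite ?expr0 ?expr1 ?eqxx ?e1 ?e2 ?e3 ?e4 ?e5;
    by rewrite ?invrN ?invr1 ?mulN1r ?mul1r ?opprK.
have sn : Num.sg c ^+ m != 0 by rewrite expf_neq0// sgr_eq0.
by field; rewrite nc sn.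
Qed.

Lemma restm_Hom n (m d : nat) (al : int) Psi : al = 1 \/ al = -1 ->
  @Hom R n.+1 (m + d) al Psi -> Hom d (sgn_add al m) (restm m Psi).
Proof.
move=> ha [h1 h2]; split; first exact: restm_csm.
move=> c x c0 x0; rewrite /restm inclcZ -chi_div//.
have H : homw setT (chi (m + d) al) Psi by move=> s z _; exact: h2.
by rewrite (homw_iter (elast n) m h1 H)// inclc_neq0.
Qed.

(** Elements of G' fix the normal vector and preserve the hyperplane, so differentiating along the
    former and restricting to the latter commute with them. *)
Lemma restm_ltrans n m (g : SL R n) Psi x :
  restm m (fun x => Psi (invmx (slmx (SLemb g)) *m x)) x = restm m Psi (invmx (slmx g) *m x).
Proof.
rewrite /restm.
have -> : invmx (slmx (SLemb g)) = slmx (SLemb (g^-1)%g) by rewrite SLemb_inv.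
have -> : inclc (invmx (slmx g) *m x) = slmx (SLemb (g^-1)%g) *m inclc x.
  by rewrite SLemb_incl.
apply: cderive_iter_affine => h z.
by rewrite mulmxDr -scalemxAr SLemb_last.
Qed.
End Restriction.

(** * The multinomial theorem and the operator in coordinates *)

Section Multinomial.
Variables (R : realType) (E : normedModType R) (N : nat) (v : 'I_N -> E).
Implicit Types (f : E -> R[i]) (a : multinom N).

Definition dms (s : seq 'I_N) (a : multinom N) f :=
  foldr (fun j w => iter (a j) (cderive (v j)) w) f s.

Lemma csm_dms s a f : csm setT f -> csm setT (dms s a f).
Proof. by move=> hf; elim: s => //= j s IH; exact: csm_iter. Qed.

Lemma iter_commT l u w f : csm setT f ->
  cderive u (iter l (cderive w) f) = iter l (cderive w) (cderive u f).
Proof. by move=> hf; apply/funext => x; apply: (iter_cderive_comm openT). Qed.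

Lemma dms_comm s a u f : csm setT f -> cderive u (dms s a f) = dms s a (cderive u f).
Proof.
move=> hf; elim: s => //= j s IH.
by rewrite iter_commT ?IH//; exact: csm_dms.
Qed.

Lemma dms_iter s a l u f : csm setT f ->
  iter l (cderive u) (dms s a f) = dms s a (iter l (cderive u) f).
Proof.
move=> hf; elim: l => //= l ->; rewrite dms_comm//; exact: csm_iter.
Qed.

Lemma dms_notin s a j f : j \notin s -> dms s (mnm_add a (mnm1 j)) f = dms s a f.
Proof.
elim: s => //= i s IH; rewrite inE negb_or => /andP[ji js]; rewrite IH//.
by rewrite mnmDE mnm1E (negbTE ji) addn0.
Qed.

Lemma dms_succ s a j f : uniq s -> j \in s -> csm setT f ->
  dms s (mnm_add a (mnm1 j)) f = cderive (v j) (dms s a f).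
Proof.
move=> + + hf; elim: s => //= i s IH /andP[nis us]; rewrite inE.
case: (eqVneq j i) => [-> _|ji /= js].
  by rewrite dms_notin// mnmDE mnm1E eqxx addn1.
rewrite IH// -iter_commT; last exact: csm_dms.
by rewrite mnmDE mnm1E (negbTE ji) addn0.
Qed.

Lemma dms_sum s a (I : Type) (r : seq I) (c : I -> R[i]) (F : I -> E -> R[i]) z :
  (forall i, csm setT (F i)) ->
  dms s a (fun x => \sum_(i <- r) c i * F i x) z = \sum_(i <- r) c i * dms s a (F i) z.
Proof.
move=> hF; elim: s z => //= j s IH z.
have -> : dms s a (fun x => \sum_(i <- r) c i * F i x) =
   (fun x => \sum_(i <- r) c i * dms s a (F i) x) by apply/funext => x; exact: IH.
rewrite (iter_cderive_sum openT)//; last by move=> i; apply: csmZ; [exact: openT|exact: csm_dms].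
by apply: eq_bigr => i _; rewrite (iter_cderiveZ openT)//; exact: csm_dms.
Qed.

Variable y : 'I_N -> R.

(** The divided monomial y^a / a!, that is, [ytilde] evaluated at y. *)
Definition mono (a : multinom N) : R[i] :=
  (\prod_j (a j)`!%:R)^-1 * \prod_j (y j)%:C ^+ a j.

Lemma mono_succ a j : mono (mnm_add a (mnm1 j)) * (a j).+1%:R = mono a * (y j)%:C.
Proof.
rewrite /mono (bigD1 j)//= [X in _ * X * _](bigD1 j)//=.
rewrite [X in _ = X^-1 * _ * _](bigD1 j)//= [X in _ = _ * X * _](bigD1 j)//=.
rewrite mnmDE mnm1E eqxx addn1 factS natrM exprS.
have -> : \prod_(i < N | i != j) ((mnm_add a (mnm1 j)) i)`!%:R =
    \prod_(i < N | i != j) (a i)`!%:R :> R[i].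
  by apply: eq_bigr => i /negbTE ij; rewrite mnmDE mnm1E eq_sym ij addn0.
have -> : \prod_(i < N | i != j) (y i)%:C ^+ (mnm_add a (mnm1 j)) i =
    \prod_(i < N | i != j) (y i)%:C ^+ a i :> R[i].
  by apply: eq_bigr => i /negbTE ij; rewrite mnmDE mnm1E eq_sym ij addn0.
have h1 : (a j).+1%:R != 0 :> R[i] by rewrite pnatr_eq0.
have h2 : (a j)`!%:R != 0 :> R[i] by rewrite pnatr_eq0 -lt0n fact_gt0.
have h3 : \prod_(i < N | i != j) (a i)`!%:R != 0 :> R[i].
  by apply/prodf_neq0 => i _; rewrite pnatr_eq0 -lt0n fact_gt0.
move: ((a j).+1%:R : R[i]) ((a j)`!%:R : R[i]) h1 h2 => p q h1 h2.
by field; rewrite h1 h2 h3.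
Qed.

Lemma bmultinom_reindex B l (j : 'I_N) (H : multinom N -> R[i]) : (l.+1 < B)%N ->
  \sum_(b : bmultinom N B | mdeg b == l) H (mnm_add b (mnm1 j)) =
  \sum_(a : bmultinom N B | (mdeg a == l.+1) && (0 < (a : multinom N) j)%N) H a.
Proof.
move=> lB; have B0 : (mdeg (mnm0 : multinom N) < B)%N by rewrite mdeg0 (leq_trans _ lB).
pose z := BMultinom B0.
(* When the shifted index would have degree B or more, [h] falls back to index 0, whose degree is
   not l + 1; the degree condition thus rules the fallback out. *)
pose h (b : bmultinom N B) := insubd z (mnm_add b (mnm1 j)).
pose h' (b : bmultinom N B) := insubd z (mnm_sub b (mnm1 j)).
rewrite [RHS](reindex_onto h h'); last first.
  move=> a /andP[/eqP da aj]; apply: val_inj.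
  have e : mnm_add (mnm_sub a (mnm1 j)) (mnm1 j) = a.
    by apply: submK; apply/mnm_lepP => i; rewrite mnm1E; case: eqP => // <-.
  have d : mdeg (mnm_sub a (mnm1 j)) = l.
    by have := congr1 mdeg e; rewrite mdegD mdeg1 da addn1 => -[].
  rewrite /h /h' [X in mnm_add X _]insubdK; first by rewrite insubdK e // unfold_in da.
  by rewrite /in_mem /= d ltnW.
have hE (b : bmultinom N B) : mdeg b == l -> bmnm (h b) = mnm_add b (mnm1 j).
  by move=> /eqP db; rewrite [LHS]insubdK // /in_mem /= mdegD mdeg1 db addn1.
apply: eq_big => [b|b db]; last by rewrite hE.
apply/idP/idP => [db|].
  rewrite hE// mdegD mdeg1 addn1 (eqP db) eqxx mnmDE mnm1E eqxx addn1 /=.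
  apply/eqP/val_inj; rewrite /h' hE//.
  have e : mnm_sub (mnm_add b (mnm1 j)) (mnm1 j) = b by exact: addmK.
  by rewrite insubdK e // /in_mem /= (eqP db) ltnW.
move=> /andP[/andP[/eqP d hj] /eqP e].
have [lb|lb] := ltnP (mdeg b).+1 B; last first.
  move: d; rewrite /h /insubd insubF /=; first by rewrite mdeg0.
  by rewrite mdegD mdeg1 addn1 ltnNge lb.
have hb : bmnm (h b) = mnm_add b (mnm1 j).
  by rewrite [LHS]insubdK // /in_mem /= mdegD mdeg1 addn1.
by move: d; rewrite hb mdegD mdeg1 addn1 => -[->].
Qed.

(** One more derivative raises one exponent. After reindexing, the term of exponent a occurs with
    weight sum_j a_j = l + 1, which cancels the new factor of (l + 1)!. *)
Lemma multinomial_derive B l f z : (l < B)%N -> csm setT f ->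
  (l`!%:R)^-1 * iter l (cderive (\sum_j y j *: v j)) f z =
  \sum_(b : bmultinom N B | mdeg b == l) dms (enum 'I_N) b f z * mono b.
Proof.
move=> + hf; elim: l f z hf => [|l IH] f z hf lB.
  have B0 : (mdeg (mnm0 : multinom N) < B)%N by rewrite mdeg0.
  rewrite (big_pred1 (BMultinom B0)); last first.
    by move=> b /=; rewrite mdeg_eq0; apply/eqP/eqP => [e|->//]; exact: val_inj.
  rewrite /= fact0 invr1 mul1r /mono big1 ?invr1 ?mul1r ?big1 ?mulr1.
  - elim: (enum _) => //= j s IH; rewrite mnm0E //=.
  - by move=> j _; rewrite mnm0E expr0.
  - by move=> j _; rewrite mnm0E fact0.
have hD j : csm setT (cderive (v j) f) by exact: csm_cderive.
have lB' : (l < B)%N by exact: ltnW.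
rewrite iterSr.
have -> : cderive (\sum_j y j *: v j) f = (fun x => \sum_j (y j)%:C * cderive (v j) f x).
  by apply/funext => x; exact: (cderive_sumdir _ _ openT).
have hS : csm setT (fun x => \sum_j (y j)%:C * cderive (v j) f x).
  by apply: csm_sum => [|j _]; [exact: openT|apply: csmZ => //; exact: openT].
rewrite factS natrM invfM -mulrA IH//.
under eq_bigr => b _ do rewrite dms_sum//.
pose H (j : 'I_N) (a : multinom N) := dms (enum 'I_N) a f z * mono a * (a j)%:R.
have -> : \sum_(b : bmultinom N B | mdeg b == l)
   (\sum_j (y j)%:C * dms (enum 'I_N) b (cderive (v j) f) z) * mono b =
  \sum_j \sum_(b : bmultinom N B | mdeg b == l)
    H j (mnm_add b (mnm1 j)).
  rewrite /H exchange_big /=; apply: eq_bigr => b _; rewrite mulr_suml; apply: eq_bigr => j _.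
  rewrite dms_succ ?enum_uniq ?mem_enum// dms_comm// mnmDE mnm1E eqxx addn1.
  by rewrite -[RHS]mulrA mono_succ; ring.
under eq_bigr => j _ do rewrite (bmultinom_reindex j (H j) lB).
rewrite /H.
have -> : \sum_(j < N) \sum_(a : bmultinom N B | (mdeg a == l.+1) && (0 < (a : multinom N) j)%N)
    dms (enum 'I_N) a f z * mono a * (a j)%:R =
  \sum_(a : bmultinom N B | mdeg a == l.+1) (l.+1)%:R * (dms (enum 'I_N) a f z * mono a).
  rewrite (exchange_big_dep (fun a : bmultinom N B => mdeg a == l.+1)) /=; last by move=> j a _ /andP[].
  apply: eq_bigr => a /eqP da.
  have -> : (l.+1)%:R = \sum_j (a j)%:R :> R[i] by rewrite -da mdegE natr_sum.
  rewrite mulr_suml big_mkcond; apply: eq_bigr => j _.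
  rewrite da eqxx /=; case: (posnP (a j)) => [->|_]; first by rewrite mul0r.
  by rewrite mulrC.
by rewrite -mulr_sumr mulKf// pnatr_eq0.
Qed.
End Multinomial.

Section Coordinates.
Variables (R : realType) (k : nat).
Let N := k.+1.

Lemma nbar_e0 n (x : 'rV[R]_n) : slmx (nbar x) *m e0 R n = col_mx 1%:M x^T.
Proof. by rewrite slmx_nbar e0_block (@mul_block_col R 1 n 1 n) !mulmx0 !addr0 !mulmx1. Qed.

Lemma nbar_emb0 (x : 'rV[R]_N) (y : 'cV[R]_N) : slmx (nbar x) *m emb0 y = emb0 y.
Proof.
by rewrite slmx_nbar (@mul_block_col R 1 N 1 N) !mulmx0 mul0mx !add0r mul1mx.
Qed.

Lemma incl0_block (a : 'cV[R]_1) (x : 'rV[R]_N) :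
  inclc (col_mx a x^T : 'cV[R]_(1 + N)) = col_mx a (incl0 x)^T :> 'cV[R]_(1 + N.+1).
Proof.
apply/(@matrixP _ (1 + N.+1)) => i j; rewrite [j]ord1.
case: (split_ordP i) => i' ->.
  rewrite col_mxEu [i']ord1.
  have -> : lshift N.+1 (0 : 'I_1) = lift ord_max (lshift N (0 : 'I_1)) :> 'I_(1 + N).+1.
    by apply: val_inj.
  by rewrite inclc_lift; exact: col_mxEu.
rewrite col_mxEd mxE mxE; case: (unliftP ord_max i') => [i'' ->|->] /=.
  have -> : rshift 1 (lift ord_max i'') = lift ord_max (rshift 1 i'') :> 'I_(1 + N).+1.
    have bE p (b : 'I_p) : bump p b = b by rewrite /bump leqNgt ltn_ord.
    by apply: val_inj => /=; rewrite bE; exact: esym (bE _ (rshift 1 i'')).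
  rewrite inclc_lift; transitivity (x^T i'' 0); first exact: col_mxEd.
  by rewrite mxE.
have -> : rshift 1 (ord_max : 'I_N.+1) = ord_max :> 'I_(1 + N).+1 by exact: val_inj.
by rewrite inclc_max.
Qed.

Lemma Cn_affine_chart K n (i : 'I_(1 + n)) :
  Cn K setT (fun x : 'rV[R]_n => (col_mx 1%:M x^T : 'cV[R]_(1 + n)) i 0).
Proof.
case: (split_ordP i) => i' ->.
  by apply: Cn_ext (Cn_cst K setT ((1%:M : 'M[R]_1) i' 0)); [exact: openT|move=> x _; rewrite col_mxEu].
by apply: Cn_ext (Cn_coord K setT 0 i'); [exact: openT|move=> x _; rewrite col_mxEd mxE].
Qed.

Lemma affine_chart_line n (h : R) (z x : 'rV[R]_n) :
  col_mx 1%:M (h *: z + x)^T = h *: col_mx 0 z^T + col_mx 1%:M x^T :> 'cV[R]_(1 + n).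
Proof. by rewrite linearP /= scale_col_mx scaler0 add_col_mx add0r. Qed.

(** In the chart x |-> (1,x) a coordinate direction z is the ambient vector (0,z), so all coordinate
    derivatives become derivatives of Psi. Moving the normal ones inside leaves the sum to which
    [multinomial_derive] applies. *)
Lemma DL_coord m l Psi : csm (@nz R _) Psi ->
  coord_DO m (liftSL Psi) (DL l (restm m Psi) : SL R k.+2 -> dhomog k.+1 R[i] l).
Proof.
move=> hPsi x'; apply: mpoly_real_inj => y.
pose P (x : 'rV[R]_N.+1) : 'cV[R]_(1 + N.+1) := col_mx 1%:M x^T.
pose u := fun x : 'rV[R]_N.+1 => Psi (P x).
have uE : (fun x => liftSL Psi (nbar x)) = u by apply/funext => x; rewrite /liftSL nbar_e0.
have P0 x : P x != 0.
  by rewrite col_mx_eq0 negb_and; apply/orP; left; apply/eqP => /matrixP/(_ 0 0)/eqP;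
     rewrite !mxE eqxx oner_eq0.
have hu : csm setT u.
  apply: csm_comp hPsi; [exact: openT|exact: open_nz|by move=> x _; exact: P0|].
  by move=> K i j; rewrite [j]ord1; exact: Cn_affine_chart.
rewrite uE /DO raddf_sum /=.
pose v (j : 'I_N) : 'rV[R]_N.+1 := delta_mx 0 (lift ord_max j).
have -> : \sum_(a : bmultinom N l.+1 | mdeg a == l)
    meval (fun j => (y j)%:C) (iter m (@dxn R k) (dmulti a u) (incl0 x') *: ytilde R a) =
  \sum_(a : bmultinom N l.+1 | mdeg a == l)
    dms v (enum 'I_N) a (iter m (cderive (delta_mx 0 ord_max)) u) (incl0 x') * mono y a.
  apply: eq_bigr => a _; rewrite /ytilde !mevalZ mevalX /mono; congr (_ * _).
  by rewrite -dms_iter.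
rewrite -multinomial_derive//; last exact: csm_iter.
have -> : (fun j => (y j)%:C) = rpt (\col_j y j) :> ('I_N -> R[i]).
  by apply/funext => j; rewrite /rpt mxE.
rewrite DL_eval; last exact: restm_csm.
congr (_ * _); rewrite nbar_e0 nbar_emb0.
have -> : iter m (cderive (delta_mx 0 ord_max)) u = (fun x => iter m (cderive (elast R N.+1)) Psi (P x)).
  apply/funext => x; apply: cderive_iter_affine => h z.
  have -> : elast R N.+1 = col_mx 0 (delta_mx 0 ord_max : 'rV[R]_N.+1)^T :> 'cV[R]_(1 + N.+1).
    rewrite elast_delta trmx_delta; apply/(@matrixP _ (1 + N.+1)) => i j; rewrite [j]ord1.
    case: (split_ordP i) => i' ->; first by rewrite col_mxEu !mxE [i']ord1.
    by rewrite col_mxEd !mxE.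
  exact: affine_chart_line.
have -> : iter l (cderive (\sum_j y j *: v j)) (fun x => iter m (cderive (elast R N.+1)) Psi (P x)) (incl0 x')
  = iter l (cderive (col_mx 0 (incl0 (\row_j y j))^T : 'cV[R]_(1 + N.+1))) (iter m (cderive (elast R N.+1)) Psi) (P (incl0 x')).
  have -> : \sum_j y j *: v j = incl0 (\row_j y j).
    apply/rowP => i; rewrite summxE mxE; case: (unliftP ord_max i) => [i' ->|->] /=.
      rewrite (bigD1 i')//= big1 ?addr0 ?mxE ?eqxx ?mulr1// => j /negbTE ji.
      by rewrite !mxE (inj_eq (@lift_inj _ _)) eq_sym ji mulr0.
    by rewrite big1// => j _; rewrite !mxE (negbTE (neq_lift _ _)) mulr0.
  by apply: cderive_iter_affine => h z; exact: affine_chart_line.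
rewrite /P -!incl0_block.
have -> : (\row_j y j)^T = \col_j y j by apply/matrixP => i j; rewrite !mxE.
apply: cderive_iter_affine => h z.
by rewrite inclc_lin.
Qed.
End Coordinates.

(** * Surjectivity of the normal derivative *)

Section Bump.
Variable R : realType.
Implicit Types (P Q : {poly R}) (t z : R).

(* The functions P(1/t) exp(-1/t), extended by 0 to t <= 0, are stable under
   differentiation; hence they are all smooth. *)
Definition flat P t : R := if 0 < t then P.[t^-1] * expR (- t^-1) else 0.

(** From 1 + u <= e^u at u = z/(i+1) follows z^i <= (i+1)^i e^z, which explains the constant. *)
Lemma horner_le_expR Q : exists2 C : R, 0 <= C & forall z, 0 < z -> `|Q.[z]| <= C * expR z.
Proof.
exists (\sum_(i < size Q) `|Q`_i| * i.+1%:R ^+ i).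
  by apply: sumr_ge0 => i _; rewrite mulr_ge0// exprn_ge0.
move=> z z0; rewrite horner_coef mulr_suml; apply: (le_trans (ler_norm_sum _ _ _)).
apply: ler_sum => i _; rewrite normrM -mulrA ler_wpM2l// normrX gtr0_norm//.
have i0 : 0 < i.+1%:R :> R by rewrite ltr0n.
have -> : z ^+ i = i.+1%:R ^+ i * (z / i.+1%:R) ^+ i.
  by rewrite exprMn exprVn mulrCA mulfV ?mulr1// expf_neq0// gt_eqF.
rewrite ler_wpM2l ?exprn_ge0 ?(ltW i0)//.
apply: (@le_trans _ _ (expR (z / i.+1%:R) ^+ i)).
  apply: lerXn2r; rewrite ?nnegrE ?expR_ge0 ?divr_ge0 ?(ltW z0) ?(ltW i0)//.
  by apply: le_trans (expR_ge1Dx _); rewrite lerDr.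
rewrite -expRM_natl ler_expR mulrC -mulrA ler_piMr ?(ltW z0)//.
by rewrite ler_pdivrMl// mulr1 ler_nat.
Qed.

(** The exponential bound is applied to X^2 P at 1/t; the extra X^2 yields the factor t^2. *)
Lemma flat_bound P : exists2 C : R, 0 <= C & forall t, `|flat P t| <= C * t ^+ 2.
Proof.
have [C C0 hC] := horner_le_expR ('X^2 * P); exists C => // t.
rewrite /flat; case: ltP => t0; last by rewrite normr0 mulr_ge0// sqr_ge0.
have v0 : 0 < t^-1 by rewrite invr_gt0.
have v2 : 0 <= t^-1 ^+ 2 by rewrite exprn_ge0 ?(ltW v0).
have := hC _ v0; rewrite hornerM hornerXn normrM (ger0_norm v2) => h.
rewrite normrM [X in _ * X]ger0_norm ?expR_ge0//.
rewrite expRN ler_pdivrMr ?expR_gt0// mulrAC -ler_pdivrMr ?exprn_gt0//.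
by rewrite mulrC -exprVn.
Qed.

(** With u = 1/t one has d/dt = -u^2 d/du, so P(u) e^-u has derivative u^2 (P - P')(u) e^-u. *)
Definition dflat P : {poly R} := 'X^2 * (P - P^`()).

Lemma is_derive_flat P t : is_derive t 1 (flat P) (flat (dflat P) t).
Proof.
have [t0|t0|t0] := ltgtP t 0.
- have h : \forall s \near t, cst 0 s = flat P s.
    have n0 : \forall s \near t, s < 0 by exact: lt_nbhsl.
    by apply: filterS n0 => s s0; rewrite /flat ltNge (ltW s0).
  apply: near_eq_is_derive h _.
  have -> : flat (dflat P) t = 0 by rewrite /flat ltNge (ltW t0).
  exact: is_derive_cst.
- have h : \forall s \near t, P.[s^-1] * expR (- s^-1) = flat P s.
    have n0 : \forall s \near t, 0 < s by exact: lt_nbhsr.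
    by apply: filterS n0 => s s0; rewrite /flat s0.
  apply: near_eq_is_derive h _.
  have tn : t != 0 by rewrite gt_eqF.
  have h1 : is_derive t 1 (fun s : R => s^-1) (- t ^- 2).
    have := @is_deriveV R id t 1 1 tn (is_derive_id t 1).
    by rewrite [_ *: 1]mulr1.
  have h2 : is_derive t 1 (fun s : R => P.[s^-1]) (- t ^- 2 * P^`().[t^-1]).
    have hp : is_derive t^-1 1 (horner P) P^`().[t^-1] by exact: is_derive_poly.
    have := is_derive1_comp hp h1.
    by rewrite mulrC.
  have h3 : is_derive t 1 (fun s : R => expR (- s^-1)) (t ^- 2 * expR (- t^-1)).
    have h1' : is_derive t 1 (fun s : R => - s^-1) (t ^- 2).
      by have := is_deriveN h1; rewrite opprK.
    have := @is_derive1_comp _ expR (fun s : R => - s^-1) t _ _ (is_derive_expR _) h1'.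
    by rewrite mulrC.
  have := is_deriveM h2 h3.
  suff -> : flat (dflat P) t = P.[t^-1] *: (t ^- 2 * expR (- t^-1)) +
     expR (- t^-1) *: (- t ^- 2 * P^`().[t^-1]) by [].
  rewrite /flat t0 /dflat hornerM hornerXn !hornerE exprVn /GRing.scale /=.
  ring.
- have -> : flat (dflat P) t = 0 by rewrite /flat t0 ltxx.
  (* At 0 the quadratic bound makes the difference quotient O(h). *)
  have [C C0 hC] := flat_bound P.
  subst t.
  have f0 : flat P 0 = 0 by rewrite /flat ltxx.
  have lim : (fun h : R => h^-1 *: ((flat P \o shift 0) (h *: 1) - flat P 0)) @ 0^' --> (0 : R).
    have C1 : 0 < C + 1 by rewrite ltr_wpDl.
    apply/cvgrPdist_le => e e_gt0; near=> h.
    rewrite sub0r normrN f0 subr0 /= addr0 [h%:A]mulr1.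
    have hn : h != 0 by near: h; exact: nbhs_dnbhs_neq.
    rewrite normrZ normfV ler_pdivrMl ?normr_gt0//; apply: (le_trans (hC h)).
    rewrite -real_normK ?num_real// expr2 mulrCA ler_wpM2l//.
    have hb : `|h| < e / (C + 1) by near: h; apply: dnbhs0_lt; rewrite divr_gt0.
    apply: (@le_trans _ _ ((C + 1) * `|h|)); first by rewrite ler_wpM2r// lerDl.
    by rewrite mulrC -ler_pdivlMr// ltW.
  split; first by apply/cvg_ex; exists 0.
  exact: cvg_lim.
Unshelve. all: by end_near. Qed.

Section Compose.
Variables (E : normedModType R) (U : set E).
Hypothesis oU : open U.

Lemma is_derive_comp1 (f : R -> R) (r : E -> R) x v d d' :
  is_derive (r x) 1 f d -> is_derive x v r d' -> is_derive x v (f \o r) (d * d').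
Proof.
move=> hf /is_derive_line0 hr; apply/is_derive_line0.
have hf' : is_derive (r (x + (0 : R) *: v)) 1 f d by rewrite scale0r addr0.
exact: (is_derive1_comp hf' hr).
Qed.

Lemma Cn_flat k P (r : E -> R) : Cn k U r -> Cn k U (flat P \o r).
Proof.
have cf Q s : {for s, continuous (flat Q)}.
  apply: differentiable_continuous; apply/derivable1_diffP.
  by case: (is_derive_flat Q s).
elim: k P => [|k IH] P hr.
  by split=> // x Ux; apply: continuous_comp; [exact: Cn_cont hr Ux|exact: cf].
have dr x v : U x -> is_derive x v (flat P \o r) (flat (dflat P) (r x) * 'D_v r x).
  move=> Ux; apply: is_derive_comp1; first exact: is_derive_flat.
  by apply: DeriveDef => //; exact: (hr.2 v).1.
split=> [x Ux|v].
  by apply: continuous_comp; [exact: Cn_cont hr Ux|exact: cf].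
split=> [x Ux|]; first by case: (dr x v Ux).
apply: (@Cn_ext _ _ k U (fun x => (flat (dflat P) \o r) x * 'D_v r x)) => //.
  by move=> x Ux; case: (dr x v Ux) => _ ->.
by apply: CnM => //; [apply: IH; exact: Cn_le|exact: (hr.2 v).2].
Qed.

(** One derivative turns rho^(m+1) G into rho^m ((m+1) G + rho D_e G), which has the same shape with
    one power less. *)
Lemma leibniz_zero m (rho G : E -> R[i]) e x : csm U rho -> csm U G -> U x ->
  (forall y, U y -> cderive e rho y = 1) -> rho x = 0 ->
  iter m (cderive e) (fun y => rho y ^+ m * G y) x = m`!%:R * G x.
Proof.
move=> hr hG Ux dr rx.
have hX j : csm U (fun y => rho y ^+ j).
  elim: j => [|j IH]; first exact: csm_cst.
  by apply: csm_ext (csmM oU hr IH) => // y _; rewrite exprS.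
have dX j y : U y -> cderive e (fun y => rho y ^+ j.+1) y = j.+1%:R * rho y ^+ j.
  elim: j y => [|j IH] y Uy.
    rewrite mul1r expr0 -(dr y Uy); apply: (cderive_ext e oU Uy) => z _; exact: expr1.
  rewrite (@cderive_ext _ _ U _ (fun y => rho y * rho y ^+ j.+1))//.
    by rewrite (cderiveM e hr (hX j.+1) Uy) dr// IH// mul1r -[j.+2%:R]nat1r !exprS; ring.
elim: m G hG => [|m IH] G hG; first by rewrite /= expr0 fact0.
have hG' : csm U (fun y => m.+1%:R * G y + rho y * cderive e G y).
  apply: csmD => //; first exact: csmZ.
  by apply: csmM => //; exact: csm_cderive.
rewrite iterSr (@iter_cderive_ext _ _ U oU _ _ _
    (fun y => rho y ^+ m * (m.+1%:R * G y + rho y * cderive e G y)))//.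
  by rewrite IH// rx mul0r addr0 factS natrM; ring.
move=> y Uy; rewrite (cderiveM e (hX m.+1) hG Uy) dX// exprSr; ring.
Qed.
End Compose.
End Bump.

Lemma is_derive_coord (R : realType) p q (x v : 'M[R]_(p, q)) i j :
  is_derive x v (fun M => M i j) (v i j).
Proof.
apply/is_derive_line0.
have -> : (fun h : R => (x + h *: v) i j) = (fun h => x i j + v i j *: h).
  by apply/funext => h; rewrite !mxE mulrC.
have h1 : is_derive (0 : R) 1 (cst (x i j)) 0 by exact: is_derive_cst.
have h2 : is_derive (0 : R) 1 (v i j *: id : R -> R) (v i j *: 1) by exact: is_deriveZ.
by have := is_deriveD h1 h2; rewrite add0r [_ *: 1]mulr1.
Qed.

Section Extension.
Variables (R : realType) (n : nat).
Implicit Types (x : 'cV[R]_n.+1) (y : 'cV[R]_n).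

Definition projc x : 'cV[R]_n := \col_i x (lift ord_max i) 0.
Definition sqn y : R := \sum_i y i 0 ^+ 2.
(** The cosine of twice the angle between x and the hyperplane x_n = 0: it is 1 on the hyperplane
    and -1 on the normal axis. *)
Definition ratio x : R := (sqn (projc x) - x ord_max 0 ^+ 2) / (sqn (projc x) + x ord_max 0 ^+ 2).

Lemma projc_incl y : projc (inclc y) = y.
Proof. by apply/matrixP => i j; rewrite [j]ord1 mxE inclc_lift. Qed.

Lemma sqn_ge0 y : 0 <= sqn y.
Proof. by apply: sumr_ge0 => i _; exact: sqr_ge0. Qed.

Lemma sqn_eq0 y : (sqn y == 0) = (y == 0).
Proof.
apply/eqP/eqP => [h|->]; last by rewrite /sqn big1// => i _; rewrite mxE expr0n.
apply/matrixP => i j; rewrite [j]ord1 mxE.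
have := @psumr_eq0P _ _ predT (fun i => y i 0 ^+ 2) (fun i _ => sqr_ge0 _) h i isT.
by move=> /eqP; rewrite sqrf_eq0 => /eqP.
Qed.

Lemma ratio_den x : x != 0 -> 0 < sqn (projc x) + x ord_max 0 ^+ 2.
Proof.
move=> x0; rewrite lt_neqAle addr_ge0 ?sqn_ge0 ?sqr_ge0// andbT eq_sym.
apply: contra x0; rewrite paddr_eq0 ?sqn_ge0 ?sqr_ge0// sqn_eq0 sqrf_eq0 => /andP[/eqP p /eqP q].
apply/eqP/matrixP => i j; rewrite [j]ord1 mxE; case: (unliftP ord_max i) => [i' ->|->//].
by have := congr1 (fun M : 'cV[R]_n => M i' 0) p; rewrite !mxE.
Qed.

Lemma ratioZ (c : R) x : c != 0 -> x != 0 -> ratio (c *: x) = ratio x.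
Proof.
move=> c0 x0; have d := ratio_den x0.
have -> : ratio (c *: x) = (c ^+ 2 * (sqn (projc x) - x ord_max 0 ^+ 2)) /
    (c ^+ 2 * (sqn (projc x) + x ord_max 0 ^+ 2)).
  have e : sqn (projc (c *: x)) = c ^+ 2 * sqn (projc x).
    by rewrite /sqn mulr_sumr; apply: eq_bigr => i _; rewrite !mxE exprMn.
  by rewrite /ratio e mxE exprMn -mulrBr -mulrDr.
by rewrite -mulf_div divff ?mul1r// expf_neq0.
Qed.

Lemma ratio_lt0 x : x != 0 -> projc x = 0 -> ratio x < 0.
Proof.
move=> x0 px; have := ratio_den x0; rewrite /ratio px (_ : sqn 0 = 0); last first.
  by apply/eqP; rewrite sqn_eq0.
by rewrite add0r sub0r => h; rewrite mulNr divff ?gt_eqF// oppr_lt0 ltr01.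
Qed.

Lemma Cn_ratio K : Cn K (@nz R n.+1) ratio.
Proof.
have o := @open_nz R n.+1.
have Cl : Cn K (@nz R n.+1) (fun x => x ord_max 0 ^+ 2) by apply: CnX => //; exact: Cn_coord.
have Cs : Cn K (@nz R n.+1) (fun x => sqn (projc x)).
  apply: (@Cn_ext _ _ K _ (fun x => \sum_(i < n) x (lift ord_max i) 0 ^+ 2)) => //.
    by move=> x _; apply: eq_bigr => i _; rewrite mxE.
  by apply: Cn_sum => // i _; apply: CnX => //; exact: Cn_coord.
apply: CnM => //; first exact: CnB.
apply: CnV => //; last exact: CnD.
by move=> x /ratio_den; rewrite lt0r => /andP[].
Qed.

Definition nzp : set 'cV[R]_n.+1 := [set x | projc x != 0].

Lemma Cn_projc K (U : set 'cV[R]_n.+1) i j : open U -> Cn K U (fun x => projc x i j).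
Proof.
move=> oU; apply: Cn_ext (Cn_coord K U (lift ord_max i) 0) => // x _.
by rewrite mxE.
Qed.

Lemma open_nzp : open nzp.
Proof.
have := @open_preim R 'cV[R]_n.+1 n 1 setT (@nz R n) projc openT (@open_nz R n)
  (fun i j => Cn_projc 0 i j openT).
by congr open; apply/seteqP; split=> y /= => [[]|].
Qed.

Lemma nzp_nz x : nzp x -> x != 0.
Proof.
apply: contraPneq => ->; apply/negP/negPn/eqP.
by apply/matrixP => i j; rewrite !mxE.
Qed.

(* Homogeneous of degree 0, equal to 1 on {x_n = 0} and to 0 on the cone
   |x'| <= |x_n|, hence near the singular line x' = 0 of [psi (projc x)]. *)
Definition bump x : R := expR 1 * flat 1 (ratio x).

Lemma Cn_bump K : Cn K (@nz R n.+1) bump.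
Proof. by apply: CnZ; [exact: open_nz|apply: Cn_flat; [exact: open_nz|exact: Cn_ratio]]. Qed.

(** On the hyperplane the ratio is 1, where [flat 1] takes the value e^-1; the factor [expR 1]
    normalises it. *)
Lemma bump_incl y : y != 0 -> bump (inclc y) = 1.
Proof.
move=> y0; rewrite /bump /ratio projc_incl inclc_max expr0n subr0 addr0 divff ?sqn_eq0//.
by rewrite /flat ltr01 hornerC mul1r invr1 -expRD subrr expR0.
Qed.

Lemma bump_eq0 x : ratio x < 0 -> bump x = 0.
Proof. by move=> h; rewrite /bump /flat ltNge (ltW h) mulr0. Qed.

Definition extm (m : nat) (psi : 'cV[R]_n -> R[i]) x : R[i] :=
  (x ord_max 0)%:C ^+ m * ((m`!%:R)^-1 * ((bump x)%:C * psi (projc x))).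

Lemma csm_last U : open U -> csm U (fun x => (x ord_max 0)%:C : R[i]).
Proof. by move=> oU; apply: csm_real => K; exact: Cn_coord. Qed.

Lemma csm_ext_factor (m : nat) psi : csm (@nz R n) psi ->
  csm nzp (fun x => (m`!%:R)^-1 * ((bump x)%:C * psi (projc x))).
Proof.
move=> h; apply: csmZ; first exact: open_nzp.
apply: csmM; first exact: open_nzp.
  apply: csm_real => K; apply: Cn_sub (Cn_bump K) => x; exact: nzp_nz.
apply: csm_comp h; [exact: open_nzp|exact: open_nz|by []|].
by move=> K i j; apply: Cn_projc; exact: open_nzp.
Qed.

Lemma csm_pow (E : normedModType R) (U : set E) (f : E -> R[i]) j : open U -> csm U f ->
  csm U (fun z => f z ^+ j).
Proof.
move=> oU hf; elim: j => [|j IH]; first exact: csm_cst.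
by apply: csm_ext (csmM oU hf IH) => // z _; rewrite exprS.
Qed.

(** Around a point with x' = 0 the ratio is negative and the function vanishes identically;
    elsewhere it is a product of smooth functions. *)
Lemma extm_csm m psi : csm (@nz R n) psi -> csm (@nz R n.+1) (extm m psi).
Proof.
move=> h; apply: csm_local => x x0.
have [px|px] := eqVneq (projc x) 0.
  have oW : open [set z | z != 0 /\ ratio z < 0].
    rewrite openE => z /= [z0 rz].
    have cr : {for z, continuous ratio} := Cn_cont (Cn_ratio 0) z0.
    apply: filterI; first exact: open_nbhs_nbhs (conj (@open_nz R n.+1) z0).
    exact: cr (lt_nbhsl rz).
  exists [set z | z != 0 /\ ratio z < 0]; split => //.
    by split=> //; exact: ratio_lt0.
  apply: (@csm_ext _ _ _ (cst 0)); [exact: oW| |exact: csm_cst].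
  by move=> z [_ /bump_eq0 bz]; rewrite /extm bz mul0r !mulr0.
exists nzp; split => //; first exact: open_nzp.
apply: csmM; [exact: open_nzp| |exact: csm_ext_factor].
by apply: csm_pow; [exact: open_nzp|apply: csm_last; exact: open_nzp].
Qed.

Lemma extm_Hom (m d : nat) al psi : al = 1 \/ al = -1 -> Hom d (sgn_add al m) psi ->
  Hom (m + d) al (extm m psi).
Proof.
move=> ha [h1 h2]; split; first exact: extm_csm.
move=> c x c0 x0; rewrite /extm.
have pZ : projc (c *: x) = c *: projc x by apply/matrixP => i j; rewrite !mxE.
have bZ : bump (c *: x) = bump x by rewrite /bump ratioZ.
have [px|px] := eqVneq (projc x) 0.
  have b0 : bump x = 0 by apply: bump_eq0; exact: ratio_lt0.
  by rewrite bZ b0 !(mul0r, mulr0).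
rewrite bZ pZ h2// -chi_div// mxE.
have cm : c ^+ m != 0 by rewrite expf_neq0.
have e1 : (c * x ord_max 0)%:C ^+ m = (c ^+ m)%:C * (x ord_max 0)%:C ^+ m :> R[i].
  by rewrite rmorphM exprMn rmorphXn.
have e2 : (chi (m + d) al c)%:C = (c ^+ m)%:C * (chi (m + d) al c / c ^+ m)%:C :> R[i].
  by rewrite -rmorphM mulrC divfK.
by rewrite e1 e2; ring.
Qed.

Lemma restm_extm m psi y : csm (@nz R n) psi -> y != 0 -> restm m (extm m psi) y = psi y.
Proof.
move=> h y0; rewrite /restm /extm elast_delta.
have ny : nzp (inclc y) by rewrite /nzp /= projc_incl.
rewrite (leibniz_zero open_nzp m (csm_last open_nzp) (csm_ext_factor m h) ny); last first.
- by rewrite inclc_max.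
- move=> z _; apply: complexP; rewrite /= ?derive_cst//.
  by have [_ ->] := is_derive_coord z (delta_mx ord_max 0) ord_max 0; rewrite mxE !eqxx.
rewrite bump_incl// mul1r projc_incl mulVKf// pnatr_eq0 -lt0n fact_gt0//.
Qed.
End Extension.

(** * The kernel *)

Section Taylor.
Variable R : realType.

Lemma const_line (f : R^o -> R[i]) : csm setT f -> (forall s, cderive (1 : R^o) f s = 0) ->
  forall s, f s = f 0.
Proof.
move=> hf h s; have key (r : R -> R) : (forall t, derivable r t 1) -> (forall t, 'D_1 r t = 0) ->
    r s = r 0.
  move=> dr r0; have [|t _] := @mvt_line R R r 0 1 s; first by move=> t _; exact: dr.
  by rewrite r0 mulr0 add0r [s%:A]mulr1 => /eqP; rewrite subr_eq0 => /eqP.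
have d t := csm_derivable (1 : R^o) hf (I : setT t).
apply: complexP.
- apply: (key (fun s => complex.Re (f s))) => t; first exact: (d t).1.
  exact: (congr1 (@complex.Re R) (h t)).
- apply: (key (fun s => complex.Im (f s))) => t; first exact: (d t).2.
  exact: (congr1 (@complex.Im R) (h t)).
Qed.

Lemma cderive_mono (j : nat) (a : R[i]) (s : R^o) :
  cderive (1 : R^o) (fun s : R^o => (s%:C) ^+ j.+1 * a) s = j.+1%:R * s%:C ^+ j * a.
Proof.
have h1 : csm setT (fun s : R^o => s%:C : R[i]).
  apply: csm_real => K; exact: (@Cn_lin R R^o K setT idfun (fun x => cvg_id)).
have d1 t : cderive (1 : R^o) (fun s : R^o => s%:C : R[i]) t = 1.
  by apply: complexP; rewrite /= ?derive_cst ?derive_id.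
have hX i : csm setT (fun s : R^o => (s%:C) ^+ i : R[i]) by apply: csm_pow => //; exact: openT.
rewrite (cderiveM _ (hX j.+1) (csm_cst setT a) (I : setT s)) cderive_cst mulr0 addr0.
congr (_ * _); elim: j s => [|j IH] s.
  by rewrite expr0 mulr1 -(d1 s); apply: (cderive_ext _ openT) => // t _; exact: expr1.
rewrite (@cderive_ext _ _ setT _ (fun s : R^o => s%:C * (s%:C) ^+ j.+1)) //.
- by rewrite (cderiveM _ h1 (hX j.+1) (I : setT s)) d1 IH mul1r -[j.+2%:R]nat1r !exprS; ring.
- exact: openT.
Qed.

(** By induction applied to f', the function f and its Taylor polynomial have the same derivative;
    they agree at 0. *)
Lemma taylor_line M (f : R^o -> R[i]) : csm setT f ->
  (forall s, iter M (cderive (1 : R^o)) f s = 0) ->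
  forall s : R, f s = \sum_(j < M) s%:C ^+ j * ((j`!%:R)^-1 * iter j (cderive (1 : R^o)) f 0).
Proof.
elim: M f => [|M IH] f hf h s; first by rewrite big_ord0; exact: h.
pose P (s : R^o) : R[i] := \sum_(j < M.+1) s%:C ^+ j * ((j`!%:R)^-1 * iter j (cderive (1 : R^o)) f 0).
have h1 : csm setT (fun s : R^o => s%:C : R[i]).
  apply: csm_real => K; exact: (@Cn_lin R R^o K setT idfun (fun x => cvg_id)).
have hX i : csm setT (fun s : R^o => (s%:C) ^+ i : R[i]) by apply: csm_pow => //; exact: openT.
have hT j (a : R[i]) : csm setT (fun s : R^o => (s%:C) ^+ j * a).
  by apply: csmM; [exact: openT|exact: hX|exact: csm_cst].
have hP : csm setT P by apply: csm_sum => [|j _]; [exact: openT|exact: hT].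
have dP t : cderive (1 : R^o) P t = cderive (1 : R^o) f t.
  rewrite (cderive_sum _ _ openT (fun j : 'I_M.+1 => hT j _))// big_ord_recl /=.
  rewrite (@cderive_ext _ _ setT _ (cst ((0`!%:R)^-1 * f 0)))//; last 2 first.
  - exact: openT.
  - by move=> z _; rewrite expr0 mul1r.
  rewrite cderive_cst add0r (IH (cderive (1 : R^o) f)) //.
  - apply: eq_bigr => j _; rewrite cderive_mono -iterSr /bump /= ?add1n factS natrM invfM.
    have j0 : j.+1%:R != 0 :> R[i] by rewrite pnatr_eq0.
    have f0 : j`!%:R != 0 :> R[i] by rewrite pnatr_eq0 -lt0n fact_gt0.
    move: (j.+1%:R) (j`!%:R) j0 f0 => p q p0 q0.
    by field; rewrite p0 q0.
  - exact: csm_cderive.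
  - by move=> z; rewrite -iterSr.
have hD : csm setT (fun z => f z + (-1) * P z) by apply: csmD; [exact: openT| |apply: csmZ; [exact: openT|]].
have := @const_line (fun z => f z + (-1) * P z) hD.
have dD z : cderive (1 : R^o) (fun z => f z + (-1) * P z) z = 0.
  rewrite (cderiveD _ hf (csmZ (-1) openT hP) (I : setT z)) (cderiveZ _ _ hP (I : setT z)).
  by rewrite dP mulN1r subrr.
move=> /(_ dD s) e.
have P0 : P 0 = f 0.
  have c0 : (0 : R)%:C = 0 :> R[i] by [].
  rewrite /P big_ord_recl c0 big1 => [|j _].
    by rewrite addr0 expr0 mul1r fact0 invr1 mul1r.
  by rewrite lift0 expr0n mul0r.
have {e}: f s + (-1) * P s = 0 by rewrite [LHS]e P0 mulN1r subrr.
by rewrite mulN1r => /eqP; rewrite subr_eq0 => /eqP.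
Qed.

(** With e = 1 or e = -1 this turns an identity valid on one half-line into an identity of
    polynomials. *)
Lemma poly_nat_eq0 (p : {poly R[i]}) (e : R[i]) : e != 0 ->
  (forall j : nat, p.[e * j.+1%:R] = 0) -> p = 0.
Proof.
move=> e0 h; apply/eqP/negPn/negP => p0.
pose s := [seq e * j.+1%:R : R[i] | j <- iota 0 (size p)].
have rs : all (root p) s by apply/allP => _ /mapP[j _ ->]; apply/rootP.
have us : uniq s.
  rewrite map_inj_uniq ?iota_uniq// => a b /(mulfI e0)/eqP.
  by rewrite eqr_nat eqSS => /eqP.
by have := max_poly_roots p0 rs us; rewrite size_map size_iota ltnn.
Qed.
End Taylor.

Section Lines.
Variables (R : realType) (n d : nat) (b : int) (psi : 'cV[R]_n -> R[i]).
Hypothesis hom : Hom d b psi.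
Variables (M : nat).
Variables (x v : 'cV[R]_n).
Hypotheses (x0 : x != 0) (vx : forall c, v <> c *: x).

Lemma line_neq0 (s : R) : x + s *: v != 0.
Proof.
apply/eqP => /eqP; rewrite addr_eq0 => /eqP e; have [s0|s0] := eqVneq s 0.
  by move: x0; rewrite e s0 scale0r oppr0 eqxx.
by apply: (vx (c := - s^-1)); rewrite e scaleNr scalerN opprK scalerA mulVf// scale1r.
Qed.

Lemma line_neq0' (s : R) : v + s *: x != 0.
Proof.
apply/eqP => /eqP; rewrite addr_eq0 => /eqP e.
by apply: (vx (c := - s)); rewrite scaleNr.
Qed.

Lemma line_taylor (p q : 'cV[R]_n) (s : R) : (forall s : R, p + s *: q != 0) ->
  (forall s : R, iter M (cderive q) psi (p + s *: q) = 0) ->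
  psi (p + s *: q) =
  \sum_(j < M) s%:C ^+ j * ((j`!%:R)^-1 * iter j (cderive q) psi p).
Proof.
move=> pq hM; have [hpsi _] := hom.
pose f (s : R^o) := psi (p + s *: q).
have itf k (t : R^o) : iter k (cderive (1 : R^o)) f t = iter k (cderive q) psi (p + t *: q).
  apply: cderive_iter_affine => h z.
  by rewrite [h *: (1 : R^o)]mulr1 scalerDl addrCA.
have hf : csm setT f.
  apply: csm_comp hpsi; [exact: openT|exact: open_nz|by move=> t _; exact: pq|].
  move=> K i j; apply: (@Cn_ext _ _ K setT (fun t : R^o => p i j + q i j * t)); first exact: openT.
    by move=> t _; rewrite !mxE mulrC.
  apply: CnD; [exact: openT|exact: Cn_cst|apply: CnZ; first exact: openT].
  exact: (@Cn_lin R R^o K setT idfun (fun x => cvg_id)).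
rewrite -[LHS]/(f s) (taylor_line hf (M := M)).
  by apply: eq_bigr => j _; rewrite itf scale0r addr0.
by move=> t; rewrite itf hM.
Qed.

Hypothesis hM : forall x v, x != 0 -> (forall c, v <> c *: x) -> iter M (cderive v) psi x = 0.

(** Independence of point and direction persists along the line, so [hM] can be used at each of its
    points. *)
Lemma line_indep (s c : R) : v <> c *: (x + s *: v).
Proof.
rewrite scalerDr scalerA => e; have [cs|cs] := eqVneq (c * s) 1.
  move: e; rewrite cs scale1r -[LHS]add0r => /addIr/esym/eqP; rewrite scaler_eq0 (negbTE x0) orbF.
  by move=> /eqP c0; move: cs; rewrite c0 mul0r => /esym/eqP; rewrite oner_eq0.
have cs' : 1 - c * s != 0 by rewrite subr_eq0 eq_sym.
apply: (vx (c := (1 - c * s)^-1 * c)); rewrite -scalerA.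
have <- : (1 - c * s) *: v = c *: x by rewrite scalerBl scale1r {1}e addrK.
by rewrite scalerA mulVf// scale1r.
Qed.

Lemma line_indep' (s c : R) : x <> c *: (v + s *: x).
Proof.
move=> e; have [c0|c0] := eqVneq c 0; first by move: x0; rewrite e c0 scale0r eqxx.
apply: (vx (c := c^-1 - s)); rewrite scalerBl {1}e scalerA mulVf// scale1r.
by rewrite addrK.
Qed.

Definition lcoef (p q : 'cV[R]_n) j := (j`!%:R)^-1 * iter j (cderive q) psi p.

(* x + s v = s (v + x/s) *)
Lemma line_inversion (s : R) : s != 0 ->
  \sum_(j < M) s%:C ^+ j * lcoef x v j =
  (chi d b s)%:C * \sum_(j < M) s%:C ^- j * lcoef v x j.
Proof.
move=> s0; rewrite -(line_taylor s line_neq0 (fun s => hM (line_neq0 s) (@line_indep s))).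
have -> : x + s *: v = s *: (v + s^-1 *: x).
  by rewrite scalerDr scalerA mulfV// scale1r addrC.
rewrite hom.2//; last exact: line_neq0'.
rewrite (line_taylor _ line_neq0' (fun s => hM (line_neq0' s) (@line_indep' s))); congr (_ * _); apply: eq_bigr => j _; congr (_ * _).
by rewrite fmorphV /= exprVn.
Qed.

End Lines.

Section Kernel.
Variables (R : realType).

Lemma chi_pos d b (s : R) : 0 < s -> chi d b s = s ^+ d.
Proof. by move=> s0; rewrite /chi /spow gtr0_norm// gtr0_sg// if_same mulr1. Qed.

Lemma chi_neg d b (s : R) : b = 1 \/ b = -1 -> s < 0 ->
  chi d b s = (if b == (-1) ^+ d then 1 else -1) * s ^+ d.
Proof.
move=> hb s0; rewrite /chi /spow ltr0_norm// ltr0_sg// (exprNn s) mulrC -[(-1 : R) ^+ d]signr_odd -[(-1 : int) ^+ d]signr_odd mulrA.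
by congr (_ * _); case: hb => ->; case: (odd d); rewrite ?expr0 ?expr1 /= ?mulrN1 ?mulr1 ?opprK.
Qed.

Lemma horner_mono (m : nat) (a : 'I_m -> R[i]) (e : 'I_m -> nat) (z : R[i]) :
  (\sum_j a j *: 'X^(e j)).[z] = \sum_j z ^+ e j * a j.
Proof.
rewrite horner_sum; apply: eq_bigr => j _.
by rewrite hornerZ hornerXn mulrC.
Qed.

Lemma real_nat (e : R) j : (e * j.+1%:R)%:C = e%:C * j.+1%:R :> R[i].
Proof. by rewrite rmorphM /= rmorph_nat. Qed.

Lemma chi_divC d b (s : R) : (chi d b s / s ^+ d)%:C = (chi d b s)%:C * (s%:C ^+ d)^-1 :> R[i].
Proof. by rewrite rmorphM fmorphV rmorphXn. Qed.

Section OnLine.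
Variables (n d : nat) (b : int) (psi : 'cV[R]_n -> R[i]).
Hypotheses (hb : b = 1 \/ b = -1) (hom : Hom d b psi).
Variables (x v : 'cV[R]_n).
Hypotheses (x0 : x != 0) (vx : forall c, v <> c *: x).

(** With fewer than d + 1 powers on each side, s^d times the expansion in 1/s is a polynomial Q.
    Positive s gives P = Q, and under the wrong parity negative s gives P = -Q. Hence P = 0, and psi
    x is its constant coefficient. *)
Lemma line_mismatch : b <> (-1) ^+ d ->
  (forall x v, x != 0 -> (forall c, v <> c *: x) -> iter d.+1 (cderive v) psi x = 0) -> psi x = 0.
Proof.
move=> mis hM.
pose P : {poly R[i]} := \sum_(j < d.+1) lcoef psi x v j *: 'X^j.
pose Q : {poly R[i]} := \sum_(j < d.+1) lcoef psi v x j *: 'X^(d - j).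
have PQ (s : R) : s != 0 -> P.[s%:C] = (chi d b s / s ^+ d)%:C * Q.[s%:C].
  move=> s0; rewrite /P /Q !horner_mono (line_inversion hom x0 vx hM s0).
  rewrite chi_divC -mulrA; congr (_ * _); rewrite mulr_sumr; apply: eq_bigr => j _.
  rewrite mulrA; congr (_ * _).
  have sC : s%:C != 0 :> R[i] by rewrite fmorph_eq0.
  rewrite -{2}(subnK (ltnSE (ltn_ord j))) exprD invfM.
  by rewrite mulrAC mulVf ?mul1r// expf_neq0.
have P1 : P - Q = 0.
  apply: (@poly_nat_eq0 R _ 1); first exact: oner_neq0.
  move=> j; have s0 : 0 < 1 * j.+1%:R :> R by rewrite mul1r ltr0n.
  have := PQ _ (lt0r_neq0 s0); rewrite chi_pos// divff ?expf_neq0 ?lt0r_neq0//.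
  by rewrite real_nat rmorph1 !mul1r hornerD hornerN => ->; rewrite subrr.
have P2 : P + Q = 0.
  apply: (@poly_nat_eq0 R _ (-1)); first by rewrite oppr_eq0 oner_neq0.
  move=> j; have s0 : -1 * j.+1%:R < 0 :> R by rewrite mulN1r oppr_lt0 ltr0n.
  have := PQ _ (ltr0_neq0 s0); rewrite chi_neg// (introF eqP mis) mulfK ?expf_neq0 ?ltr0_neq0//.
  by rewrite real_nat rmorphN rmorph1 hornerD !mulN1r => ->; rewrite addNr.
have PP : P = 0.
  have : P + P = 0 by rewrite -[RHS](addr0 0) -{1}P1 -P2; rewrite addrACA addNr addr0.
  by rewrite -mulr2n => /eqP; rewrite -scaler_nat scaler_eq0 pnatr_eq0 /= => /eqP.
have : P`_0 = 0 by rewrite PP coef0.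
rewrite /P coef_sum big_ord_recl big1 => [|j _]; last by rewrite coefZ coefXn mulr0.
by rewrite coefZ coefXn eqxx mulr1 addr0 /lcoef fact0 invr1 mul1r.
Qed.

(** An a priori order M of vanishing improves to d + 1: the expansion in 1/s, multiplied by s^d,
    contains no power of s above d. *)
Lemma line_degree M : (d.+1 < M)%N ->
  (forall x v, x != 0 -> (forall c, v <> c *: x) -> iter M (cderive v) psi x = 0) -> iter d.+1 (cderive v) psi x = 0.
Proof.
move=> dM hM.
(* Both sides are multiplied by s^M, because s^(d-j) may have a negative exponent when j > d. *)
pose P : {poly R[i]} := \sum_(j < M) lcoef psi x v j *: 'X^(j + M).
pose Q : {poly R[i]} := \sum_(j < M) lcoef psi v x j *: 'X^(d + M - j).
have PQ (s : R) : s != 0 -> P.[s%:C] = (chi d b s / s ^+ d)%:C * Q.[s%:C].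
  move=> s0; rewrite /P /Q !horner_mono.
  have sC : s%:C != 0 :> R[i] by rewrite fmorph_eq0.
  under eq_bigr do rewrite exprD mulrAC mulrC.
  rewrite -mulr_sumr (line_inversion hom x0 vx hM s0) mulrCA chi_divC -mulrA; congr (_ * _).
  rewrite !mulr_sumr; apply: eq_bigr => j _; rewrite !mulrA; congr (_ * _).
  have jM : (j <= M)%N by exact: ltnW.
  rewrite -addnBA// exprD mulKf ?expf_neq0//.
  by rewrite -{1}(subnK jM) exprD mulfK ?expf_neq0.
have P1 : P - Q = 0.
  apply: (@poly_nat_eq0 R _ 1); first exact: oner_neq0.
  move=> j; have s0 : 0 < 1 * j.+1%:R :> R by rewrite mul1r ltr0n.
  have := PQ _ (lt0r_neq0 s0); rewrite chi_pos// divff ?expf_neq0 ?lt0r_neq0//.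
  by rewrite real_nat rmorph1 !mul1r hornerD hornerN => ->; rewrite subrr.
have : (P - Q)`_(d.+1 + M) = 0 by rewrite P1 coef0.
rewrite coefB /P /Q !coef_sum (bigD1 (Ordinal dM))//= big1 => [|j jd]; last first.
  rewrite coefZ coefXn eqn_add2r eq_sym; case: eqP => [e|]; last by rewrite mulr0.
  by move: jd; rewrite -val_eqE /= e eqxx.
rewrite big1 => [|j _]; last first.
  rewrite coefZ coefXn gtn_eqF ?mulr0//.
  by rewrite (leq_ltn_trans (leq_subr _ _))// addSn.
rewrite coefZ coefXn eqxx mulr1 addr0 subr0 /lcoef => /eqP.
by rewrite mulf_eq0 invr_eq0 pnatr_eq0 -leqn0 leqNgt fact_gt0 /= => /eqP.
Qed.
End OnLine.

Lemma Hom_pos n l b (psi : 'cV[R]_n -> R[i]) : (0 < l)%N -> Hom l.-1 b psi ->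
  homw [set c | 0 < c] (fun c => c ^+ l / c) psi.
Proof.
move=> l0 [_ hom] s z /= s0 s1 z0; rewrite hom// chi_pos//.
by rewrite -{2}(prednK l0) exprSr mulfK.
Qed.

(** This is [euler_drop] with v = 0: the radial direction may be replaced by the zero direction. *)
Lemma iter_cderive_self n l b (psi : 'cV[R]_n -> R[i]) x c : (0 < l)%N -> Hom l.-1 b psi ->
  x != 0 -> iter l (cderive (c *: x)) psi x = 0.
Proof.
move=> l0 hom x0; have := euler_drop 0 c hom.1 x0 (Hom_pos l0 hom).
rewrite add0r => ->; rewrite -[0 : 'cV[R]_n](scale0r 0) (iter_cderiveZdir _ _ _ hom.1 x0).
by rewrite expr0n gtn_eqF// mul0r.
Qed.

Section DLKernel.
Variables (k l : nat) (b : int).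
Let N := k.+1.
Hypothesis l0 : (0 < l)%N.

(** At g the operator sees only the directions g(0,y). Every direction at x = g e_0 is one of these
    plus a multiple of x, which Euler's identity removes. *)
Lemma DL_ker (psi : 'cV[R]_(1 + N) -> R[i]) : Hom l.-1 b psi ->
  (DL l psi = 0 <-> forall x v, x != 0 -> iter l (cderive v) psi x = 0).
Proof.
move=> hom; have hpsi := hom.1; split=> [h x v x0|h].
  have [g gx] := SL_transitive x0.
  pose w : 'cV[R]_(1 + N) := invmx (slmx g) *m v.
  have -> : v = slmx g *m emb0 (dsubmx w) + w 0 0 *: x.
    have -> : v = slmx g *m w by rewrite /w mulKVmx ?SL_unit.
    rewrite -gx scalemxAr -mulmxDr; congr (_ *m _).
    rewrite e0_block /emb0 (@scale_col_mx R 1 N) (@add_col_mx R 1 N) scaler0 addr0 add0r.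
    have l0' : lshift N (0 : 'I_1) = 0 :> 'I_(1 + N) by exact: val_inj.
    have -> : w 0 0 *: 1%:M = usubmx w :> 'cV[R]_1.
      by apply/matrixP => i j; rewrite scale_scalar_mx mulr1 [LHS]mxE [RHS]mxE !ord1 mulr1n l0'.
    by rewrite vsubmxK.
  rewrite (euler_drop _ _ hpsi x0 (Hom_pos l0 hom)).
  have := congr1 (fun p => meval (rpt (dsubmx w)) (mpoly_of_dhomog (p g))) h.
  rewrite DL_eval// gx meval0 => /eqP; rewrite mulf_eq0 invr_eq0 pnatr_eq0.
  by rewrite -leqn0 leqNgt fact_gt0 /= => /eqP.
apply/funext => g; apply: dhomog_real_inj => y; rewrite DL_eval// h ?mulr0 ?meval0//.
exact: SL_e0_neq0.
Qed.

Lemma exists_indep (x : 'cV[R]_(1 + N)) : x != 0 -> exists v, forall c, v <> c *: x.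
Proof.
move=> x0; have [g <-] := SL_transitive x0.
exists (slmx g *m emb0 (delta_mx 0 0)) => c; rewrite scalemxAr => /(congr1 (mulmx (invmx (slmx g)))).
rewrite !mulKmx ?SL_unit// e0_block /emb0 (@scale_col_mx R 1 N) scaler0.
move=> /(@eq_col_mx _ 1 N)[_ /matrixP/(_ 0 0)/eqP]; rewrite !mxE !eqxx.
by rewrite oner_eq0.
Qed.

Lemma DL_inj_mismatch (psi : 'cV[R]_(1 + N) -> R[i]) : b = 1 \/ b = -1 ->
  b <> (-1) ^+ l.-1 -> Hom l.-1 b psi -> DL l psi = 0 -> liftSL psi = 0.
Proof.
move=> hb mis hom /(DL_ker hom) h; apply/funext => g; rewrite /liftSL.
have x0 := SL_e0_neq0 g; have [v hv] := exists_indep x0.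
apply: (line_mismatch hb hom x0 hv mis).
by move=> y w y0 _; rewrite prednK// h.
Qed.
End DLKernel.
End Kernel.

(** * Homogeneous polynomials as the kernel *)

Section Monomials.
Variables (R : realType) (k d : nat).
Let N := k.+1.
Let n := (1 + N)%N.
Implicit Types (x v : 'cV[R]_(1 + N)).

Definition wmon (w : seq 'I_(1 + N)) x : R[i] := \prod_(i <- w) (x i 0)%:C.
(** Indexing by words rather than exponents gives a spanning family with repetitions, in which
    powers of linear forms expand without coefficients. *)
Definition mon (u : {ffun 'I_d -> 'I_(1 + N)}) x : R[i] := \prod_j (x (u j) 0)%:C.

Lemma csm_coordC i : csm setT (fun x => (x i 0)%:C : R[i]).
Proof. by apply: csm_real => K; exact: Cn_coord. Qed.

Lemma csm_wmon w : csm setT (wmon w).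
Proof.
elim: w => [|i w IH].
  by apply: csm_ext (csm_cst setT 1); [exact: openT|move=> x _; rewrite /wmon big_nil].
apply: (@csm_ext _ _ setT (fun x => (x i 0)%:C * wmon w x)); first exact: openT.
  by move=> x _; rewrite /wmon big_cons.
by apply: csmM; [exact: openT|exact: csm_coordC|].
Qed.

(** Leibniz's rule stops after two terms because the first factor is linear; for j = 0 the factor j
    cancels the term with [j.-1]. *)
Lemma iter_cderive_coordM i (F : 'cV[R]_(1 + N) -> R[i]) v j x : csm setT F ->
  iter j (cderive v) (fun x => (x i 0)%:C * F x) x =
  (x i 0)%:C * iter j (cderive v) F x + j%:R * (v i 0)%:C * iter j.-1 (cderive v) F x.
Proof.
move=> hF; have dc y : cderive v (fun x => (x i 0)%:C : R[i]) y = (v i 0)%:C.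
  apply: complexP; rewrite /= ?derive_cst//.
  by have [_ ->] := is_derive_coord y v i 0.
elim: j x => [|j IH] x; first by rewrite /= !mul0r addr0.
have hi m := csm_iter m v hF.
rewrite /= (@cderive_ext _ _ setT _ (fun x => (x i 0)%:C * iter j (cderive v) F x +
   j%:R * (v i 0)%:C * iter j.-1 (cderive v) F x))//; last exact: openT.
have h1 : csm setT (fun x => (x i 0)%:C * iter j (cderive v) F x).
  by apply: csmM; [exact: openT|exact: csm_coordC|exact: hi].
have h2 : csm setT (fun x => j%:R * (v i 0)%:C * iter j.-1 (cderive v) F x).
  by apply: csmZ; [exact: openT|exact: hi].
rewrite (cderiveD v h1 h2 (I : setT x)) (cderiveM v (csm_coordC i) (hi j) (I : setT x)) dc.
rewrite (cderiveZ _ v (hi j.-1) (I : setT x)) -nat1r.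
by case: j {IH h1 h2} => [|j] /=; ring.
Qed.

Lemma iter_cderive_wmon w v x j : (size w < j)%N -> iter j (cderive v) (wmon w) x = 0.
Proof.
elim: w x j => [|i w IH] x j wj.
  case: j wj => // j _; rewrite iterSr.
  transitivity (iter j (cderive v) (cst 0 : 'cV[R]_(1 + N) -> R[i]) x).
    apply: (iter_cderive_ext (@openT _)) => // z _.
    rewrite -[RHS](cderive_cst v z (1 : R[i])); congr (cderive v _ z).
    by apply/funext => t; rewrite /wmon big_nil.
  elim: j => [//|j IH]; rewrite iterSr -[RHS]IH; apply: (iter_cderive_ext (@openT _)) => // z _.
  exact: cderive_cst.
rewrite (@iter_cderive_ext _ _ setT openT j v _ (fun x => (x i 0)%:C * wmon w x))//.
  rewrite iter_cderive_coordM; last exact: csm_wmon.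
  rewrite !IH ?mulr0 ?addr0//; first by case: j wj.
  exact: ltnW.
by move=> z _; rewrite /wmon big_cons.
Qed.

Lemma mon_wmon u : mon u = wmon (codom u).
Proof.
by apply/funext => x; rewrite /mon /wmon big_map big_enum.
Qed.

Lemma wmon_mon w : size w = d -> exists u, wmon w = mon u.
Proof.
move=> sw; exists [ffun j : 'I_d => nth 0 w j]; apply/funext => x.
rewrite /wmon /mon (big_nth 0) big_mkord sw; apply: eq_bigr => j _.
by rewrite ffunE.
Qed.

Definition inmon (F : 'cV[R]_(1 + N) -> R[i]) :=
  exists c : {ffun 'I_d -> 'I_(1 + N)} -> R[i], forall x, F x = \sum_u c u * mon u x.

Lemma inmonD F G : inmon F -> inmon G -> inmon (fun x => F x + G x).
Proof.
move=> [c hc] [c' hc']; exists (fun u => c u + c' u) => x.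
by rewrite hc hc' -big_split; apply: eq_bigr => u _; rewrite /= mulrDl.
Qed.

Lemma inmonZ a F : inmon F -> inmon (fun x => a * F x).
Proof.
move=> [c hc]; exists (fun u => a * c u) => x.
by rewrite hc mulr_sumr; apply: eq_bigr => u _; rewrite mulrA.
Qed.

Lemma inmon_ext F G : (forall x, F x = G x) -> inmon F -> inmon G.
Proof. by move=> e [c hc]; exists c => x; rewrite -e. Qed.

Lemma inmon_sum (I : eqType) (r : seq I) (F : I -> 'cV[R]_(1 + N) -> R[i]) :
  (forall i, i \in r -> inmon (F i)) -> inmon (fun x => \sum_(i <- r) F i x).
Proof.
elim: r => [|i r IH] h.
  by exists (fun=> 0) => x; rewrite big_nil big1// => u _; rewrite mul0r.
apply: (inmon_ext (F := fun x => F i x + \sum_(j <- r) F j x)).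
  by move=> x; rewrite big_cons.
apply: inmonD; first by apply: h; rewrite mem_head.
by apply: IH => j jr; apply: h; rewrite in_cons jr orbT.
Qed.

Lemma inmon_wmon w : size w = d -> inmon (wmon w).
Proof.
move=> /wmon_mon[u ->]; exists (fun u' => (u' == u)%:R) => x.
rewrite (bigD1 u)//= eqxx mul1r big1 ?addr0// => u' /negbTE ->.
by rewrite mul0r.
Qed.

Lemma chi_sign (c : R) : c != 0 -> chi d ((-1) ^+ d) c = c ^+ d.
Proof.
move=> c0; have [cn|cp|ce] := ltgtP c 0; last by rewrite ce eqxx in c0.
- rewrite chi_neg ?eqxx ?mul1r//.
  by rewrite -signr_odd; case: (odd d); [right|left].
- exact: chi_pos.
Qed.

Lemma inmon_csm F : inmon F -> csm setT F.
Proof.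
move=> [c hc]; apply: (@csm_ext _ _ setT (fun x => \sum_u c u * mon u x)); first exact: openT.
  by move=> x _; rewrite hc.
apply: csm_sum => [|u _]; first exact: openT.
by apply: csmZ; [exact: openT|rewrite mon_wmon; exact: csm_wmon].
Qed.

Lemma inmon_Hom F : inmon F -> Hom d ((-1) ^+ d) F.
Proof.
move=> hF; split; first by apply: csm_sub (inmon_csm hF).
move=> s x s0 x0; have [c hc] := hF; rewrite !hc mulr_sumr; apply: eq_bigr => u _.
rewrite mulrCA; congr (_ * _); rewrite chi_sign// /mon.
under eq_bigr do rewrite mxE rmorphM.
by rewrite big_split /= prodr_const card_ord rmorphXn.
Qed.

Lemma inmon_iter F x v : inmon F -> iter d.+1 (cderive v) F x = 0.
Proof.
move=> [c hc].
rewrite (@iter_cderive_ext _ _ setT openT _ v _ (fun x => \sum_u c u * mon u x))//.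
rewrite (iter_cderive_sum openT)//; last first.
  by move=> u; apply: csmZ; [exact: openT|rewrite mon_wmon; exact: csm_wmon].
apply: big1 => u _; have hu : csm setT (mon u) by rewrite mon_wmon; exact: csm_wmon.
rewrite (iter_cderiveZ openT)// mon_wmon iter_cderive_wmon ?mulr0//.
by rewrite size_codom card_ord.
Qed.

Lemma col_decomp x : x = x 0 0 *: e0 R N + emb0 (dsubmx x).
Proof.
have l0' : lshift N (0 : 'I_1) = 0 :> 'I_(1 + N) by exact: val_inj.
rewrite e0_block /emb0 (@scale_col_mx R 1 N) (@add_col_mx R 1 N) scaler0 addr0 add0r.
have -> : x 0 0 *: 1%:M = usubmx x :> 'cV[R]_1.
  by apply/matrixP => i j; rewrite scale_scalar_mx mulr1 [LHS]mxE [RHS]mxE !ord1 mulr1n l0'.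
by rewrite vsubmxK.
Qed.

Lemma emb0_00 (a : 'cV[R]_(1 + N)) (s : R) y : (a + s *: emb0 y) 0 0 = a 0 0.
Proof.
have l0' : lshift N (0 : 'I_1) = 0 :> 'I_(1 + N) by exact: val_inj.
by rewrite mxE [X in _ + X]mxE -l0' /emb0 col_mxEu mxE mulr0 addr0.
Qed.

(* Off the hyperplane x_0 = 0, writing x = x_0 (e_0 + (0,y)/x_0) turns the Taylor
   expansion along a line through e_0 into a polynomial in x. *)
Lemma ker_inmon psi : Hom d ((-1) ^+ d) psi ->
  (forall x v, x != 0 -> iter d.+1 (cderive v) psi x = 0) ->
  exists2 F, inmon F & forall x, x != 0 -> psi x = F x.
Proof.
move=> hom hM; have [hpsi hc] := hom.
pose e := e0 R N.
(* A Taylor term of order j contributes j variables; padding with d - j copies of x_0, from the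
   factor x_0^(d-j), gives degree d. *)
pose wd (j : nat) (w : seq (idx k)) : seq 'I_(1 + N) :=
  nseq (d - j) (0 : 'I_(1 + N)) ++ [seq rshift 1 t.1 | t <- w].
pose C (j : nat) (w : seq (idx k)) : R[i] := (j`!%:R)^-1 * ((aword (1%:M : 'M[R]_(1 + N)) w)%:C * dword w psi e).
pose F x := \sum_(j <- iota 0 d.+1) \sum_(w <- words k j) C j w * wmon (wd j w) x.
have hF : inmon F.
  apply: inmon_sum => j; rewrite mem_iota add0n ltnS => /andP[_ jd].
  apply: inmon_sum => w /size_words sw; apply/inmonZ/inmon_wmon.
  by rewrite size_cat size_nseq size_map sw subnK.
have iterE j y : iter j (cderive (emb0 y)) psi e =
    \sum_(w <- words k j) ((aword (1%:M : 'M[R]_(1 + N)) w)%:C * dword w psi e) *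
      \prod_(t <- w) (y t.1 0)%:C.
  have := lsymb_eval j 1%:M y hpsi (e0_neq0 R N); rewrite mul1mx => <-.
  rewrite /lsymb mpoly_of_dhomog_sum raddf_sum big_seq [RHS]big_seq; apply: eq_bigr => w hw.
  rewrite mpoly_of_dhomogZ /= mevalZ -[mpoly_of_dhomog _]/(val (indhomog j (xword R w))) (xword_in _ hw).
  congr (_ * _); rewrite /xword; elim: w {hw} => [|t w IH]; first by rewrite !big_nil meval1.
  by rewrite !big_cons mevalM mevalXU IH.
have gen x : x 0 0 != 0 -> psi x = F x.
  move=> x00; pose y := dsubmx x.
  have xE : x = x 0 0 *: (e + (1 : R) *: emb0 ((x 0 0)^-1 *: y)).
    rewrite scale1r scalerDr {1}[x]col_decomp; congr (_ + _).
    by rewrite /emb0 (@scale_col_mx R 1 N) scaler0 scalerA mulfV// scale1r.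
  have ne (s : R) : e + s *: emb0 ((x 0 0)^-1 *: y) != 0.
    apply/eqP => /matrixP/(_ 0 0)/eqP; rewrite emb0_00 !mxE !eqxx.
    by rewrite oner_eq0.
  rewrite [in LHS]xE hc//.
  rewrite (line_taylor hom 1 ne (fun s => hM _ _ (ne s))) chi_sign// /F -[iota 0 d.+1]/(index_iota 0 d.+1) big_mkord mulr_sumr.
  apply: eq_bigr => j _; rewrite rmorph1 expr1n mul1r.
  have -> : emb0 ((x 0 0)^-1 *: y) = (x 0 0)^-1 *: emb0 y.
    by rewrite /emb0 (@scale_col_mx R 1 N) scaler0.
  rewrite (iter_cderiveZdir _ _ _ hpsi (e0_neq0 R N)) iterE.
  rewrite !mulr_sumr; apply: eq_bigr => w _; rewrite /C /wd /wmon big_cat big_map /=.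
  have -> : \prod_(i <- nseq (d - j) 0) (x i 0)%:C = (x 0 0)%:C ^+ (d - j) :> R[i].
    elim: (d - j)%N => [|m IH] /=; first by rewrite big_nil.
    by rewrite big_cons IH exprS.
  have -> : \prod_(t <- w) (x (rshift 1 t.1) 0)%:C = \prod_(t <- w) (y t.1 0)%:C :> R[i].
    by apply: eq_bigr => t _; rewrite mxE.
  have xC : (x 0 0)%:C != 0 :> R[i] by rewrite fmorph_eq0.
  have -> : (x 0 0 ^+ d)%:C = (x 0 0)%:C ^+ (d - j) * (x 0 0)%:C ^+ j :> R[i].
    by rewrite rmorphXn -exprD subnK// -ltnS.
  have -> : ((x 0 0)^-1 ^+ j)%:C = ((x 0 0)%:C ^+ j)^-1 :> R[i].
    by rewrite rmorphXn fmorphV exprVn.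
  have xj : (x 0 0)%:C ^+ j != 0 :> R[i] by rewrite expf_neq0.
  by field; rewrite xj pnatr_eq0 -lt0n fact_gt0.
exists F => // x x0; have [x00|x00] := eqVneq (x 0 0) 0; last exact: gen.
(* The point [c s] has first coordinate s, so [gen] applies for s other than 0, and continuity at s
   = 0 settles the hyperplane. *)
pose c (s : R) : 'cV[R]_(1 + N) := x + s *: e.
have c0 : c 0 = x by rewrite /c scale0r addr0.
have cs s : c s 0 0 = s by rewrite /c !mxE x00 !eqxx mulr1 add0r.
have cc : {for 0, continuous c}.
  apply: continuousD; first exact: cst_continuous.
  exact: scalel_continuous.
have key (r : 'cV[R]_(1 + N) -> R) : {for x, continuous r} -> {for 0, continuous (r \o c)}.
  by move=> cr; apply: continuous_comp; [exact: cc|rewrite c0].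
have [a1 b1] := hpsi 0%N; have [a2 b2] := inmon_csm hF 0%N.
rewrite -c0; apply: complexP.
- apply: (cont_eq0 (key _ (Cn_cont a1 x0)) (key _ (Cn_cont a2 (I : setT x)))).
  by move=> s s0 /=; rewrite gen ?cs.
- apply: (cont_eq0 (key _ (Cn_cont b1 x0)) (key _ (Cn_cont b2 (I : setT x)))).
  by move=> s s0 /=; rewrite gen ?cs.
Qed.
End Monomials.

(** * The finite-dimensional subrepresentation *)

Section Torus.
Variables (R : realType) (N : nat).

Definition torus_mx (s : R) : 'M[R]_(1 + N) := block_mx (s ^+ N)%:M 0 0 (s^-1)%:M.

Lemma torus_det s : s != 0 -> \det (torus_mx s : 'M[R]_N.+1) == 1.
Proof.
move=> s0; rewrite /torus_mx (@det_ublock R 1 N) det_scalar1 det_scalar exprVn mulfV//.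
by rewrite expf_neq0.
Qed.

Definition torus s (s0 : s != 0) : SL R N.+1 := MkSL (torus_det s0).

Lemma torus_row s (x : 'cV[R]_(1 + N)) i :
  (torus_mx s *m x) i 0 = (if i == 0 then s ^+ N else s^-1) * x i 0.
Proof.
have l0 : lshift N (0 : 'I_1) = 0 :> 'I_(1 + N) by exact: val_inj.
rewrite -[x]vsubmxK /torus_mx (@mul_block_col R 1 N 1 N) !mul0mx addr0 add0r !mul_scalar_mx.
case: (split_ordP i) => i' ->.
  by rewrite [i']ord1 !col_mxEu mxE l0 eqxx.
have -> : (rshift 1 i' == 0) = false by [].
by rewrite !col_mxEd mxE.
Qed.
End Torus.

Section Irreducible.
Variables (R : realType) (k d : nat).
Let N := k.+1.
Local Notation SLn := (SL R N.+1).
Local Notation word := {ffun 'I_d -> 'I_(1 + N)}.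

Definition monV : set (SLn -> R[i]^o) := [set f | exists2 F, inmon d F & f = liftSL F].

Lemma liftSL_mul (g h : SLn) (F : 'cV[R]_N.+1 -> R[i]) :
  liftSL F (g * h)%g = F (slmx g *m (slmx h *m e0 R N)).
Proof. by rewrite /liftSL /= mulmxA. Qed.

Definition lmon (u : word) : SLn -> R[i]^o := liftSL (mon u).

Lemma monV_sum (f : SLn -> R[i]^o) :
  monV f <-> exists c : word -> R[i], f = \sum_u c u *: lmon u.
Proof.
have e c : (\sum_u c u *: lmon u) = liftSL (fun x => \sum_u c u * mon u x) :> (SLn -> R[i]^o).
  by apply/funext => g; rewrite fct_sumE; apply: eq_bigr => u _.
split.
  by move=> [F [c hc] ->]; exists c; rewrite e; apply/funext => g; rewrite /liftSL hc.
by move=> [c ->]; exists (fun x => \sum_u c u * mon u x); [exists c|rewrite e].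
Qed.

Variable E : set (SLn -> R[i]^o).
Hypothesis hE : invariant_subspace E.
Hypothesis EV : E `<=` monV.

Let E0 : E 0. Proof. by case: hE. Qed.
Let EL : forall (c : R[i]) u v, E u -> E v -> E (c *: u + v). Proof. by case: hE. Qed.
Let EZ (c : R[i]) u : E u -> E (c *: u).
Proof. by move=> Eu; rewrite -[c *: u]addr0; exact: EL. Qed.
Let Eg (g : SLn) u : E u -> E (fun h => u (g * h)%g).
Proof.
case: hE => _ _ h Eu; have := h (g^-1)%g u Eu; rewrite /ltrans invgK.
exact.
Qed.

(* Some translate of a nonzero element does not vanish at e_0, so it contains the
   monomial x_0^d, which the torus separates from the others. *)
Lemma top_monomial : E <> [set 0] -> E (lmon [ffun=> 0]).
Proof.
move=> En0; have [f [Ef f0]] : exists f, E f /\ f <> 0.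
  apply: contrapT => h; apply: En0; apply/seteqP; split=> [f Ef|f ->] //=.
  by apply: contrapT => f0; apply: h; exists f.
have [g0 fg0] : exists g, f g <> 0.
  by apply: contrapT => h; apply: f0; apply/funext => g; apply: contrapT => fg; apply: h; exists g.
have Ef1 := Eg g0 Ef; have /monV_sum[c hc] := EV Ef1.
pose z : word := [ffun=> 0].
(* At e_0 every monomial vanishes except x_0^d, so this coefficient is the nonzero value f g0. *)
have cz : c z != 0.
  apply/eqP => cz; apply: fg0; have := congr1 (fun f => f 1%g) hc; rewrite mulg1 => ->.
  rewrite fct_sumE big1// => u _; have [->|uz] := eqVneq u z; first by rewrite cz scale0r.
  have [j uj] : exists j, u j != 0.
    apply/existsP; rewrite -[X in is_true X]negbK negb_exists; apply/negP => /forallP h.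
    by case/negP: uz; apply/eqP/ffunP => j; rewrite ffunE; have := h j; rewrite negbK => /eqP.
  rewrite -[LHS]/(c u * mon u (1%:M *m e0 R N)) mul1mx /mon (bigD1 j)//= mxE (negbTE uj) /= mul0r.
  exact: mulr0.
(* The torus scales the monomial of u by s^(N nz0 - (d - nz0)); the extra factor s^d makes the
   exponent (N+1) nz0, a natural number that is maximal only for the word 0...0. *)
pose nz0 (u : word) : nat := #|[pred j | u j == 0]|.
have H := @kronecker_extraction R[i] (SLn -> R[i]^o) E word (fun u => N.+1 * nz0 u)%N
   (fun u => c u *: lmon u) E0 EL.
have {H}H : E (\sum_(u | (N.+1 * nz0 u == N.+1 * d)%N) c u *: lmon u).
  apply: H => s s0.
  have sR : (s%:R : R) != 0 by rewrite pnatr_eq0 -lt0n.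
  suff -> : \sum_u s%:R ^+ (N.+1 * nz0 u) *: (c u *: lmon u) =
    s%:R ^+ d *: (fun h => f (g0 * (torus N sR * h))%g) by apply: EZ; exact: (Eg (torus N sR) Ef1).
  have -> : (fun h => f (g0 * (torus N sR * h))%g) = (fun h => (\sum_u c u *: lmon u) (torus N sR * h)%g).
    by rewrite -hc.
  apply/funext => h; rewrite -[RHS]/(_ * _) !fct_sumE mulr_sumr; apply: eq_bigr => u _.
  rewrite -[LHS]/(_ * (c u * lmon u h)) -[(c u *: lmon u) _]/(c u * lmon u _) /lmon liftSL_mul.
  rewrite /liftSL /mon; set x := slmx h *m e0 R N.
  have -> : \prod_(j < d) ((slmx (torus N sR) *m x) (u j) 0)%:C =
     (\prod_(j < d) (if u j == 0 then s%:R ^+ N else s%:R^-1 : R[i])) * \prod_j (x (u j) 0)%:C.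
    rewrite -big_split; apply: eq_bigr => j _; rewrite torus_row rmorphM /=; congr (_ * _).
    by case: ifP => _; rewrite ?fmorphV ?rmorphXn /= rmorph_nat.
  suff -> : \prod_(j < d) (if u j == 0 then s%:R ^+ N else s%:R^-1 : R[i]) =
    s%:R ^+ (N.+1 * nz0 u) / s%:R ^+ d.
    have sC : s%:R ^+ d != 0 :> R[i] by rewrite expf_neq0// pnatr_eq0 -lt0n.
    by field.
  have sC : s%:R != 0 :> R[i] by rewrite pnatr_eq0 -lt0n.
  have -> : s%:R ^+ d = \prod_(j < d) s%:R :> R[i] by rewrite prodr_const card_ord.
  have -> : s%:R ^+ (N.+1 * nz0 u) = \prod_(j < d) (if u j == 0 then s%:R ^+ N.+1 else 1) :> R[i].
    rewrite exprM -big_mkcond /= prodr_const; congr (_ ^+ _).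
  rewrite -prodf_div; apply: eq_bigr => j _.
  case: ifP => _; last by rewrite mul1r.
  by rewrite exprSr mulfK.
have hz (u : word) : (N.+1 * nz0 u == N.+1 * d)%N = (u == z).
  rewrite eqn_pmul2l//; apply/eqP/eqP => [e|->].
    have /subset_cardP h : #|[pred j | u j == 0]| = #|'I_d| by rewrite -[LHS]/(nz0 u) e card_ord.
    apply/ffunP => j; rewrite ffunE; have := h (subset_predT _) j.
    by rewrite !inE => /eqP.
  by rewrite /nz0 -[RHS]card_ord; apply: eq_card => j; rewrite !inE ffunE eqxx.
move: H; rewrite (big_pred1 z) => [|u]; last by rewrite hz.
by move=> /(EZ (c z)^-1); rewrite scalerA mulVf// scale1r.
Qed.

(** The transpose of an element with first column v has first row v. *)
Lemma exists_row (v : 'cV[R]_(1 + N)) : v != 0 -> exists g : SLn, forall x : 'cV[R]_N.+1,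
  (slmx g *m x) 0 0 = \sum_i v i 0 * x i 0.
Proof.
move=> /SL_transitive[g ge].
have dt : \det (slmx g)^T == 1 by rewrite det_tr SL_det.
exists (MkSL dt) => x; rewrite mxE; apply: eq_bigr => i _; congr (_ * _).
rewrite /= mxE -ge mxE (bigD1 0)//= big1 => [|j /negbTE j0]; last by rewrite mxE j0 mulr0.
by rewrite mxE !eqxx mulr1 addr0.
Qed.

Lemma mon_count (u : word) (x : 'cV[R]_(1 + N)) :
  mon u x = \prod_i (x i 0)%:C ^+ #|[pred j | u j == i]|.
Proof.
rewrite /mon (partition_big u predT)//=; apply: eq_bigr => i _.
rewrite -prodr_const; apply: eq_big => [j|j /eqP ->//].
by rewrite inE.
Qed.

(* Translating x_0^d gives (sum_i s^(B^i) x_i)^d, and for B > d the exponents of s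
   separate the monomials. *)
Lemma all_monomials : E (lmon [ffun=> 0]) -> forall u, E (lmon u).
Proof.
move=> Ez u; pose B := d.+1.
pose cnt (u : word) (i : 'I_(1 + N)) := #|[pred j | u j == i]|.
pose e (u : word) := (\sum_i cnt u i * B ^ i)%N.
have cB u' i : (cnt u' i < B)%N by rewrite ltnS -[X in (_ <= X)%N]card_ord max_card.
have e_mon u1 u2 : e u1 = e u2 -> lmon u1 = lmon u2.
  move=> /(kronecker_inj (cB u1) (cB u2)) h; apply/funext => g.
  by rewrite /lmon /liftSL !mon_count; apply: eq_bigr => i _; rewrite -!/(cnt _ i) h.
have eE u' : e u' = (\sum_j B ^ u' j)%N.
  rewrite (partition_big u' predT)//=; apply: eq_bigr => i _.
  rewrite -sum_nat_const; apply: eq_big => [j|j]; first by rewrite inE.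
  by rewrite inE => /eqP ->.
have H := @kronecker_extraction R[i] (SLn -> R[i]^o) E word e lmon E0 EL.
have {H}H : E (\sum_(u' | e u' == e u) lmon u').
  apply: H => s s0.
  pose v : 'cV[R]_(1 + N) := \col_i s%:R ^+ (B ^ i).
  have v0 : v != 0.
    apply/eqP => /matrixP/(_ 0 0)/eqP; rewrite !mxE expf_eq0 pnatr_eq0 (gtn_eqF s0).
    by rewrite andbF.
  have vC i : (v i 0)%:C = s%:R ^+ (B ^ i) :> R[i] by rewrite mxE rmorphXn rmorph_nat.
  have [g hg] := exists_row v0.
  suff -> : \sum_u' s%:R ^+ e u' *: lmon u' = (fun h => lmon [ffun=> 0] (g * h)%g) by exact: Eg.
  apply/funext => h; rewrite /lmon liftSL_mul fct_sumE /mon; set x := slmx h *m e0 R N.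
  under [RHS]eq_bigr do rewrite ffunE hg rmorph_sum.
  rewrite bigA_distr_bigA /=; apply: eq_bigr => u' _.
  rewrite -[LHS]/(_ * lmon u' h) /lmon /liftSL /mon -/x eE expr_sum -big_split.
  by apply: eq_bigr => j _; rewrite /= -vC -rmorphM.
(* Words with the same exponent define the same function, so the extracted sum is a positive
   multiple of [lmon u]. *)
have -> : lmon u = (#|[pred u' | e u' == e u]|%:R)^-1 *: (\sum_(u' | e u' == e u) lmon u').
  rewrite (eq_bigr (fun=> lmon u)); last by move=> u' /eqP /e_mon.
  rewrite sumr_const -[X in _ *: X](@scaler_nat R[i]) scalerA mulVf ?scale1r// pnatr_eq0 -lt0n.
  by apply/card_gt0P; exists u; rewrite inE.
exact: EZ.
Qed.

Lemma monV_irred : E = [set 0] \/ E = monV.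
Proof.
have [->|En0] := pselect (E = [set 0]); first by left.
right; apply/seteqP; split=> // f /monV_sum[c ->].
have h := all_monomials (top_monomial En0).
elim/big_rec: _ => // u g _ Eg'; apply: EL => //; exact: h.
Qed.
End Irreducible.

(** * Eigenfunctionals on a finitely spanned space *)

Section FiniteDimension.
Variables (F : numFieldType) (V : lmodType F).

(** One vector more than generators: the coefficient matrix has more rows than columns, and a
    nonzero row of its left kernel is a relation. *)
Lemma span_dependent (s : seq V) (f : 'I_(size s).+1 -> V) :
  (forall j, exists c : 'I_(size s) -> F, f j = \sum_i c i *: s`_i) ->
  exists2 c : 'I_(size s).+1 -> F, \sum_j c j *: f j = 0 & exists j, c j != 0.
Proof.
move=> /choice[A hA]; pose M : 'M[F]_((size s).+1, size s) := \matrix_(j, i) A j i.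
have kM : kermx M != 0.
  rewrite -mxrank_eq0 mxrank_ker subn_eq0 -ltnNge ltnS.
  exact: rank_leq_col.
have [j cj] : exists j, row j (kermx M) != 0.
  apply: contrapT => h; move/eqP: kM; apply; apply/row_matrixP => j; rewrite row0.
  by apply: contrapT => /eqP hj; apply: h; exists j.
exists (fun i => kermx M j i).
  under eq_bigr do rewrite hA scaler_sumr.
  rewrite exchange_big big1// => i _; under eq_bigr do rewrite scalerA.
  rewrite -scaler_suml; suff -> : \sum_j0 kermx M j j0 * A j0 i = 0 by rewrite scale0r.
  transitivity ((kermx M *m M) j i); last by rewrite mulmx_ker mxE.
  by rewrite mulmx_entry; apply: eq_bigr => a _; rewrite [M _ _]mxE.
have [i ci] : exists i, row j (kermx M) 0 i != 0.
  apply: contrapT => h; move/eqP: cj; apply; apply/rowP => i; rewrite [RHS]mxE.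
  by apply: contrapT => /eqP hj; apply: h; exists i.
by exists i; rewrite mxE in ci.
Qed.

(** The product of the polynomials a i + X b i is nonzero, so one of finitely many natural numbers
    is not a root. *)
Lemma avoid_zeros (I : Type) (s : seq I) (a b : I -> F) :
  all (fun i => (a i != 0) || (b i != 0)) s ->
  exists t : F, all (fun i => a i + t * b i != 0) s.
Proof.
move=> h; pose P : {poly F} := \prod_(i <- s) ((a i)%:P + 'X * (b i)%:P).
have P0 : P != 0.
  rewrite prodf_seq_neq0; apply: sub_all h => i /= ab.
  apply: contraTneq ab => /polyP e; rewrite negb_or !negbK.
  have := e 0%N; have := e 1%N; rewrite !coefD !coefXM !coefC /= add0r addr0 => -> ->.
  by rewrite eqxx.
pose r := [seq j%:R : F | j <- iota 0 (size P)].
have /allPn[_ /mapP[t _ ->] ht] : ~~ all (root P) r.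
  apply/negP => rs; have ur : uniq r.
    by rewrite map_inj_uniq ?iota_uniq// => x y /eqP; rewrite eqr_nat => /eqP.
  by have := max_poly_roots P0 rs ur; rewrite size_map size_iota ltnn.
exists t%:R; move: ht; rewrite rootE horner_prod prodf_seq_neq0.
by apply: sub_all => i /=; rewrite hornerD hornerM !hornerC hornerX.
Qed.
End FiniteDimension.

Section BoundedSupport.
Variables (F : numFieldType) (V : lmodType F) (E : set V) (s : seq V) (I : eqType).
Variables (A : V -> V) (mu : nat -> F) (delta : nat -> I -> V -> F).
Hypotheses (E0 : E 0) (EL : forall c u v, E u -> E v -> E (c *: u + v))
  (Es : forall f, E f -> exists c : 'I_(size s) -> F, f = \sum_i c i *: s`_i)
  (EA : forall f, E f -> E (A f)) (mu_inj : injective mu)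
  (deltaL : forall k i c u v, E u -> E v ->
    delta k i (c *: u + v) = c * delta k i u + delta k i v)
  (deltaA : forall k i f, E f -> delta k i (A f) = mu k * delta k i f).

(* A linear relation among the iterates A^j f is a polynomial of degree at most
   [size s] vanishing at every [mu k] with [delta k i f != 0]. *)
Lemma support_card f (r : seq (nat * I)) : E f -> uniq (map fst r) ->
  all (fun p => delta p.1 p.2 f != 0) r -> (size r <= size s)%N.
Proof.
move=> Ef ur hr.
have Ej j : E (iter j A f) by elim: j => //= j; exact: EA.
have dj j k i : delta k i (iter j A f) = mu k ^+ j * delta k i f.
  elim: j => [|j IH]; first by rewrite mul1r.
  by rewrite /= deltaA// IH exprS mulrA.
have d0 k i : delta k i 0 = 0.
  have := deltaL k i 1 E0 E0; rewrite scaler0 addr0 mul1r => /eqP.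
  by rewrite -subr_eq0 opprD addrA addrN sub0r oppr_eq0 => /eqP.
have [c hc [j0 cj]] := span_dependent (fun j : 'I_(size s).+1 => Es (Ej j)).
pose C : {poly F} := \poly_(j < (size s).+1) oapp c 0 (insub j).
have hC (j : 'I_(size s).+1) : C`_j = c j by rewrite coef_poly ltn_ord valK.
have C0 : C != 0 by apply: contraTneq cj => e; rewrite -hC e coef0 eqxx.
have key k i : C.[mu k] * delta k i f = 0.
  rewrite -(d0 k i) -hc (horner_coef_wide _ (size_poly _ _)).
  have dS (q : seq 'I_(size s).+1) : delta k i (\sum_(j <- q) c j *: iter j A f) =
     \sum_(j <- q) c j * (mu k ^+ j * delta k i f) /\ E (\sum_(j <- q) c j *: iter j A f).
    elim: q => [|j q [IH1 IH2]]; first by rewrite !big_nil.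
    by rewrite !big_cons deltaL// IH1 dj; split=> //; exact: EL.
  rewrite (dS _).1 big_distrl; apply: eq_bigr => j _.
  by rewrite hC mulrA.
have rC : all (root C) (map (fun p => mu p.1) r).
  apply/allP => _ /mapP[[k i] kr ->]; rewrite rootE.
  have /(_ _ kr)/= hd := allP hr.
  by have /eqP := key k i; rewrite mulf_eq0 (negbTE hd) orbF.
have uC : uniq (map (fun p => mu p.1) r) by rewrite (map_comp mu fst) map_inj_uniq.
have := max_poly_roots C0 rC uC; rewrite size_map => /leq_trans/(_ (size_poly _ _)).
by rewrite ltnS.
Qed.

(* The bound K is uniform in f: otherwise a generic combination would have more
   nonzero [delta k i] than [support_card] allows. *)
Lemma bounded_support : exists K, forall f k i, E f -> (K <= k)%N -> delta k i f = 0.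
Proof.
apply: contrapT => h.
have {}h K : exists f k i, [/\ E f, (K <= k)%N & delta k i f != 0].
  apply: contrapT => hK; apply: h; exists K => f k i Ef Kk.
  by apply/eqP/negPn/negP => d; apply: hK; exists f, k, i.
have build m : exists f (r : seq (nat * I)), [/\ E f, uniq (map fst r), size r = m &
    all (fun p => delta p.1 p.2 f != 0) r].
  elim: m => [|m [f [r [Ef ur sr hr]]]]; first by exists 0, [::].
  (* K exceeds every index used so far, so the next index is new. *)
  pose K := (\sum_(p <- r) p.1).+1.
  have [f' [k [i [Ef' Kk d]]]] := h K.
  have [|t ht] := @avoid_zeros F _ ((k, i) :: r) (fun p => delta p.1 p.2 f) (fun p => delta p.1 p.2 f').
    by rewrite /= d orbT; apply: sub_all hr => p ->.
  exists (t *: f' + f), ((k, i) :: r); split=> //=.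
  - exact: EL.
  - rewrite ur andbT; apply/negP => /mapP[p pr kp]; move: Kk; rewrite kp /K ltnNge => /negP; apply.
    by rewrite (big_rem _ pr) /= leq_addr.
  - by rewrite sr.
  - move: ht; apply: sub_all => p /=.
    by rewrite deltaL// addrC.
have [f [r [Ef ur sr hr]]] := build (size s).+1.
by have := support_card Ef ur hr; rewrite sr ltnn.
Qed.
End BoundedSupport.

Section Unlift.
Variables (R : realType) (k : nat).
Let N := k.+1.
Local Notation SLn := (SL R N.+1).
Implicit Types (psi : 'cV[R]_(1 + N) -> R[i]) (f : SLn -> R[i]^o).

(* The value at 0 is irrelevant. *)
Definition unlift f (x : 'cV[R]_(1 + N)) : R[i] :=
  f (xget 1%g [set g : SLn | slmx g *m e0 R N = x]).

Lemma unliftK psi x : x != 0 -> unlift (liftSL psi) x = psi x.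
Proof.
move=> x0; rewrite /unlift /liftSL; congr psi.
exact: (@xgetPex _ 1%g [set g : SLn | slmx g *m e0 R N = x] (SL_transitive x0)).
Qed.

Lemma Hom_ext d b psi psi' : (forall x, x != 0 -> psi x = psi' x) -> Hom d b psi -> Hom d b psi'.
Proof.
move=> e [h1 h2]; split; first by apply: csm_ext h1 => //; exact: open_nz.
by move=> c x c0 x0; rewrite -!e ?h2// scaler_eq0 negb_or c0.
Qed.

Lemma unlift_Hom d b f : Ind (@triv R N) b (- d%:R) f -> Hom d b (unlift f) /\ f = liftSL (unlift f).
Proof.
move=> /Ind_Hom[psi hpsi ->]; have e x : x != 0 -> psi x = unlift (liftSL psi) x.
  by move=> x0; rewrite unliftK.
split; first exact: Hom_ext e hpsi.
apply/funext => g; rewrite -[LHS]/(psi _) e//.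
exact: SL_e0_neq0.
Qed.

Lemma torus_e0 (s : R) (s0 : s != 0) : slmx (torus N s0) *m e0 R N = s ^+ N *: e0 R N.
Proof.
apply/(@matrixP _ (1 + N)) => i j; rewrite [j]ord1 torus_row !mxE.
by case: (eqVneq i 0) => [_|i0]; rewrite ?mulr0.
Qed.

Lemma torus_emb0 (s : R) (s0 : s != 0) y : slmx (torus N s0) *m emb0 y = s^-1 *: emb0 y.
Proof.
apply/(@matrixP _ (1 + N)) => i j; rewrite [j]ord1 torus_row [RHS]mxE.
have [->|i0] := eqVneq i 0; last by [].
by have := emb0_00 0 1 y; rewrite add0r scale1r [RHS]mxE => ->; rewrite !mulr0.
Qed.

(** After moving e_0 to x, the vector v has coordinates (w_0, y) with y nonzero. A unipotent matrix
    with first row (1, r) fixes e_0 and sends (0,y) to (r y, y); the choice r = (w_0 / y^T y) y^T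
    gives r y = w_0. *)
Lemma pair_transitive (x v : 'cV[R]_(1 + N)) : x != 0 -> (forall c, v <> c *: x) ->
  exists (g : SLn) y, slmx g *m e0 R N = x /\ slmx g *m emb0 y = v.
Proof.
move=> x0 hv; have [g0 gx] := SL_transitive x0.
pose w : 'cV[R]_(1 + N) := invmx (slmx g0) *m v.
have vw : v = slmx g0 *m w by rewrite /w mulKVmx ?SL_unit.
pose y := dsubmx w; have y0 : y != 0.
  apply/eqP => y0; apply: (hv (w 0 0)); rewrite vw {1}(col_decomp w) -/y y0.
  by rewrite /emb0 (@col_mx0 _ 1 N) addr0 -scalemxAr gx.
have yy0 : (y^T *m y) 0 0 != 0.
  apply: contra y0 => /eqP; rewrite mulmx_entry.
  have -> : \sum_j y^T 0 j * y j 0 = \sum_j (y j 0) ^+ 2 by apply: eq_bigr => j _; rewrite mxE.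
  move=> /eqP; rewrite psumr_eq0 => [/allP h|a _]; last exact: sqr_ge0.
  apply/eqP/matrixP => i j; rewrite [j]ord1 [RHS]mxE.
  by have := h i (mem_index_enum _); rewrite /= expf_eq0 /= => /eqP.
pose r : 'rV[R]_N := (w 0 0 / (y^T *m y) 0 0) *: y^T.
pose u : 'M[R]_(1 + N) := block_mx 1%:M r 0 1%:M.
have du : \det (u : 'M[R]_N.+1) == 1 by rewrite (@det_ublock R 1 N) !det1 mulr1.
exists (g0 * MkSL du)%g, y; split; rewrite /= -mulmxA.
  by rewrite -gx e0_block /u (@mul_block_col R 1 N 1 N) !mulmx0 mul0mx !addr0 mulmx1.
rewrite vw; congr (_ *m _); rewrite /u /emb0 (@mul_block_col R 1 N 1 N) mulmx0 mul0mx !add0r mul1mx.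
have l0' : lshift N (0 : 'I_1) = 0 :> 'I_(1 + N) by exact: val_inj.
have -> : r *m y = usubmx w.
  apply/matrixP => i j; rewrite /r -scalemxAl [LHS]mxE !ord1 [RHS]mxE l0'.
  by rewrite mulfVK.
exact: (@vsubmxK _ 1 N 1 w).
Qed.
End Unlift.

Section FiniteDimensionalSubrep.
Variables (R : realType) (k d : nat).
Let N := k.+1.
Local Notation SLn := (SL R N.+1).
Local Notation b := ((-1) ^+ d : int).
Local Notation J := (Ind (@triv R N) b (- d%:R)).

Lemma Hom_mul e c (g : SLn) (psi : 'cV[R]_N.+1 -> R[i]) : Hom e c psi ->
  Hom e c (fun x => psi (slmx g *m x)).
Proof.
move=> [h1 h2]; split.
  apply: csm_comp h1; [exact: open_nz|exact: open_nz|by move=> x; exact: SL_mul_neq0|].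
  by move=> j i i'; apply: Cn_mulmx; exact: open_nz.
by move=> s x s0 x0; rewrite -scalemxAr h2// SL_mul_neq0.
Qed.

(* The transversal derivatives at e_0 of order j are eigenvectors of the torus with
   pairwise distinct eigenvalues, so on F those of large order vanish. *)
Lemma findim_sub_monV (F : set (SLn -> R[i]^o)) : F `<=` J -> invariant_subspace F ->
  (exists s, forall u, F u -> in_span s u) -> F `<=` @monV R k d.
Proof.
move=> FJ [F0 FL Fg] [s Fs].
have Fg' (g : SLn) u : F u -> F (fun h => u (g * h)%g).
  by move=> Fu; have := Fg (g^-1)%g u Fu; rewrite /ltrans invgK.
have o := @open_nz R N.+1.
have t0 : (2 : R) != 0 by rewrite pnatr_eq0.
pose T := torus N t0.
pose A (f : SLn -> R[i]^o) := (fun h => f (T * h)%g) : SLn -> R[i]^o.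
pose delta (j : nat) (y : 'cV[R]_N) (f : SLn -> R[i]^o) : R[i] :=
  iter j (cderive (emb0 y)) (unlift f) (e0 R N).
have uH f : F f -> Hom d b (unlift f) /\ f = liftSL (unlift f) by move=> /FJ /unlift_Hom.
have shift (g : SLn) f : F f -> forall j v x, x != 0 ->
    iter j (cderive v) (unlift (fun h => f (g * h)%g)) x =
    iter j (cderive (slmx g *m v)) (unlift f) (slmx g *m x).
  move=> Ff j v x x0; have [hf ef] := uH f Ff.
  rewrite -(@cderive_iter_affine _ _ _ (fun z => slmx g *m z) v); last first.
    by move=> h z; rewrite mulmxDr -scalemxAr.
  apply: (iter_cderive_ext o) => // z z0; rewrite [in LHS]ef.
  have -> : (fun h => liftSL (unlift f) (g * h)%g) = liftSL (fun z => unlift f (slmx g *m z)).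
    by apply/funext => h; rewrite liftSL_mul.
  exact: unliftK.
pose c0 := chi d b ((2 : R) ^+ N).
have c00 : c0 != 0 by rewrite /c0 chi_pos ?exprn_gt0 ?ltr0n// expf_neq0// expf_neq0.
(* The torus element at s = 2 scales e_0 by 2^N and (0,y) by 1/2. An order-j derivative gains 2^-j
   from its directions and c0 / 2^(N j) from its base point. *)
pose mu (j : nat) : R[i] := (c0 * (((2 : R) ^+ N.+1) ^- j))%:C.
have mu_inj : injective mu.
  have q1 : (2 : R) ^+ N.+1 != 1 by rewrite gt_eqF// exprn_egt1// ltr1n.
  move=> i j /complexI/(mulfI c00)/invr_inj; apply: (ieexprIn _ q1).
  by rewrite exprn_gt0// ltr0n.
have dL j y c u v : F u -> F v -> delta j y (c *: u + v) = c * delta j y u + delta j y v.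
  move=> /uH[hu _] /uH[hv _]; have e00 := e0_neq0 R N.
  rewrite -(iter_cderiveZ o j (emb0 y) c hu.1 e00).
  by rewrite -(iter_cderiveD o j (emb0 y) (csmZ c o hu.1) hv.1 e00).
have dA j y f : F f -> delta j y (A f) = mu j * delta j y f.
  move=> Ff; have [hf _] := uH f Ff; have e00 := e0_neq0 R N.
  rewrite /delta /A shift// torus_emb0 torus_e0 (iter_cderiveZdir _ _ _ hf.1); last first.
    by rewrite scaler_eq0 negb_or e00 andbT expf_neq0.
  have hw : homw setT (chi d b) (unlift f) by move=> c x _; exact: hf.2.
  rewrite (homw_iter (emb0 y) j hf.1 hw) ?expf_neq0// mulrA -rmorphM /mu; congr (_%:C * _).
  by rewrite mulrCA -!exprVn -exprMn -exprS.
have [K hK] := bounded_support F0 FL Fs (Fg' T) mu_inj dL dA.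
move=> f Ff; have [hf ef] := uH f Ff.
suff [P hP eP] : exists2 P, @inmon R k d P & forall x, x != 0 -> unlift f x = P x.
  exists P => //; rewrite ef; apply/funext => g; apply: eP; exact: SL_e0_neq0.
apply: (ker_inmon hf) => x v x0.
have [[c ->]|vx] := pselect (exists c, v = c *: x); first exact: (@iter_cderive_self _ _ d.+1 b).
have {}vx c : v <> c *: x by move=> e; apply: vx; exists c.
(* [bounded_support] gives vanishing at e_0 of order at least K, carried to all independent pairs by
   translation within F; the maximum with d + 2 meets the strict bound of [line_degree]. *)
apply: (@line_degree _ _ d b _ hf x v x0 vx (maxn K d.+2)); first exact: leq_maxr.
move=> z w z0 wz; have [g [y [<- <-]]] := pair_transitive z0 wz.
rewrite -shift//; last exact: e0_neq0.
by apply: hK; [exact: Fg'|exact: leq_maxl].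
Qed.

Lemma monV_findim : findim_irreducible_subrep J (@monV R k d).
Proof.
have Vinv : invariant_subspace (@monV R k d).
  split.
  - by apply/monV_sum; exists (fun=> 0); rewrite big1// => u _; rewrite scale0r.
  - move=> c u v /monV_sum[cu ->] /monV_sum[cv ->]; apply/monV_sum.
    exists (fun w => c * cu w + cv w); rewrite scaler_sumr -big_split /=.
    by apply: eq_bigr => w _; rewrite scalerDl scalerA.
  - move=> g _ [P hP ->]; have hPH := inmon_Hom hP.
    (* A translated polynomial is recognised as a polynomial by the vanishing of its derivatives of
       order d + 1, not by expanding it. *)
    have [Q hQ e] : exists2 Q, @inmon R k d Q & forall x, x != 0 -> P (slmx g^-1%g *m x) = Q x.
      apply: (ker_inmon (Hom_mul g^-1%g hPH)) => x v x0.
      rewrite (@cderive_iter_affine _ _ _ (fun z => slmx g^-1%g *m z) v (slmx g^-1%g *m v)).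
        exact: inmon_iter.
      by move=> h z; rewrite mulmxDr -scalemxAr.
    exists Q => //; apply/funext => h; rewrite /ltrans liftSL_mul e//.
    exact: SL_e0_neq0.
split=> //.
- by move=> _ [P hP ->]; apply: Hom_Ind; exact: inmon_Hom.
- exists [seq lmon u | u <- enum {: {ffun 'I_d -> 'I_(1 + N)}}] => _ /monV_sum[c ->].
  pose u0 : {ffun 'I_d -> 'I_(1 + N)} := [ffun=> 0].
  exists (fun i => c (nth u0 (enum {: {ffun 'I_d -> 'I_(1 + N)}}) i)).
  rewrite -(big_mkord predT (fun i => c (nth u0 (enum {: {ffun 'I_d -> 'I_(1 + N)}}) i) *:
    [seq lmon u | u <- enum {: {ffun 'I_d -> 'I_(1 + N)}}]`_i)) size_map.
  rewrite (big_nth u0) enumT; apply: eq_big_nat => i /= hi.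
  by rewrite (nth_map u0).
- pose z : {ffun 'I_d -> 'I_(1 + N)} := [ffun=> 0]; move=> e; have : @monV R k d (lmon z).
    by exists (mon z) => //; rewrite mon_wmon; apply: inmon_wmon; rewrite size_codom card_ord.
  rewrite e => /(congr1 (fun f => f 1%g))/eqP; rewrite /lmon /liftSL /mon /= mul1mx.
  rewrite big1 ?oner_eq0// => j _.
  by rewrite ffunE mxE eqxx.
- by move=> E hE EV; exact: monV_irred.
Qed.

Lemma monV_unique F : findim_irreducible_subrep J F -> F = @monV R k d.
Proof.
move=> [FJ Finv Ffin F0 _]; have FV := findim_sub_monV FJ Finv Ffin.
by case: monV_findim => _ _ _ _ /(_ F Finv FV)[].
Qed.
End FiniteDimensionalSubrep.

(** * The Lie algebra action *)

Section InverseCurve.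
Variables (R : realType) (n : nat).
Local Notation SLn := (SL R n.+2).

Lemma Cn_cofactor K (U : set 'M[R]_n.+2) i j : open U -> Cn K U (fun A => cofactor A i j).
Proof.
move=> oU; apply: CnZ => //.
have cs a b : Cn K U (fun A => row' i (col' j A) a b).
  apply: (@Cn_ext _ _ K U (fun A => A (lift i a) (lift j b))) => //; last exact: Cn_coord.
  by move=> A _; rewrite !mxE.
by have := Cn_comp oU openT (fun _ _ => I) (Cn_det K openT) cs.
Qed.

(** The curve y(t) = exp(tX)^-1 x is differentiable because the inverse is the adjugate, polynomial
    in the entries. Differentiating exp(tX) y(t) = x at 0 then gives y'(0) = -X x. *)
Lemma SLexpV_derive (X : 'M[R]_n.+2) (x : 'cV[R]_n.+2) i j : \tr X = 0 ->
  is_derive (0 : R^o) 1 (fun t : R^o => (slmx (SLexp (t *: X))^-1%g *m x) i j) ((- X *m x) i j).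
Proof.
move=> trX; rewrite [j]ord1; pose A (t : R) := expm (t *: X).
have A0 : A 0 = 1%:M by rewrite /A scale0r expm_nilp ?addr0// mul0mx.
have slA (t : R) : slmx (SLexp (t *: X)) = A t by rewrite slmx_SLexp// linearZ /= trX mulr0.
have dA t : \det (A t) = 1 by rewrite -slA SL_det.
pose y (t : R^o) := slmx (SLexp (t *: X))^-1%g *m x.
have yE t : y t = \adj (A t) *m x.
  by rewrite /y /= slA /invmx unitmxE dA unitr1 invr1 scale1r.
have Ay t : A t *m y t = x by rewrite /y -slA mulKVmx// SL_unit.
have y0 : y 0 = x by rewrite -[RHS](Ay 0) A0 mul1mx.
have dAt t a b : is_derive (t : R^o) 1 (fun s : R^o => A s a b) ((X *m A t) a b).
  exact: is_derive_expm.
have [dy hy] : exists d : 'I_n.+2 -> R, forall a, is_derive (0 : R^o) 1 (fun t : R^o => y t a 0) (d a).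
  suff /choice[d hd] : forall a, exists d, is_derive (0 : R^o) 1 (fun t : R^o => y t a 0) d by exists d.
  move=> a; have -> : (fun t : R^o => y t a 0) = (fun M => \sum_b x b 0 * cofactor M b a) \o A.
    apply/funext => t; rewrite yE mulmx_entry /=; apply: eq_bigr => b _.
    by rewrite mxE mulrC.
  have hC : Cn 1 setT (fun M : 'M[R]_n.+2 => \sum_b x b 0 * cofactor M b a).
    apply: Cn_sum => [|b _]; first exact: openT.
    by apply: CnZ; [exact: openT|apply: Cn_cofactor; exact: openT].
  have sT (t : R^o) : setT t -> setT (A t) by [].
  eexists; exact: (comp_derive openT sT hC (I : setT (0 : R^o)) (dAt 0)).
suff -> : (- X *m x) i 0 = dy i by exact: hy.
have h : is_derive (0 : R^o) 1 (fun t : R^o => \sum_a A t i a * y t a 0)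
    (\sum_a (A 0 i a * dy a + y 0 a 0 * (X *m A 0) i a)).
  have -> : (fun t : R^o => \sum_a A t i a * y t a 0) =
     \sum_a ((fun t : R^o => A t i a) * (fun t : R^o => y t a 0)).
    by apply/funext => t; rewrite fct_sumE.
  apply: is_derive_sum => a; exact: is_deriveM.
have := @derive_val _ _ _ _ _ _ _ h.
have -> : (fun t : R^o => \sum_a A t i a * y t a 0) = cst (x i 0).
  by apply/funext => t; rewrite -mulmx_entry Ay.
rewrite derive_cst A0 mulmx1 big_split /= => /esym e.
have e1 : \sum_a (1%:M : 'M[R]_n.+2) i a * dy a = dy i.
  rewrite (bigD1 i)//= big1 => [|a ai]; first by rewrite mxE eqxx mul1r addr0.
  by rewrite mxE eq_sym (negbTE ai) mul0r.
move: e; rewrite e1 y0 => /eqP; rewrite addr_eq0 => /eqP ->.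
by rewrite mulNmx mxE mulmx_entry; congr (- _); apply: eq_bigr => a _; exact: mulrC.
Qed.
End InverseCurve.

Section CurveDerivative.
Variables (R : realType) (E : normedModType R).

Lemma is_cderive_ext (U : set E) f g x v (d : R[i]) : open U -> U x ->
  (forall y, U y -> f y = g y) -> is_cderive x v f d -> is_cderive x v g d.
Proof.
move=> oU Ux fg [h1 h2]; split; [move: h1|move: h2]; apply: near_eq_is_derive;
  by apply: near_open oU Ux _ => y /fg ->.
Qed.

Lemma is_cderive_realM (r : E -> R) (f : E -> R[i]) x v (dr : R) d :
  is_derive x v r dr -> is_cderive x v f d ->
  is_cderive x v (fun y => (r y)%:C * f y) (dr%:C * f x + (r x)%:C * d).
Proof.
move=> hr [h1 h2]; split.
  under [X in is_derive _ _ X]eq_fun do rewrite ReM mul0r subr0.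
  have := is_deriveM hr h1; congr (is_derive _ _ _ _).
  by rewrite ReD !ReM !mul0r !subr0 addrC; congr (_ + _); exact: mulrC.
under [X in is_derive _ _ X]eq_fun do rewrite ImM mul0r addr0.
have := is_deriveM hr h2; congr (is_derive _ _ _ _).
by rewrite ImD !ImM !mul0r !addr0 addrC; congr (_ + _); exact: mulrC.
Qed.

Variable n : nat.
Let o := @open_nz R n.
Implicit Types (w v : 'cV[R]_n) (psi : 'cV[R]_n -> R[i]).

Lemma cderive_coord w psi z : csm (@nz R n) psi -> z != 0 ->
  cderive w psi z = \sum_i (w i 0)%:C * cderive (delta_mx i 0) psi z.
Proof.
move=> hpsi z0; have -> : w = \sum_i w i 0 *: delta_mx i 0.
  apply/matrixP => i j; rewrite [j]ord1 summxE (bigD1 i)//= big1 => [|a ai].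
    by rewrite !mxE !eqxx mulr1 addr0.
  by rewrite !mxE eq_sym (negbTE ai) mulr0.
rewrite (cderive_sumdir _ _ o hpsi z0); apply: eq_bigr => i _; congr (_%:C * _).
rewrite summxE (bigD1 i)//= big1 => [|a ai]; first by rewrite !mxE !eqxx mulr1 addr0.
by rewrite !mxE eq_sym (negbTE ai) mulr0.
Qed.

Lemma iter_cderive_coord l v w psi z : csm (@nz R n) psi -> z != 0 ->
  iter l (cderive v) (cderive w psi) z =
  \sum_i (w i 0)%:C * iter l (cderive v) (cderive (delta_mx i 0) psi) z.
Proof.
move=> hpsi z0; have hd i : csm (@nz R n) (cderive (delta_mx i 0) psi) by exact: csm_cderive.
rewrite (@iter_cderive_ext _ _ _ o l v _ (fun y => \sum_i (w i 0)%:C * cderive (delta_mx i 0) psi y))//.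
  rewrite (iter_cderive_sum o _ l v (fun i => csmZ _ o (hd i)) z0).
  by apply: eq_bigr => i _; rewrite (iter_cderiveZ o).
by move=> y y0; exact: cderive_coord.
Qed.

Lemma cderive_iter_coord l u v w psi z : csm (@nz R n) psi -> z != 0 ->
  cderive u (iter l (cderive v) (cderive w psi)) z =
  \sum_i (w i 0)%:C * cderive u (iter l (cderive v) (cderive (delta_mx i 0) psi)) z.
Proof.
move=> hpsi z0; have hd i : csm (@nz R n) (iter l (cderive v) (cderive (delta_mx i 0) psi)).
  by apply: csm_iter; exact: csm_cderive.
rewrite (cderive_ext u o z0 (fun y y0 => iter_cderive_coord l v w hpsi y0)).
rewrite (cderive_sum _ u o (fun i => csmZ _ o (hd i)) z0).
by apply: eq_bigr => i _; rewrite (cderiveZ _ u (hd i) z0).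
Qed.

(** The product rule when both the base point and the l equal directions move. Derivatives commute,
    so the l directional contributions coincide; for l = 0 the factor l cancels the term with
    [l.-1]. *)
Lemma is_cderive_iter (U : set E) (x v : E) (w z : E -> 'cV[R]_n) (dw dz : 'cV[R]_n) l psi :
  open U -> U x -> (forall t, U t -> z t != 0) -> csm (@nz R n) psi ->
  (forall i, is_derive x v (fun t => w t i 0) (dw i 0)) ->
  (forall i, is_derive x v (fun t => z t i 0) (dz i 0)) ->
  is_cderive x v (fun t => iter l (cderive (w t)) psi (z t))
    (cderive dz (iter l (cderive (w x)) psi) (z x) +
     l%:R * cderive dw (iter l.-1 (cderive (w x)) psi) (z x)).
Proof.
move=> oU Ux z0 + hw hz; have zx0 := z0 x Ux; elim: l psi => [|l IH] psi hpsi.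
  rewrite mul0r addr0; apply: (is_cderive_comp o) => // i j.
  by rewrite [j]ord1.
have hd i : csm (@nz R n) (cderive (delta_mx i 0) psi) by exact: csm_cderive.
apply: (@is_cderive_ext U (fun t => \sum_i (w t i 0)%:C *
    iter l (cderive (w t)) (cderive (delta_mx i 0) psi) (z t))) => //.
  by move=> t Ut; rewrite iterSr iter_cderive_coord// z0.
have := is_cderive_sum (index_enum 'I_n) (fun i => is_cderive_realM (hw i) (IH _ (hd i))).
set D := \sum_(i <- _) _; set D' := (X in _ -> is_cderive _ _ _ X).
suff -> : D = D' by [].
rewrite /D big_split /= -(iter_cderive_coord l (w x) dw hpsi zx0).
under eq_bigr do rewrite mulrDr.
rewrite big_split /= /D'.
rewrite -(cderive_iter_coord l dz (w x) (w x) hpsi zx0) -iterSr.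
have -> : \sum_i (w x i 0)%:C *
   (l%:R * cderive dw (iter l.-1 (cderive (w x)) (cderive (delta_mx i 0) psi)) (z x)) =
  l%:R * cderive dw (iter l (cderive (w x)) psi) (z x).
  case: {IH D D'} l => [|l]; first by rewrite mul0r big1// => i _; rewrite mul0r mulr0.
  rewrite iterSr (cderive_iter_coord l dw (w x) (w x) hpsi zx0) mulr_sumr.
  by apply: eq_bigr => i _; exact: mulrCA.
rewrite -(iter_cderive_comm o l dw (w x) hpsi zx0).
move: (cderive dw _ _) (cderive dz _ _) => a b.
by rewrite -[l.+1%:R]nat1r mulrDl mul1r addrCA.
Qed.
End CurveDerivative.

Section VectorDerivative.
Variable R : realType.

Lemma smooth_SL_is_cderive n (f : SL R n -> R[i]) (c : R -> SL R n) (d : 'M[R]_n) : smooth_SL f ->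
  (forall i j, is_derive (0 : R^o) 1 (fun t : R^o => slmx (c t) i j) (d i j)) ->
  exists D, is_cderive (0 : R^o) 1 (fun t : R^o => f (c t)) D.
Proof.
move=> hf hc; have [U [F [oU Uc /smooth_onP hF eF]]] := hf (c 0).
have cc : {for (0 : R^o), continuous (fun s : R^o => slmx (c s))}.
  apply: cvg_mx => i j; have [h _] := hc i j.
  by apply: (@differentiable_continuous R R^o R^o); apply/derivable1_diffP.
have nU : \forall s \near (0 : R^o), F (slmx (c s)) = f (c s).
  have nU' : \forall s \near (0 : R^o), U (slmx (c s)).
    exact: cc (open_nbhs_nbhs (conj oU Uc)).
  by apply: filterS nU' => s; exact: eF.
have [h1 h2] := is_cderive_comp oU Uc hF hc.
by eexists; split; [move: h1|move: h2]; apply: near_eq_is_derive; apply: filterS nU => s ->.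
Qed.

Lemma is_cderive_eval (V : vectType R[i]) (phi : V -> R[i]) (c : R -> V) (t : R) :
  (forall a u v, phi (a *: u + v) = a * phi u + phi v) ->
  (forall i, exists d, is_cderive (t : R^o) 1
     (fun s : R^o => coord (vbasis (fullv : {vspace V})) i (c s)) d) ->
  is_cderive (t : R^o) 1 (fun s : R^o => phi (c s)) (phi (vderive c t)).
Proof.
move=> phiL hc; have phi0 : phi 0 = 0.
  have := phiL 1 0 0; rewrite scaler0 addr0 mul1r => /eqP.
  by rewrite -subr_eq0 opprD addrA addrN sub0r oppr_eq0 => /eqP.
have phiS (I : finType) (a : I -> R[i]) (b : I -> V) :
    phi (\sum_i a i *: b i) = \sum_i phi (b i) * a i.
  elim/big_rec2: _ => [//|i x y _ e].
  by rewrite phiL e mulrC.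
have [d hd] := choice hc.
have := is_cderive_sum (index_enum 'I_(\dim (fullv : {vspace V})))
   (fun i => is_cderiveZ (phi (vbasis (fullv : {vspace V}))`_i) (hd i)).
have -> : (fun s : R^o => phi (c s)) = (fun s : R^o => \sum_(i < \dim (fullv : {vspace V})) phi (vbasis (fullv : {vspace V}))`_i *
     coord (vbasis (fullv : {vspace V})) i (c s)).
  by apply/funext => s; rewrite {1}[c s](coord_vbasis (memvf _)) phiS.
congr (is_cderive _ _ _ _); rewrite /vderive phiS.
by apply: eq_bigr => i _; rewrite (is_cderive_val (hd i)).
Qed.
End VectorDerivative.

Section LieOperator.
Variables (R : realType) (k : nat).
Let N := k.+1.
Local Notation SLn := (SL R N.+1).
Let o := @open_nz R N.+1.
Implicit Types (X : 'M[R]_N.+1) (psi : 'cV[R]_N.+1 -> R[i]) (x v : 'cV[R]_N.+1).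

(** The linear vector field of the flow x |-> exp(-tX) x, which left translation induces on
    functions of g e_0. *)
Definition lieop X psi x : R[i] := cderive (- X *m x) psi x.

Lemma csm_lieop X psi : csm (@nz R _) psi -> csm (@nz R _) (lieop X psi).
Proof.
move=> h; apply: (@csm_ext _ _ _ (fun x => \sum_i ((- X *m x) i 0)%:C * cderive (delta_mx i 0) psi x)) => //.
  by move=> x x0; rewrite -cderive_coord.
apply: csm_sum => // i _; apply: csmM => //; last exact: csm_cderive.
by apply: csm_real => K; exact: Cn_mulmx.
Qed.

Lemma lieop_Hom d b X psi : Hom d b psi -> Hom d b (lieop X psi).
Proof.
move=> hom; have [h1 h2] := hom; split; first exact: csm_lieop.
move=> c x c0 x0; have hw : homw setT (chi d b) psi by move=> s z _; exact: h2.
have cx0 : c *: x != 0 by rewrite scaler_eq0 negb_or c0.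
rewrite /lieop -scalemxAr (cderiveZdir o _ _ h1 cx0) (homw_cderive _ h1 hw)// mulrA -rmorphM.
by rewrite mulrCA mulfV// mulr1.
Qed.

Lemma is_derive_mulmx X x v i : is_derive x v (fun z => (X *m z) i 0) ((X *m v) i 0).
Proof.
have h a : is_derive x v (fun z : 'cV[R]_N.+1 => X i a *: (z a 0 : R^o)) (X i a *: (v a 0 : R^o)).
  by apply: is_deriveZ; exact: is_derive_coord.
have := is_derive_sum h.
rewrite mulmx_entry; congr (is_derive _ _ _ _); apply/funext => z.
by rewrite fct_sumE mulmx_entry.
Qed.

(** The commutator of D_v with the linear field x |-> -X x is the constant field -X v, which
    commutes with D_v; each of the l derivatives adds one copy. *)
Lemma iter_lieop X psi v l x : csm (@nz R _) psi -> x != 0 ->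
  iter l (cderive v) (lieop X psi) x =
  cderive (- X *m x) (iter l (cderive v) psi) x +
  l%:R * cderive (- X *m v) (iter l.-1 (cderive v) psi) x.
Proof.
move=> hpsi; elim: l x => [|l IH] x x0; first by rewrite mul0r addr0.
have hF := csm_iter l v hpsi.
rewrite iterS (cderive_ext v o x0 IH).
have h1 := csm_lieop X hF.
have h2 : csm (@nz R _) (cderive (- X *m v) (iter l.-1 (cderive v) psi)).
  by apply: csm_cderive; exact: csm_iter.
rewrite (cderiveD v h1 (csmZ l%:R o h2) x0) (cderiveZ _ v h2 x0).
have := is_cderive_iter 1 o x0 (fun t t0 => t0) hF
  (fun i => is_derive_mulmx (- X) x v i) (fun i => is_derive_coord x v i 0).
move=> /is_cderive_val /= ->; rewrite mul1r (cderive_comm _ _ o hF x0) -addrA; congr (_ + _).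
have -> : l%:R * cderive v (cderive (- X *m v) (iter l.-1 (cderive v) psi)) x =
   l%:R * cderive (- X *m v) (iter l (cderive v) psi) x.
  case: {IH hF h1 h2} l => [|l]; first by rewrite !mul0r.
  by rewrite (cderive_comm _ _ o (csm_iter l v hpsi) x0).
move: (cderive _ _ _) => a.
by rewrite -nat1r mulrDl mul1r.
Qed.

Lemma diff_ltrans_lift X psi : \tr X = 0 -> csm (@nz R _) psi ->
  diff_ltrans X (liftSL psi) = liftSL (lieop X psi).
Proof.
move=> trX hpsi; apply/funext => h; apply: vderive_scalar.
set x := slmx h *m e0 R N; have x0 : x != 0 := SL_e0_neq0 h.
pose s (t : R^o) := slmx (SLexp (t *: X))^-1%g *m x.
have s0 : s 0 = x.
  by rewrite /s /= scale0r slmx_SLexp ?mxtrace0// expm_nilp ?mul0mx// addr0 invmx1 mul1mx.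
have ds i j : is_derive (0 : R^o) 1 (fun t => s t i j) ((- X *m x) i j) by exact: SLexpV_derive.
have -> : (fun t : R^o => ltrans (SLexp (t *: X)) (liftSL psi) h) = (fun t : R^o => psi (s t)).
  by apply/funext => t; rewrite /ltrans liftSL_mul.
rewrite -[liftSL _ h]/(cderive (- X *m x) psi x).
move: s s0 ds => s s0 ds.
rewrite -[X in cderive _ _ X]s0.
apply: (is_cderive_comp o) ds => //.
by rewrite s0.
Qed.
End LieOperator.

Section LieAction.
Variables (R : realType) (k : nat).
Let N := k.+1.
Local Notation SLn := (SL R N.+1).
Let o := @open_nz R N.+1.
Implicit Types (X : 'M[R]_N.+1) (Z : 'M[R[i]]_N.+1) (psi : 'cV[R]_N.+1 -> R[i]) (x v : 'cV[R]_N.+1).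

(** Translating h by exp(-tX) moves the direction h(0,y) and the base point h e_0 together. The
    resulting product rule is term by term the expansion in [iter_lieop]. *)
Lemma diff_ltrans_DL l X psi : \tr X = 0 -> csm (@nz R _) psi ->
  diff_ltrans X (DL l psi) = DL l (lieop X psi).
Proof.
move=> trX hpsi; apply/funext => h; apply: dhomog_real_inj => y.
rewrite DL_eval; last exact: csm_lieop.
set x := slmx h *m e0 R N; set w := slmx h *m emb0 y.
have x0 : x != 0 := SL_e0_neq0 h.
pose phi (p : dhomog N R[i] l) := meval (rpt y) (mpoly_of_dhomog p).
pose g (t : R) := ((SLexp (t *: X))^-1 * h)%g.
pose s (t : R^o) (u : 'cV[R]_N.+1) := slmx (SLexp (t *: X))^-1%g *m u.
have s0 (u : 'cV[R]_N.+1) : s 0 u = u.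
  by rewrite /s /= scale0r slmx_SLexp ?mxtrace0// expm_nilp ?mul0mx// addr0 invmx1 mul1mx.
have ds (u : 'cV[R]_N.+1) i j : is_derive (0 : R^o) 1 (fun t => s t u i j) ((- X *m u) i j).
  exact: SLexpV_derive.
have sn t u : u != 0 -> s t u != 0 by move=> u0; exact: SL_mul_neq0.
have dg i j : is_derive (0 : R^o) 1 (fun t : R^o => slmx (g t) i j) ((- X *m slmx h) i j).
  have e (A : 'M[R]_N.+1) : (A *m slmx h) i j = (A *m col j (slmx h)) i 0.
    by rewrite !mulmx_entry; apply: eq_bigr => a _; rewrite [col _ _ _ _]mxE.
  rewrite e; have := ds (col j (slmx h)) i 0.
  by congr (is_derive _ _ _ _); apply/funext => t; rewrite /g /s -e.
have phiL a p q : phi (a *: p + q) = a * phi p + phi q.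
  by rewrite /phi mpoly_of_dhomogD mpoly_of_dhomogZ mevalD mevalZ.
have hc i := smooth_SL_is_cderive (@DL_smooth R k l psi hpsi i) dg.
have := is_cderive_val (is_cderive_eval phiL hc).
rewrite -[vderive _ _]/(diff_ltrans X (DL l psi) h) -[phi _]/(meval _ _) => <-.
have -> : (fun t : R^o => phi (DL l psi (g t))) =
    (fun t : R^o => (l`!%:R)^-1 * iter l (cderive (s t w)) psi (s t x)).
  by apply/funext => t; rewrite /phi DL_eval// /s /w /x !mulmxA.
clearbody s.
have H := @is_cderive_iter R R^o N.+1 setT 0 1 (fun t => s t w) (fun t => s t x) (- X *m w) (- X *m x)
  l psi openT I (fun t _ => sn t x x0) hpsi (fun i => ds w i 0) (fun i => ds x i 0).
rewrite (is_cderive_val (is_cderiveZ _ H)) iter_lieop//.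
by rewrite !s0.
Qed.

Lemma tr_Re_Im Z : \tr Z = 0 ->
  \tr (map_mx (@complex.Re R) Z) = 0 /\ \tr (map_mx (@complex.Im R) Z) = 0.
Proof.
move=> trZ; split.
  rewrite -[RHS](congr1 (@complex.Re R) trZ) /mxtrace Re_sum.
  by apply: eq_bigr => i _; rewrite mxE.
rewrite -[RHS](congr1 (@complex.Im R) trZ) /mxtrace Im_sum.
by apply: eq_bigr => i _; rewrite mxE.
Qed.

(** The summands are ordered to fit the shape a psi + phi of [DL_lin] and [HomL]. *)
Definition lieC Z psi x : R[i] :=
  'i * lieop (map_mx (@complex.Im R) Z) psi x + lieop (map_mx (@complex.Re R) Z) psi x.

Lemma HomL d b (a : R[i]) psi phi : Hom d b psi -> Hom d b phi ->
  Hom d b (fun x => a * psi x + phi x).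
Proof.
move=> [h1 h2] [h3 h4]; split; first by apply: csmD => //; exact: csmZ.
by move=> c x c0 x0; rewrite h2// h4// mulrDr mulrCA.
Qed.

Lemma lieC_Hom d b Z psi : Hom d b psi -> Hom d b (lieC Z psi).
Proof. by move=> h; apply: HomL; exact: lieop_Hom. Qed.

Lemma lie_act_lift Z psi : \tr Z = 0 -> csm (@nz R _) psi ->
  lie_act Z (liftSL psi) = liftSL (lieC Z psi).
Proof.
move=> /tr_Re_Im[h1 h2] hpsi; apply/funext => g.
by rewrite /lie_act !diff_ltrans_lift// addrC.
Qed.

Lemma lie_act_DL l Z psi : \tr Z = 0 -> csm (@nz R _) psi ->
  lie_act Z (DL l psi) = DL l (lieC Z psi).
Proof.
move=> /tr_Re_Im[h1 h2] hpsi; apply/funext => g.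
by rewrite /lie_act !diff_ltrans_DL// addrC DL_lin//; exact: csm_lieop.
Qed.
End LieAction.

(** * The image *)

Section ImageIso.
Variables (R : realType) (N : nat) (V V' : vectType R[i]).
Local Notation SLn := (SL R N).
Variables (A B : set (SLn -> V)) (D : (SLn -> V) -> (SLn -> V')).
Hypotheses (Ainv : invariant_subspace A)
  (Alie : forall Z f, \tr Z = 0 -> A f -> A (lie_act Z f))
  (Dlin : forall (c : R[i]) f f', A f -> A f' -> D (c *: f + f') = c *: D f + D f')
  (Dg : forall g f, A f -> D (ltrans g f) = ltrans g (D f))
  (Dlie : forall Z f, \tr Z = 0 -> A f -> D (lie_act Z f) = lie_act Z (D f))
  (DB : forall f, A f -> (B f <-> D f = 0)).

Let A0 : A 0. Proof. by case: Ainv. Qed.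
Let AL : forall (c : R[i]) u v, A u -> A v -> A (c *: u + v). Proof. by case: Ainv. Qed.
Let Ag : forall g u, A u -> A (ltrans g u). Proof. by case: Ainv. Qed.

Lemma in_span_map (W W' : vectType R[i]) (f : (SLn -> W) -> (SLn -> W')) (s : seq (SLn -> W))
    (c : 'I_(size s) -> R[i]) : in_span (map f s) (\sum_i c i *: f s`_i).
Proof.
exists (fun i => c (cast_ord (size_map f s) i)).
rewrite (reindex (cast_ord (size_map f s))) /=; last first.
  by exists (cast_ord (esym (size_map f s))) => i _; rewrite ?cast_ordK ?cast_ordKV.
apply: eq_bigr => i _; congr (_ *: _).
by rewrite (nth_map 0)// -(size_map f).
Qed.

Let AB (f g : SLn -> V) : A f -> A g -> A (f - g) /\ D (f - g) = D f - D g.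
Proof.
move=> Af Ag'; rewrite -[- g]scaleN1r addrC; split; first exact: AL.
by rewrite Dlin// scaleN1r addrC.
Qed.

Let B_sub (f g : SLn -> V) : A f -> A g -> D f = D g -> B (f - g).
Proof.
move=> Af Ag' e; have [h1 h2] := AB Af Ag'; apply/(DB h1).
by rewrite h2 e subrr.
Qed.

Let AS (I : Type) (r : seq I) (c : I -> R[i]) (f : I -> SLn -> V) : (forall i, A (f i)) ->
  A (\sum_(i <- r) c i *: f i) /\
  D (\sum_(i <- r) c i *: f i) = \sum_(i <- r) c i *: D (f i).
Proof.
move=> hf; elim: r => [|i r [h1 h2]].
  rewrite !big_nil; split=> //; have := Dlin 1 A0 A0.
  rewrite scaler0 scale1r addr0 => /eqP.
  by rewrite -subr_eq0 opprD addrA addrN sub0r oppr_eq0 => /eqP.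
by rewrite !big_cons Dlin// h2; split=> //; exact: AL.
Qed.

Let phi (u : SLn -> V') : SLn -> V := xget 0 [set f | A f /\ D f = u].

Let phiP u : (D @` A) u -> A (phi u) /\ D (phi u) = u.
Proof. by move=> [f Af Df]; apply: (@xgetPex _ 0 [set f | A f /\ D f = u]); exists f. Qed.

Let imL (c : R[i]) u v : (D @` A) u -> (D @` A) v -> (D @` A) (c *: u + v).
Proof. by move=> [f Af <-] [g Ag' <-]; exists (c *: f + g); [exact: AL|exact: Dlin]. Qed.

(** The map [phi] picks a preimage under D. Two preimages differ by an element of B, so every
    identity holds modulo B. K-finiteness is transported by moving finite spanning families through
    [phi] in one direction and D in the other. *)
Lemma gK_iso_image : gK_iso (Kfinite (subrep (D @` A))) (Kfinite (Subquot A B)).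
Proof.
exists phi; split.
- move=> u [/= /phiP[Au Du] [s sA hs]]; split=> //.
  have sA' (i : 'I_(size s)) : A (phi s`_i) /\ D (phi s`_i) = s`_i by apply/phiP/sA/mem_nth.
  exists (map phi s) => [_ /mapP[w ws ->]|k hk]; first exact: (phiP (sA w ws)).1.
  have [w [c wE] /= /eqP] := hs k hk; rewrite subr_eq0 => /eqP e.
  exists (\sum_i c i *: phi s`_i); first exact: in_span_map.
  have [h1 h2] := AS (index_enum 'I_(size s)) c (fun i => (sA' i).1).
  apply: B_sub => //; first exact: Ag.
  rewrite h2 Dg// Du e wE; apply: eq_bigr => i _.
  by rewrite (sA' i).2.
- move=> c u v [/= uI _] [/= vI _]; have [Au Du] := phiP uI; have [Av Dv] := phiP vI.
  have [Aw Dw] := phiP (imL c uI vI).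
  apply: B_sub => //; first exact: AL.
  by rewrite Dw Dlin// Du Dv.
- move=> u [/= uI _]; have [Au Du] := phiP uI.
  by have := DB Au; rewrite Du.
- move=> u' [/= Au' [s sA hs]]; have uI : (D @` A) (D u') by exists u'.
  have [Au Du] := phiP uI; exists (D u'); last exact: B_sub.
  split=> //; exists (map D s) => [_ /mapP[w ws ->]|k hk]; first by exists w => //; exact: sA.
  have [w [c wE] Bw] := hs k hk.
  have sA' (i : 'I_(size s)) : A s`_i by apply/sA/mem_nth.
  have [h1 h2] := AS (index_enum 'I_(size s)) c sA'.
  exists (\sum_i c i *: D s`_i); first exact: in_span_map.
  have Aw : A w by rewrite wE.
  have [h3 h4] := AB (Ag k Au') Aw.
  by move/(DB h3): Bw; rewrite h4 Dg// {1}wE h2 => ->.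
- split=> [k u _ [/= uI _]|Z u trZ [/= uI _]]; have [Au Du] := phiP uI.
    have [Aw Dw] : A (phi (ltrans k u)) /\ D (phi (ltrans k u)) = ltrans k u.
      by apply: phiP; exists (ltrans k (phi u)); [exact: Ag|rewrite Dg// Du].
    by apply: B_sub => //; [exact: Ag|rewrite Dw Dg// Du].
  have [Aw Dw] : A (phi (lie_act Z u)) /\ D (phi (lie_act Z u)) = lie_act Z u.
    by apply: phiP; exists (lie_act Z (phi u)); [exact: Alie|rewrite Dlie// Du].
  by apply: B_sub => //; [exact: Alie|rewrite Dw Dlie// Du].
Qed.
End ImageIso.

Section Main.
Variables (R : realType) (k m l : nat) (alpha : int).
Hypotheses (l0 : (0 < l)%N) (ha : alpha = 1 \/ alpha = -1).
Let N := k.+1.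
Let d := l.-1.
Let b := sgn_add alpha m.
Let I := @Itriv R k alpha (1 - (m + l)%:R).
Let J := @Jpoly R k l (sgn_add alpha (m + l)) (1 + l%:R / N%:R).
Let Jt := @Jtriv R k b (1 - l%:R).
Implicit Types (f : SL R N.+1 -> R[i]^o) (psi : 'cV[R]_(1 + N) -> R[i]).

Let hb : b = 1 \/ b = -1.
Proof.
rewrite /b /sgn_add; case: ha => ->; rewrite -signr_odd; case: (odd m); by [left|right].
Qed.

Let nuE : 1 - l%:R = - d%:R :> R.
Proof. by rewrite /d -{1}(prednK l0) -natr1 opprD addrCA addrN addr0. Qed.

Let lamE : 1 - (m + l)%:R = - (m + d)%:R :> R.
Proof. by rewrite natrD opprD addrCA nuE -opprD -natrD. Qed.

Let JtP f : Jt f <-> Hom d b (unlift f) /\ f = liftSL (unlift f).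
Proof.
rewrite /Jt /Jtriv nuE; split; first exact: unlift_Hom.
by move=> [h ->]; exact: Hom_Ind.
Qed.

Let Jt_lift psi : Hom d b psi -> Jt (liftSL psi).
Proof. by move=> h; rewrite /Jt /Jtriv nuE; exact: Hom_Ind. Qed.

Definition Dlift f : SL R N.+1 -> dhomog N R[i] l := DL l (unlift f).

Let Dlift_lift psi : Hom d b psi -> Dlift (liftSL psi) = DL l psi.
Proof.
move=> h; have h' : Hom d b (unlift (liftSL psi)).
  by apply: Hom_ext h => x x0; rewrite unliftK.
apply: DL_ext h'.1 h.1 _ => x; exact: unliftK.
Qed.

Let DL_J psi : Hom d b psi -> J (DL l psi).
Proof.
move=> h; have := DL_Ind l0 hb h.
by rewrite /J /Jpoly /b /sgn_add exprD mulrA.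
Qed.

(** The chosen value is forced: two elements of J with the same coordinates on N'_- agree by
    density. *)
Lemma DSBO_lift Psi : Hom (m + d) alpha Psi ->
  DSBO m J (liftSL Psi) = DL l (restm m Psi) /\
  J (DL l (restm m Psi)) /\ coord_DO m (liftSL Psi) (DL l (restm m Psi) : SL R k.+2 -> dhomog k.+1 R[i] l).
Proof.
move=> h; have h1 := DL_J (restm_Hom ha h); have h2 := DL_coord m l h.1.
split=> //; apply: xget_unique => // phi' [J' c'].
apply: (Ind_nbar_inj J' h1) => x; apply: val_inj.
exact: etrans (c' x) (esym (h2 x)).
Qed.

Lemma Itriv_lift F : I F -> exists2 Psi, Hom (m + d) alpha Psi & F = liftSL Psi.
Proof. by rewrite /I /Itriv lamE => /Ind_Hom. Qed.

Lemma DSBO_symmetry_breaking : symmetry_breaking m I J.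
Proof.
split=> [F /Itriv_lift[Psi h ->]|g F /Itriv_lift[Psi h ->]].
  by have [-> ?] := DSBO_lift h.
have -> : ltrans (SLemb g) (liftSL Psi) = liftSL (fun x => Psi (slmx (SLemb g)^-1%g *m x)).
  by apply/funext => h'; rewrite /ltrans liftSL_mul.
have h' := Hom_mul (SLemb g)^-1%g h.
rewrite (DSBO_lift h').1 (DSBO_lift h).1.
have hr := restm_Hom ha h.
rewrite -(DL_ltrans l g hr.1); apply: DL_ext.
- exact: (restm_Hom ha h').1.
- exact: (Hom_mul g^-1%g hr).1.
- by move=> x _; exact: restm_ltrans.
Qed.

(** Since the normal derivative is onto, m enters the image only through the sign [b]. *)
Lemma DSBO_image : DSBO m J @` I = Dlift @` Jt.
Proof.
apply/seteqP; split=> [_ [F /Itriv_lift[Psi h ->] <-]|_ [f /JtP[h fE] <-]] /=.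
  have hr := restm_Hom ha h.
  exists (liftSL (restm m Psi)); first exact: Jt_lift.
  by rewrite Dlift_lift// (DSBO_lift h).1.
have he := extm_Hom ha h; exists (liftSL (extm m (unlift f))).
  by rewrite /I /Itriv lamE; exact: Hom_Ind.
rewrite (DSBO_lift he).1; apply: DL_ext.
- exact: (restm_Hom ha he).1.
- exact: h.1.
- by move=> x x0; exact: restm_extm h.1 x0.
Qed.

(** Common to both parities: B is 0 in one case and the space of homogeneous polynomials of degree l
    - 1 in the other. *)
Lemma image_iso (B : set (SL R N.+1 -> R[i]^o)) :
  (forall psi, Hom d b psi -> B (liftSL psi) <-> DL l psi = 0) ->
  gK_iso (Kfinite (Im_DSBO m I J)) (Kfinite (Subquot Jt B)).
Proof.
move=> hB; rewrite /Im_DSBO DSBO_image; apply: gK_iso_image.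
- split.
  + have -> : 0 = liftSL (fun=> 0) :> (SL R N.+1 -> R[i]^o) by apply/funext.
    apply: Jt_lift; split; first exact: csm_cst.
    by move=> c x _ _; rewrite mulr0.
  + move=> c u v /JtP[hu ->] /JtP[hv ->]; exact: (Jt_lift (HomL c hu hv)).
  + move=> g u /JtP[hu ->].
    have -> : ltrans g (liftSL (unlift u)) = liftSL (fun x => unlift u (slmx g^-1%g *m x)).
      by apply/funext => h'; rewrite /ltrans liftSL_mul.
    by apply: Jt_lift; exact: Hom_mul.
- by move=> Z u trZ /JtP[hu ->]; rewrite (lie_act_lift trZ hu.1); apply: Jt_lift; exact: lieC_Hom.
- move=> c u v /JtP[hu _] /JtP[hv _].
  rewrite /Dlift -[unlift (c *: u + v)]/(fun x => c * unlift u x + unlift v x).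
  by rewrite (DL_lin l c hu.1 hv.1).
- move=> g u /JtP[hu uE]; rewrite {1}uE.
  have -> : ltrans g (liftSL (unlift u)) = liftSL (fun x => unlift u (slmx g^-1%g *m x)).
    by apply/funext => h'; rewrite /ltrans liftSL_mul.
  by rewrite (Dlift_lift (Hom_mul _ hu)); exact: DL_ltrans hu.1.
- move=> Z u trZ /JtP[hu uE]; rewrite {1}uE (lie_act_lift trZ hu.1).
  by rewrite (Dlift_lift (lieC_Hom Z hu)) /Dlift (lie_act_DL l trZ hu.1).
- by move=> u /JtP[hu uE]; rewrite {1}uE; exact: hB.
Qed.

Lemma image_iso_mismatch : b <> (-1) ^+ d ->
  gK_iso (Kfinite (Im_DSBO m I J)) (Kfinite (subrep Jt)).
Proof.
move=> mis; apply: image_iso => psi hpsi; split=> [/= e|]; last exact: (DL_inj_mismatch l0 hb mis hpsi).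
apply: etrans (_ : DL l (fun=> 0) = 0).
  apply: DL_ext; [exact: hpsi.1|exact: csm_cst|move=> x x0].
  by rewrite -(unliftK psi x0) e.
have h0 : csm (@nz R (1 + N)) (fun=> 0) by exact: csm_cst.
have := DL_lin l (-1) h0 h0; rewrite mulr0 addr0 => ->.
by apply/funext => g; rewrite scaleN1r addNr.
Qed.

Lemma image_iso_match : b = (-1) ^+ d ->
  gK_iso (Kfinite (Im_DSBO m I J)) (Kfinite (@Tquot R k l b)).
Proof.
(* [Fsub] is a chosen subrepresentation; existence and uniqueness together identify it with the
   homogeneous polynomials. *)
move=> mat; have FE : @Fsub R k l b = @monV R k d.
  apply: xget_unique => [|F]; first by rewrite /= /Jtriv nuE mat; exact: monV_findim.
  by rewrite /= /Jtriv nuE mat; exact: monV_unique.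
rewrite /Tquot FE; apply: image_iso => psi hpsi.
have hpsi' : Hom d ((-1) ^+ d) psi by rewrite -mat.
rewrite (DL_ker l0 hpsi); split=> [[P hP e] x v x0|h].
  rewrite (@iter_cderive_ext _ _ _ (@open_nz R _) l v _ P) //; last first.
    by move=> y y0; rewrite -(unliftK psi y0) e unliftK.
  by rewrite -(prednK l0); exact: inmon_iter.
have [|P hP e] := ker_inmon hpsi'; first by rewrite /d prednK.
by exists P => //; apply/funext => g; rewrite /liftSL e//; exact: SL_e0_neq0.
Qed.
End Main.

Theorem proposition8p7 (R : realType) (n m l : nat) (alpha : int)
    (hn : (3 <= n)%N) (hm : (1 <= m)%N) (hl : (1 <= l)%N)
    (halpha : alpha = 1 \/ alpha = -1) :
  let k := (n - 2)%N in
  let I := @Itriv R k alpha (1 - (m + l)%:R) in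
  let J := @Jpoly R k l (sgn_add alpha (m + l)) (1 + l%:R / (n - 1)%:R) in
  let ImD := Im_DSBO m I J in
  let Jt := subrep (@Jtriv R k (sgn_add alpha m) (1 - l%:R)) in
  let T := @Tquot R k l (sgn_add alpha m) in
  [/\ symmetry_breaking m I J,
      alpha = (-1) ^+ m ->
        (odd l -> gK_iso (Kfinite ImD) (Kfinite T)) /\
        (~~ odd l -> gK_iso (Kfinite ImD) (Kfinite Jt)) &
      alpha = (-1) ^+ m.+1 ->
        (odd l -> gK_iso (Kfinite ImD) (Kfinite Jt)) /\
        (~~ odd l -> gK_iso (Kfinite ImD) (Kfinite T))].
Proof.
move=> k; have -> : (n - 1 = k.+1)%N by rewrite /k -subSn// (ltnW hn).
move: k => k I J ImD Jt T.
have sE : (-1) ^+ l.-1 = - (-1) ^+ odd l :> int.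
  by rewrite signr_odd -{2}(prednK hl) exprS mulN1r opprK.
(* The values e = 0 and e = 1 are the two cases of the theorem: the sign alpha (-1)^m is 1 in the
   first and -1 in the second, to be compared with (-1)^(l-1). *)
have bE e : alpha = (-1) ^+ (e + m) -> sgn_add alpha m = (-1) ^+ e.
  by move=> ->; rewrite /sgn_add -exprD -addnA addnn exprD -[(-1) ^+ m.*2]signr_odd odd_double mulr1.
split; first exact: DSBO_symmetry_breaking.
- move=> /(bE 0%N) b1; split=> ol.
    by apply: image_iso_match => //; rewrite sE ol b1.
  by apply: image_iso_mismatch => //; rewrite sE (negbTE ol) b1.
- move=> /(bE 1%N) b1; split=> ol.
    by apply: image_iso_mismatch => //; rewrite sE ol b1.
  by apply: image_iso_match => //; rewrite sE (negbTE ol) b1.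
Qed.
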